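(* Let $n\ge 0$ be an integer, let $1<p<\infty$ and let $q:=\frac{p}{p-1}$ be the conjugate exponent of $p$. Then the Bergman projection $P_{\mathcal{U}^n}$ satisfies $$\frac{\Gamma\left(\frac{n+2}{p}\right)\Gamma\left(\frac{n+2}{q}\right)}{\Gamma^2\left(\frac{n+2}{2}\right)}\;\le\;\|P_{\mathcal{U}^n}\|_{p\to p}\;\le\;\frac{(n+1)!}{\Gamma^2\left(\frac{n+2}{2}\right)}\,\frac{\pi}{\sin\frac{\pi}{p}},$$ where $$\|P_{\mathcal{U}^n}\|_{p\to p}:=\sup\left\{\frac{\|P_{\mathcal{U}^n}f\|_p}{\|f\|_p}: f\in L^p(\mathcal{U}^n),\ f\neq 0\right\}.$$
   Context: Write points of $\mathbb{C}^{n+1}$ as $z=(z',z_{n+1})$ with $z'=(z_1,\dots,z_n)\in\mathbb{C}^n$, $z_{n+1}\in\mathbb{C}$, and $z'\cdot\overline{w'}=\sum_{j=1}^n z_j\overline{w_j}$. The Siegel upper half-space is $\mathcal{U}^n=\{z\in\mathbb{C}^{n+1}:\operatorname{Im}z_{n+1}>|z'|^2\}$ (so $\mathcal{U}^0$ is the upper half-plane). $dV$ is Lebesgue measure on $\mathbb{C}^{n+1}$ and $\|f\|_p=\left(\int_{\mathcal{U}^n}|f|^p\,dV\right)^{1/p}$ is the norm of $L^p(\mathcal{U}^n)$; $A^p(\mathcal{U}^n)$ is the closed subspace of holomorphic functions in $L^p(\mathcal{U}^n)$. Put $$\boldsymbol{\rho}(z,w):=\tfrac{i}{2}(\overline{w}_{n+1}-z_{n+1})-z'\cdot\overline{w'}.$$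 The Bergman projection (the orthogonal projection of $L^2(\mathcal{U}^n)$ onto $A^2(\mathcal{U}^n)$) is the integral operator $$(P_{\mathcal{U}^n}f)(z)=\frac{(n+1)!}{4\pi^{n+1}}\int_{\mathcal{U}^n}\boldsymbol{\rho}(z,w)^{-n-2}f(w)\,dV(w),$$ which extends to a bounded operator from $L^p(\mathcal{U}^n)$ to $A^p(\mathcal{U}^n)$ for $1<p<\infty$. *)

(* Defs.v *)
From HB Require Import structures.
From mathcomp Require Import all_boot all_order all_algebra.
From mathcomp Require Import all_classical all_reals all_analysis.
From mathcomp Require Import complex.

Set Implicit Arguments.
Unset Strict Implicit.
Unset Printing Implicit Defensive.
Import Order.TTheory GRing.Theory Num.Theory.
Import numFieldNormedType.Exports.

Local Open Scope classical_set_scope.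
Local Open Scope ring_scope.
Local Open Scope complex_scope.

Section sigma_finite_pushforward.
Context d d' (T1 : measurableType d) (T2 : measurableType d') (R : realType).
Context (m : {sigma_finite_measure set T1 -> \bar R}) (f : T1 -> T2)
  (g : T2 -> T1).
Context (mf : measurable_fun [set: T1] f) (mg : measurable_fun [set: T2] g)
  (fK : cancel f g).

Let pf := pushforward m f.

Let pf0 : pf set0 = 0%E. Proof. exact: (measure0 (pushforward m f)). Qed.

Let pf_ge0 A : (0 <= pf A)%E.
Proof. exact: (measure_ge0 (pushforward m f)). Qed.

Let pf_sigma_additive : semi_sigma_additive pf.
Proof. exact: (@measure_semi_sigma_additive _ _ _ (pushforward m f)). Qed.

HB.instance Definition _ := isMeasure.Build _ _ _ pf
  pf0 pf_ge0 pf_sigma_additive.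

Let pf_sigma_finite : sigma_finite setT pf.
Proof.
have [F FT Foo] := sigma_finiteT m.
exists (fun k => g @^-1` F k); first by rewrite -preimage_bigcup -FT.
move=> k; have [mF Fk] := Foo k; split.
  by rewrite -[X in measurable X]setTI; exact: mg.
rewrite /pf /pushforward; suff -> : f @^-1` (g @^-1` F k) = F k by [].
by apply/seteqP; split=> x /=; rewrite fK.
Qed.

HB.instance Definition _ := Measure_isSigmaFinite.Build _ _ _ pf
  pf_sigma_finite.

Definition sigma_finite_pushforward :
  {sigma_finite_measure set T2 -> \bar R} := pf.

End sigma_finite_pushforward.

(* The library makes [m1 \x m2] a sigma-finite measure only for
   sub-probabilities. *)
Section sigma_finite_product.
Local Open Scope ereal_scope.
Context d1 d2 (T1 : measurableType d1) (T2 : measurableType d2) (R : realType).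
Context (m1 : {sigma_finite_measure set T1 -> \bar R})
  (m2 : {sigma_finite_measure set T2 -> \bar R}).

Let pm := m1 \x m2.

HB.instance Definition _ := Measure.on pm.

Let pm_sigma_finite : sigma_finite setT pm.
Proof.
have /sigma_finiteP[F [TF ndF Foo]] := sigma_finiteT m1.
have /sigma_finiteP[G [TG ndG Goo]] := sigma_finiteT m2.
exists (fun n => F n `*` G n).
  apply/esym/seteqP; split=> // -[x y] _.
  have [i _ Fix] : (\bigcup_k F k) x by rewrite -TF.
  have [j _ Gjy] : (\bigcup_k G k) y by rewrite -TG.
  exists (maxn i j) => //; split.
  - by move: x Fix; exact/subsetPset/ndF/leq_maxl.
  - by move: y Gjy; exact/subsetPset/ndG/leq_maxr.
move=> k; have [? ?] := Foo k; have [? ?] := Goo k.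
split; first exact: measurableX.
by rewrite /pm product_measure1E// lte_mul_pinfty// ge0_fin_numE.
Qed.

HB.instance Definition _ := Measure_isSigmaFinite.Build _ _ _ pm
  pm_sigma_finite.

Definition sigma_finite_product :
  {sigma_finite_measure set (T1 * T2)%type -> \bar R} := pm.

End sigma_finite_product.

Section tuple_measure.
Local Open Scope ereal_scope.
Context d (T : measurableType d) (R : realType).

(* The n-fold product measure mu \x ... \x mu on n-tuples; for n = 0 it is the
   unit mass on the one-point space. *)
Fixpoint tuple_measure (mu : set T -> \bar R) (n : nat) {struct n} :
    set (n.-tuple T) -> \bar R :=
  match n with
  | 0 => \d_([tuple] : 0.-tuple T)
  | n'.+1 => pushforward (mu \x @tuple_measure mu n')
      (fun xt : T * n'.-tuple T => [tuple of xt.1 :: xt.2])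
  end.

Arguments tuple_measure : clear implicits.

Context (mu : {sigma_finite_measure set T -> \bar R}).

Let tuple_measure_ex n :
  exists m : {sigma_finite_measure set (n.-tuple T) -> \bar R},
    tuple_measure mu n = m.
Proof.
elim: n => [|n [m mE]]; first by exists \d_([tuple] : 0.-tuple T).
pose f (xt : T * n.-tuple T) : n.+1.-tuple T := [tuple of xt.1 :: xt.2].
pose g (t : n.+1.-tuple T) : T * n.-tuple T := (thead t, [tuple of behead t]).
have mf : measurable_fun setT f by exact: measurable_cons.
have mg : measurable_fun setT g.
  apply/measurable_fun_pairP; split; [exact: measurable_tnth|].
  exact: measurable_behead.
have fK : cancel f g by move=> [x t]; congr pair; exact/val_inj.
exists (sigma_finite_pushforward (sigma_finite_product mu m) mf mg fK).
by rewrite /= mE.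
Qed.

Let tuple_measure0 n : tuple_measure mu n set0 = 0.
Proof. by have [m ->] := tuple_measure_ex n. Qed.

Let tuple_measure_ge0 n A : 0 <= tuple_measure mu n A.
Proof. by have [m ->] := tuple_measure_ex n. Qed.

Let tuple_measure_sigma_additive n : semi_sigma_additive (tuple_measure mu n).
Proof.
by have [m ->] := tuple_measure_ex n; exact: measure_semi_sigma_additive.
Qed.

HB.instance Definition _ n := isMeasure.Build _ _ _ (tuple_measure mu n)
  (@tuple_measure0 n) (@tuple_measure_ge0 n) (@tuple_measure_sigma_additive n).

Let tuple_measure_sigma_finite n : sigma_finite setT (tuple_measure mu n).
Proof. by have [m ->] := tuple_measure_ex n; exact: sigma_finiteT. Qed.

HB.instance Definition _ n := Measure_isSigmaFinite.Build _ _ _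
  (tuple_measure mu n) (@tuple_measure_sigma_finite n).

End tuple_measure.

Arguments tuple_measure {d T R} mu n _.

Local Notation normc := ComplexField.Normc.normc.

Section complex_measure.
Context {R : realType}.

Definition pair_of_complex (z : R[i]) : R * R := (complex.Re z, complex.Im z).

Definition complex_of_pair (xy : R * R) : R[i] := xy.1 +i* xy.2.

HB.instance Definition _ := isPointed.Build R[i] 0.

(* The Borel sigma-algebra of C, transported from R^2. *)
HB.instance Definition _ :=
  Measurable.copy R[i] (g_sigma_algebra_preimageType pair_of_complex).

Lemma measurable_pair_of_complex : measurable_fun [set: R[i]] pair_of_complex.
Proof. by move=> _ B mB; exists B. Qed.

Lemma measurable_complex_of_pair : measurable_fun [set: R * R] complex_of_pair.
Proof.
move=> _ _ [B mB <-]; rewrite !setTI -comp_preimage.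
suff -> : pair_of_complex \o complex_of_pair = id by rewrite preimage_id.
by apply/funext => -[].
Qed.

Lemma complex_of_pairK : cancel complex_of_pair pair_of_complex.
Proof. by case. Qed.

Definition lebesgueC : {sigma_finite_measure set R[i] -> \bar R} :=
  sigma_finite_pushforward
    (sigma_finite_product lebesgue_measure lebesgue_measure)
    measurable_complex_of_pair measurable_pair_of_complex complex_of_pairK.

Definition cintegral d (T : measurableType d) (mu : {measure set T -> \bar R})
    (D : set T) (f : T -> R[i]) : R[i] :=
  (\int[mu]_(x in D) complex.Re (f x)) +i* (\int[mu]_(x in D) complex.Im (f x)).

Definition Gamma (s : R) : R :=
  \int[lebesgue_measure]_(t in `]0, +oo[) (t `^ (s - 1) * expR (- t)).

End complex_measure.

Section siegel.
Context {R : realType} (n : nat).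

(* The pair (z', z_{n+1}), with z' in C^n. *)
Definition Cn1 : Type := (n.-tuple R[i] * R[i])%type.

HB.instance Definition _ := Measurable.on Cn1.

Implicit Types (z w : Cn1) (f : Cn1 -> R[i]) (p : R).

Definition dV : {sigma_finite_measure set Cn1 -> \bar R} :=
  sigma_finite_product (tuple_measure lebesgueC n) lebesgueC.

Definition hdot z w : R[i] := \sum_(j < n) tnth z.1 j * (tnth w.1 j)^*.

Definition siegel : set Cn1 :=
  [set z | \sum_(j < n) normc (tnth z.1 j) ^+ 2 < complex.Im z.2].

Definition rho z w : R[i] := 'i / 2 * (w.2^* - z.2) - hdot z w.

(* For f in L^p with 1 < p < oo the kernel is in the conjugate L^q in w, so the
   integral converges absolutely at every z in [siegel]; this is the bounded
   extension to L^p of the orthogonal projection of L^2 onto A^2. *)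
Definition bergman_projection f z : R[i] :=
  ((n.+1)`!%:R / (4 * pi ^+ n.+1))%:C *
    cintegral dV siegel (fun w => rho z w ^- n.+2 * f w).

Local Open Scope ereal_scope.

Definition Lp_norm p f : \bar R :=
  (\int[dV]_(z in siegel) (normc (f z) `^ p)%:E) `^ p^-1.

Definition Lp p : set (Cn1 -> R[i]) :=
  [set f | measurable_fun siegel f /\ Lp_norm p f < +oo].

(* [f <> 0] is meant in L^p, that is, up to null sets. *)
Definition bergman_opnorm p : \bar R :=
  ereal_sup [set Lp_norm p (bergman_projection f) / Lp_norm p f | f in
    [set f | Lp p f /\ ~ f = cst 0%R %[ae dV in siegel]]].

End siegel.

(* Main.v *)
Require Import Defs.
From HB Require Import structures.
From mathcomp Require Import all_boot all_order all_algebra.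
From mathcomp Require Import all_classical all_reals all_analysis.
From mathcomp Require Import measurable_realfun complex ring lra.

Set Implicit Arguments.
Unset Strict Implicit.
Unset Printing Implicit Defensive.
Import Order.TTheory GRing.Theory Num.Theory.
Import numFieldNormedType.Exports.

Local Open Scope classical_set_scope.
Local Open Scope ring_scope.

Local Notation normc := ComplexField.Normc.normc.
Local Notation Re := complex.Re.
Local Notation Im := complex.Im.

(** Put [N = n + 2], [height w = Im w.2 - |w.1|^2] (the domain is
  [height w > 0]) and [k = N / p], [a = N / q], so that [a + k = N].

  Upper bound.  Since [2 Re (rho z w) = height z + height w + |w.1 - z.1|^2],
  while [Re w.2] enters [rho z w] only through its imaginary part, the integral
  of [|rho z w| ^ -N * height w ^ s] over [w] can be computed by integrating
  successively over [Re w.2], over [w.1] and over the height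
  ([integral_kernel]).  For [-1 < s < 0] it is a constant multiple of
  [height z ^ s], with the factor [pi / sin (pi (s + 1))] of the reflection
  formula ([beta_reflection_le]).  Hence the weight [height ^ -(1 / (p q))] and
  the Schur test ([schur_test]) bound the norm of the operator of kernel
  [|rho| ^ -N]; the constant is rewritten with the Gamma function by
  [wallis_Gamma].

  Lower bound.  Let [theta] be the angle of [w.2], counted clockwise from the
  imaginary axis, and take [f w = |w.2| ^ -k * exp (i a theta)].  It depends on [w.2]
  only, so integrating over the ball [|w.1|^2 < Im w.2] replaces [rho z w] by
  its value at the centre of the ball ([integral_ball_mean]: the kernel is
  antiholomorphic in [w.1]).  In polar coordinates for [w.2] the radial integral
  is then the Beta integral of [x ^ (a - 1) / (1 + x) ^ N] taken along a rotated
  ray; it does not depend on the ray ([integral_rotated]), the phase of [f]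
  being the one that the rotation produces.  What is left is an integral of
  [cos ^ n], and [|P f z|] comes out as [K * |z.2| ^ -k], where [K] is the lower
  bound of the theorem.  As [f] is not in L^p, it is cut off to
  [1 <= |w.2| <= S].  Where [M <= |z.2| <= S / M] and [Re z.2 / Im z.2] is
  bounded, the cut-off changes [P f] by an arbitrarily small proportion
  ([projection_ge]).  The integral of [|f|^p] is a multiple of [ln S], and that
  of [|P f|^p] over this region is at least [K^p] times as large, up to a factor
  that tends to 1 ([Lp_norm_projection_ge]).

  The measures are handled through the scalings and translations of the line
  and Tonelli's theorem: polar coordinates are two scalings
  ([integral_polar]), and a rotation of the plane is a product of three shears
  ([integral_rotation]). *)

(** * Integration tools *)

Section integration_tools.
Context {R : realType}.

(** The integral of a nonnegative function is a supremum over the simple functions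
  below it; this monotonicity also serves for partial integrals whose
  measurability would be tedious to check. *)
Lemma le_ge0_integral d (T : measurableType d) (mu : {measure set T -> \bar R})
    (D : set T) (f g : T -> \bar R) :
  (forall x, D x -> 0 <= f x)%E -> (forall x, D x -> f x <= g x)%E ->
  (\int[mu]_(x in D) f x <= \int[mu]_(x in D) g x)%E.
Proof.
move=> f0 fg.
have g0 x : D x -> (0 <= g x)%E by move=> Dx; exact: le_trans (f0 _ Dx) (fg _ Dx).
rewrite !ge0_integralE//; apply: le_ereal_sup => _ [h hf <-].
exists h => // x; apply: le_trans (hf x) _.
by rewrite /patch; case: ifPn => // /set_mem; exact: fg.
Qed.

Lemma measurable_affine (a b : R) : measurable_fun [set: R] (fun x => a * x + b).
Proof.
by apply: measurable_funD => //; exact: measurable_funM.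
Qed.

(** Both sides are measures that agree on the half-open intervals. *)
Lemma lebesgue_measure_affine (a b : R) (A : set R) : 0 < a -> measurable A ->
  lebesgue_measure A =
  (a%:E * pushforward lebesgue_measure
           ((fun x => a * x + b)%R : _ -> measurableTypeR R) A)%E.
Proof.
move=> a0 mA; have mphi := measurable_affine a b.
pose phi : measurableTypeR R -> measurableTypeR R := fun x => a * x + b.
pose m : {measure set _ -> \bar R} := pushforward lebesgue_measure phi.
rewrite (@lebesgue_measure_unique R (mscale (NngNum (ltW a0)) (m mphi)))//.
move=> _ [[x y]] _ <-.
pose I : set R := `](x - b) / a, (y - b) / a]%classic.
rewrite [RHS](_ : _ = a%:E * lebesgue_measure I)%E; last first.
  congr (_ * lebesgue_measure _)%E; apply/seteqP; split => t /=;
  by rewrite /I/= !in_itv/= ltr_pdivrMr// ler_pdivlMr// ltrBlDr lerBrDr (mulrC t).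
rewrite /I !lebesgue_measure_itv/= !lte_fin ltr_pM2r ?invr_gt0// ltrD2r.
case: ifPn => _; last by rewrite mule0.
rewrite -!EFinB -EFinM; congr EFin.
by rewrite -mulrBl opprB addrA subrK mulrC divfK ?gt_eqF.
Qed.

Lemma integral_affine (a b : R) (f : R -> \bar R) : 0 < a ->
  measurable_fun [set: R] f -> (forall x, 0 <= f x)%E ->
  (\int[lebesgue_measure]_x f x =
   a%:E * \int[lebesgue_measure]_x f (a * x + b)%R)%E.
Proof.
move=> a0 mf f0; have mphi := measurable_affine a b.
pose phi : measurableTypeR R -> measurableTypeR R := fun x => a * x + b.
pose m : {measure set _ -> \bar R} := pushforward lebesgue_measure phi.
rewrite (eq_measure_integral (mscale (NngNum (ltW a0)) (m mphi))); last first.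
  by move=> A mA _; exact: (lebesgue_measure_affine b a0 mA).
by rewrite ge0_integral_mscale// ge0_integral_pushforward.
Qed.

Lemma eq_integral_line (g f : R -> \bar R) : f =1 g ->
  (\int[lebesgue_measure]_x f x = \int[lebesgue_measure]_x g x)%E.
Proof. by move=> fg; apply: eq_integral => x _. Qed.

End integration_tools.

(** * Measurability of complex-valued functions *)

Section complex_measurability.
Context {R : realType} d (T : measurableType d).
Local Notation D := [set: T].
Implicit Types f g : T -> R[i].

Lemma measurable_funVr (f : T -> R) :
  measurable_fun D f -> measurable_fun D (fun x => (f x)^-1).
Proof.
move=> mf; rewrite (_ : (fun x => _) = (fun x => f x * (f x ^+ 2) `^ (-1))).
  apply: measurable_funM => //.
  exact: (measurableT_comp (measurable_powR (-1)) (measurable_funX 2 mf)).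
apply/funext => x; rewrite powR_inv1 ?sqr_ge0//.
have [->|f0] := eqVneq (f x) 0; first by rewrite mul0r invr0.
by rewrite expr2 invfM mulrA divff// mul1r.
Qed.

Lemma measurable_fun_sqrt (f : T -> R) : (forall x, 0 <= f x) ->
  measurable_fun D f -> measurable_fun D (fun x => Num.sqrt (f x)).
Proof.
move=> f0 mf; under eq_fun do rewrite -powR12_sqrt//.
exact: (measurableT_comp (measurable_powR 2^-1) mf).
Qed.

Lemma measurable_Re : measurable_fun [set: R[i]] (fun z : R[i] => Re z).
Proof.
exact: (measurableT_comp (@measurable_fst _ _ _ _) measurable_pair_of_complex).
Qed.

Lemma measurable_Im : measurable_fun [set: R[i]] (fun z : R[i] => Im z).
Proof.
exact: (measurableT_comp (@measurable_snd _ _ _ _) measurable_pair_of_complex).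
Qed.

Lemma measurable_funC f : measurable_fun D (fun x => Re (f x)) ->
  measurable_fun D (fun x => Im (f x)) -> measurable_fun D f.
Proof.
move=> mr mi; rewrite (_ : f = complex_of_pair \o (fun x => (Re (f x), Im (f x)))).
  apply: measurableT_comp; first exact: measurable_complex_of_pair.
  exact: measurable_fun_pair.
by apply/funext => x /=; rewrite /complex_of_pair/=; case: (f x).
Qed.

Lemma measurable_ReC f : measurable_fun D f -> measurable_fun D (fun x => Re (f x)).
Proof. by move=> mf; exact: (measurableT_comp measurable_Re mf). Qed.

Lemma measurable_ImC f : measurable_fun D f -> measurable_fun D (fun x => Im (f x)).
Proof. by move=> mf; exact: (measurableT_comp measurable_Im mf). Qed.

Lemma measurable_funMC f g : measurable_fun D f -> measurable_fun D g ->
  measurable_fun D (fun x => f x * g x).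
Proof.
move=> mf mg; apply: measurable_funC.
  rewrite (_ : (fun x => Re (f x * g x)) =
      (fun x => Re (f x) * Re (g x) - Im (f x) * Im (g x))); last first.
    by apply/funext => x; case: (f x) => a b; case: (g x).
  by apply: measurable_funB; apply: measurable_funM; 
    [exact: measurable_ReC|exact: measurable_ReC|exact: measurable_ImC|exact: measurable_ImC].
rewrite (_ : (fun x => Im (f x * g x)) =
    (fun x => Re (f x) * Im (g x) + Im (f x) * Re (g x))); last first.
  by apply/funext => x; case: (f x) => a b; case: (g x).
by apply: measurable_funD; apply: measurable_funM;
  [exact: measurable_ReC|exact: measurable_ImC|exact: measurable_ImC|exact: measurable_ReC].
Qed.

Lemma measurable_funDC f g : measurable_fun D f -> measurable_fun D g ->
  measurable_fun D (fun x => f x + g x).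
Proof.
move=> mf mg; apply: measurable_funC.
  rewrite (_ : (fun x => Re (f x + g x)) = (fun x => Re (f x) + Re (g x))); last first.
    by apply/funext => x; case: (f x) => a b; case: (g x).
  by apply: measurable_funD; exact: measurable_ReC.
rewrite (_ : (fun x => Im (f x + g x)) = (fun x => Im (f x) + Im (g x))); last first.
  by apply/funext => x; case: (f x) => a b; case: (g x).
by apply: measurable_funD; exact: measurable_ImC.
Qed.

Lemma measurable_funNC f : measurable_fun D f -> measurable_fun D (fun x => - f x).
Proof.
move=> mf; apply: measurable_funC.
  rewrite (_ : (fun x => Re (- f x)) = (fun x => - Re (f x))); last first.
    by apply/funext => x; case: (f x).
  by apply: measurableT_comp => //; exact: measurable_ReC.
rewrite (_ : (fun x => Im (- f x)) = (fun x => - Im (f x))); last first.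
  by apply/funext => x; case: (f x).
by apply: measurableT_comp => //; exact: measurable_ImC.
Qed.

Lemma measurable_fun_conjC f :
  measurable_fun D f -> measurable_fun D (fun x => (f x)^*).
Proof.
move=> mf; apply: measurable_funC.
  rewrite (_ : (fun x => Re (f x)^*) = (fun x => Re (f x))); last first.
    by apply/funext => x; case: (f x).
  exact: measurable_ReC.
rewrite (_ : (fun x => Im (f x)^*) = (fun x => - Im (f x))); last first.
  by apply/funext => x; case: (f x).
by apply: measurableT_comp => //; exact: measurable_ImC.
Qed.

Lemma measurable_funVC f : measurable_fun D f -> measurable_fun D (fun x => (f x)^-1).
Proof.
move=> mf.
have mn : measurable_fun D (fun x => (Re (f x) ^+ 2 + Im (f x) ^+ 2)^-1).
  apply: measurable_funVr.
  apply: measurable_funD; apply: measurable_funX;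
  [exact: measurable_ReC|exact: measurable_ImC].
apply: measurable_funC.
  rewrite (_ : (fun x => Re (f x)^-1) =
    (fun x => Re (f x) * (Re (f x) ^+ 2 + Im (f x) ^+ 2)^-1)); last first.
    by apply/funext => x; case: (f x).
  by apply: measurable_funM => //; exact: measurable_ReC.
rewrite (_ : (fun x => Im (f x)^-1) =
    (fun x => - (Im (f x) * (Re (f x) ^+ 2 + Im (f x) ^+ 2)^-1))); last first.
  by apply/funext => x; case: (f x).
by apply: measurableT_comp => //; apply: measurable_funM => //; exact: measurable_ImC.
Qed.

Lemma measurable_funXC f k : measurable_fun D f -> measurable_fun D (fun x => f x ^+ k).
Proof.
move=> mf; elim: k => [|k ih]; first exact: measurable_cst.
rewrite (_ : (fun x => f x ^+ k.+1) = (fun x => f x * f x ^+ k)).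
  exact: measurable_funMC.
by apply/funext => x; rewrite exprS.
Qed.

Lemma measurable_fun_sumC (I : Type) (s : seq I) (h : I -> T -> R[i]) :
  (forall i, measurable_fun D (h i)) ->
  measurable_fun D (fun x => \sum_(i <- s) h i x).
Proof.
move=> mh; elim: s => [|i s ih].
  by under eq_fun do rewrite big_nil; exact: measurable_cst.
by under eq_fun do rewrite big_cons; exact: measurable_funDC.
Qed.

Lemma measurable_fun_realC (f : T -> R) :
  measurable_fun D f -> measurable_fun D (fun x => (f x)%:C%C).
Proof.
by move=> mf; apply: measurable_funC => //; exact: measurable_cst.
Qed.

Lemma measurable_normc f : measurable_fun D f -> measurable_fun D (fun x => normc (f x)).
Proof.
move=> mf; rewrite (_ : (fun x => _) =
    (fun x => Num.sqrt (Re (f x) ^+ 2 + Im (f x) ^+ 2))); last first.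
  by apply/funext => x; case: (f x).
apply: measurable_fun_sqrt; first by move=> x; rewrite addr_ge0 ?sqr_ge0.
apply: measurable_funD; apply: measurable_funX;
  [exact: measurable_ReC|exact: measurable_ImC].
Qed.

End complex_measurability.

(** * Iterated integrals over [C], over tuples and over [C^n * C] *)

Section iterated_integrals.
Context {R : realType}.
Local Notation mu := (@lebesgue_measure R).

Lemma ge0_integral_sigma_finite_pushforward d d' (T1 : measurableType d)
    (T2 : measurableType d') (m : {sigma_finite_measure set T1 -> \bar R})
    (f : T1 -> T2) (g : T2 -> T1) (mf : measurable_fun setT f)
    (mg : measurable_fun setT g) (fK : cancel f g) (h : T2 -> \bar R) :
  measurable_fun setT h -> (forall y, 0 <= h y)%E ->
  (\int[sigma_finite_pushforward m mf mg fK]_y h y = \int[m]_x h (f x))%E.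
Proof.
move=> mh h0.
pose pf : {measure set _ -> \bar R} := pushforward m f.
rewrite (eq_measure_integral (pf mf))//.
by rewrite ge0_integral_pushforward.
Qed.

Lemma ge0_integral_sigma_finite_product d d' (T1 : measurableType d)
    (T2 : measurableType d') (m1 : {sigma_finite_measure set T1 -> \bar R})
    (m2 : {sigma_finite_measure set T2 -> \bar R}) (h : T1 * T2 -> \bar R) :
  measurable_fun setT h -> (forall y, 0 <= h y)%E ->
  (\int[sigma_finite_product m1 m2]_y h y = \int[(m1 \x m2)%E]_y h y)%E.
Proof. by []. Qed.

Lemma ge0_integral_exchange d1 d2 (T1 : measurableType d1) (T2 : measurableType d2)
    (m1 : {sigma_finite_measure set T1 -> \bar R})
    (m2 : {sigma_finite_measure set T2 -> \bar R}) (g : T1 -> T2 -> \bar R) :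
  measurable_fun setT (fun p : T1 * T2 => g p.1 p.2) ->
  (forall x y, 0 <= g x y)%E ->
  (\int[m1]_x \int[m2]_y g x y = \int[m2]_y \int[m1]_x g x y)%E.
Proof.
by move=> mg g0; exact: (@fubini_tonelli _ _ _ _ R m1 m2 (fun p => g p.1 p.2)).
Qed.

Lemma measurable_ge0_integral d1 d2 (T1 : measurableType d1) (T2 : measurableType d2)
    (m2 : {sigma_finite_measure set T2 -> \bar R}) (g : T1 -> T2 -> \bar R) :
  measurable_fun setT (fun p : T1 * T2 => g p.1 p.2) ->
  (forall x y, 0 <= g x y)%E ->
  measurable_fun setT (fun x => \int[m2]_y g x y)%E.
Proof.
move=> mg g0.
by apply: (@measurable_fun_fubini_tonelli_F _ _ _ _ R m2 (fun p => g p.1 p.2)).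
Qed.

Lemma integral_lebesgueC (f : R[i] -> \bar R) :
  measurable_fun [set: R[i]] f -> (forall x, 0 <= f x)%E ->
  (\int[lebesgueC]_z f z = \int[mu]_x \int[mu]_y f (x +i* y)%C)%E.
Proof.
move=> mf f0; rewrite ge0_integral_sigma_finite_pushforward//.
have mc : measurable_fun setT (fun y => f (complex_of_pair y)).
  exact: (measurableT_comp mf measurable_complex_of_pair).
by rewrite ge0_integral_sigma_finite_product// fubini_tonelli1.
Qed.

Lemma integral_lebesgueC_Im_first (f : R[i] -> \bar R) :
  measurable_fun [set: R[i]] f -> (forall x, 0 <= f x)%E ->
  (\int[lebesgueC]_z f z = \int[mu]_y \int[mu]_x f (x +i* y)%C)%E.
Proof.
move=> mf f0; rewrite ge0_integral_sigma_finite_pushforward//.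
have mc : measurable_fun setT (fun y => f (complex_of_pair y)).
  exact: (measurableT_comp mf measurable_complex_of_pair).
by rewrite ge0_integral_sigma_finite_product// fubini_tonelli2.
Qed.

Section tuples.
Context d (T : measurableType d) (m : {sigma_finite_measure set T -> \bar R}).

Lemma integral_tuple0 (f : 0.-tuple T -> \bar R) :
  measurable_fun setT f ->
  (\int[tuple_measure m 0]_t f t = f [tuple])%E.
Proof.
move=> mf; rewrite (eq_measure_integral (\d_([tuple] : 0.-tuple T)))//.
by rewrite integral_dirac// diracT mul1e.
Qed.

Lemma integral_tupleS n (f : n.+1.-tuple T -> \bar R) :
  measurable_fun setT f -> (forall t, 0 <= f t)%E ->
  (\int[tuple_measure m n.+1]_t f t =
   \int[m]_x \int[tuple_measure m n]_t f [tuple of x :: t])%E.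
Proof.
move=> mf f0.
pose c := fun xt : T * n.-tuple T => [tuple of xt.1 :: xt.2].
have mc : measurable_fun setT c by exact: measurable_cons.
pose pf : {measure set _ -> \bar R} := pushforward (m \x tuple_measure m n)%E c.
rewrite (eq_measure_integral (pf mc))//.
rewrite ge0_integral_pushforward//.
rewrite preimage_setT fubini_tonelli1//; last by move=> x; exact: f0.
exact: (measurableT_comp mf mc).
Qed.

End tuples.

Lemma integral_dV n (f : Cn1 n -> \bar R) :
  measurable_fun setT f -> (forall z, 0 <= f z)%E ->
  (\int[dV n]_z f z =
   \int[lebesgueC]_w \int[tuple_measure lebesgueC n]_t f (t, w))%E.
Proof.
by move=> mf f0; rewrite ge0_integral_sigma_finite_product// fubini_tonelli2.
Qed.

Lemma integral_dV_tuple_first n (f : Cn1 n -> \bar R) :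
  measurable_fun setT f -> (forall z, 0 <= f z)%E ->
  (\int[dV n]_z f z =
   \int[tuple_measure lebesgueC n]_t \int[lebesgueC]_w f (t, w))%E.
Proof.
by move=> mf f0; rewrite ge0_integral_sigma_finite_product// fubini_tonelli1.
Qed.

End iterated_integrals.

(** * Polar coordinates in the upper half-plane *)

Section polar_coordinates.
Context {R : realType}.
Local Notation mu := (@lebesgue_measure R).

(** The cosine of [atan t]: the slope [t = Re w / Im w] parametrizes the rays of
  the upper half-plane, which keeps the change of variables affine in each
  variable. *)
Definition cosa (t : R) : R := (Num.sqrt (1 + t ^+ 2))^-1.

Lemma cosa_gt0 t : 0 < cosa t.
Proof. by rewrite invr_gt0 sqrtr_gt0 ltr_pwDl ?sqr_ge0. Qed.

Lemma sqr_cosa t : cosa t ^+ 2 = (1 + t ^+ 2)^-1.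
Proof. by rewrite exprVn sqr_sqrtr// addr_ge0 ?sqr_ge0. Qed.

Lemma measurable_cosa : measurable_fun [set: R] cosa.
Proof.
apply: measurable_funVr; apply: measurable_fun_sqrt.
  by move=> x; rewrite addr_ge0 ?sqr_ge0.
by apply: measurable_funD => //; exact: measurable_funX.
Qed.

Definition direction (t : R) : R[i] := (cosa t * t +i* cosa t)%C.

Definition polar (p : R * R) : R[i] := ((p.2)%:C * direction p.1)%C.

Definition jacobian (p : R * R) : R := Num.max p.2 0 * cosa p.1 ^+ 2.

Lemma measurable_direction : measurable_fun [set: R] direction.
Proof.
apply: measurable_funC => /=; last exact: measurable_cosa.
by apply: measurable_funM => //; exact: measurable_cosa.
Qed.

Lemma measurable_polar : measurable_fun [set: R * R] polar.
Proof.
apply: measurable_funMC; first by apply: measurable_fun_realC; exact: measurable_snd.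
by apply: (measurableT_comp measurable_direction); exact: measurable_fst.
Qed.

Lemma measurable_upper : measurable [set z : R[i] | 0 < Im z].
Proof.
rewrite (_ : [set z | _] = (fun z : R[i] => Im z) @^-1` `]0, +oo[).
  by rewrite -[X in measurable X]setTI; exact: measurable_Im.
by apply/seteqP; split => z /=; rewrite in_itv/= andbT.
Qed.

(** On the line of height [y] the abscissa is [y * t]; on the ray of slope [t]
  the height is [x * cosa t].  Both substitutions are scalings. *)
Lemma integral_polar (f : R[i] -> \bar R) :
  measurable_fun [set: R[i]] f -> (forall x, 0 <= f x)%E ->
  (\int[lebesgueC]_(z in [set z | (0 < Im z)%R]) f z =
   \int[mu]_t \int[mu]_x ((jacobian (t, x))%:E * f (polar (t, x))))%E.
Proof.
move=> mf f0.
have f00 z : (0 <= (f \_ [set z | (0 < Im z)%R]) z)%E.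
  by rewrite /patch; case: ifP.
have mfU : measurable_fun setT (f \_ [set z | (0 < Im z)%R]).
  by apply/measurable_restrict => //; [exact: measurable_upper|exact: measurable_funTS].
rewrite integral_mkcond integral_lebesgueC_Im_first//.
pose g (y t : R) := ((Num.max y 0)%:E * f (y%:C%C * (t +i* 1)%C)%R)%E.
transitivity (\int[mu]_y \int[mu]_t g y t)%E.
  apply: eq_integral => y _.
  have [y0|y0] := ltP 0 y; last first.
    rewrite /g max_r//; under [RHS]eq_integral do rewrite mul0e.
    rewrite integral0; apply: integral0_eq => x _; rewrite patchE memNset//=.
    by apply/negP; rewrite -leNgt.
  rewrite (integral_affine 0 y0)//; last first.
    by apply: measurableT_comp => //; apply: measurable_funC => //=.
  rewrite /g max_l ?ltW// ge0_integralZl//; last 2 first.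
  - apply: (measurableT_comp mf); apply: measurable_funMC; first exact: measurable_cst.
    by apply: measurable_funC => //=.
  - by rewrite lee_fin ltW.
  congr (_ * _)%E; apply: eq_integral => x _; rewrite patchE mem_set//=.
  by congr f; apply/eqP; rewrite eq_complex/=; apply/andP; split; apply/eqP; ring.
have mg : measurable_fun setT (fun p : R * R => g p.1 p.2).
  apply: emeasurable_funM.
    apply/measurable_EFinP/measurable_maxr; first exact: measurable_fst.
    exact: measurable_cst.
  apply: (measurableT_comp mf); apply: measurable_funMC.
    by apply: measurable_fun_realC; exact: measurable_fst.
  by apply: measurable_funC => /=; [exact: measurable_snd|exact: measurable_cst].
have g0 y t : (0 <= g y t)%E by rewrite mule_ge0// lee_fin le_max lexx orbT.
transitivity (\int[mu]_t \int[mu]_y g y t)%E.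
  by apply: (@ge0_integral_exchange R _ _ _ _ mu mu g).
apply: eq_integral => t _; have c0 := cosa_gt0 t.
rewrite (integral_affine 0 c0)//; last exact: measurable_fun_pair1 mg.
rewrite -ge0_integralZl//; last 2 first.
- apply: (measurableT_comp (measurable_fun_pair1 t mg)).
  exact: (measurable_affine (cosa t) 0).
- by rewrite lee_fin ltW.
apply: eq_integral => x _; rewrite /g muleA -EFinM; congr (_%:E * f _)%E.
  rewrite addr0 -[X in Num.max _ X](mulr0 (cosa t)) -maxr_pMr ?ltW//.
  by rewrite /jacobian/= expr2; ring.
by apply/eqP; rewrite eq_complex/=; apply/andP; split; apply/eqP; ring.
Qed.

End polar_coordinates.

(** * Rotation invariance *)

Section rotation_invariance.
Context {R : realType}.
Local Notation mu := (@lebesgue_measure R).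

Lemma measurable_complexC (f g : R[i] -> R) : measurable_fun setT f ->
  measurable_fun setT g -> measurable_fun setT (fun z => f z +i* g z)%C.
Proof. by move=> mf mg; exact: measurable_funC. Qed.

Lemma integral_shear_Re (t : R) (f : R[i] -> \bar R) :
  measurable_fun setT f -> (forall z, 0 <= f z)%E ->
  (\int[lebesgueC]_z f ((Re z + t * Im z)%R +i* Im z)%C = \int[lebesgueC]_z f z)%E.
Proof.
move=> mf f0.
have mg : measurable_fun setT (fun z : R[i] => f ((Re z + t * Im z) +i* Im z)%C).
  apply: (measurableT_comp mf); apply: measurable_complexC.
    apply: measurable_funD; first exact: measurable_Re.
    by apply: measurable_funM => //; exact: measurable_Im.
  exact: measurable_Im.
rewrite (integral_lebesgueC_Im_first mg)// (integral_lebesgueC_Im_first mf)//.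
apply: eq_integral => y _ /=.
rewrite [RHS](integral_affine (t * y) (@ltr01 R))//; last first.
  by apply: (measurableT_comp mf); apply: measurable_funC => //=.
by rewrite mul1e; apply: eq_integral => x _; rewrite mul1r.
Qed.

Lemma integral_shear_Im (t : R) (f : R[i] -> \bar R) :
  measurable_fun setT f -> (forall z, 0 <= f z)%E ->
  (\int[lebesgueC]_z f (Re z +i* (Im z + t * Re z)%R)%C = \int[lebesgueC]_z f z)%E.
Proof.
move=> mf f0.
have mg : measurable_fun setT (fun z : R[i] => f (Re z +i* (Im z + t * Re z))%C).
  apply: (measurableT_comp mf); apply: measurable_complexC; first exact: measurable_Re.
  apply: measurable_funD; first exact: measurable_Im.
  by apply: measurable_funM => //; exact: measurable_Re.
rewrite (integral_lebesgueC mg)// (integral_lebesgueC mf)//.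
apply: eq_integral => x _ /=.
rewrite [RHS](integral_affine (t * x) (@ltr01 R))//; last first.
  by apply: (measurableT_comp mf); apply: measurable_funC => //=.
by rewrite mul1e; apply: eq_integral => y _; rewrite mul1r.
Qed.

(** A rotation is a product of three shears, each of which is a translation on
  every line of one direction. *)
Lemma integral_rotation (c s : R) (f : R[i] -> \bar R) :
  s != 0 -> c ^+ 2 + s ^+ 2 = 1 ->
  measurable_fun setT f -> (forall z, 0 <= f z)%E ->
  (\int[lebesgueC]_z f ((c +i* s)%C * z)%R = \int[lebesgueC]_z f z)%E.
Proof.
(* For [c +i* s = exp (i phi)], [t] is [- tan (phi / 2)]: the outer two shears
   are by [t], the middle one by [s]. *)
move=> s0 cs mf f0; pose t := - ((1 - c) / s).
rewrite -(integral_shear_Re t mf f0).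
have mg : measurable_fun setT (fun z : R[i] => f ((Re z + t * Im z) +i* Im z)%C).
  apply: (measurableT_comp mf); apply: measurable_complexC; last exact: measurable_Im.
  apply: measurable_funD; first exact: measurable_Re.
  by apply: measurable_funM => //; exact: measurable_Im.
rewrite -(integral_shear_Im s mg)//.
set g := fun z : R[i] => _ in mg *.
have mh : measurable_fun setT (fun z : R[i] => g (Re z +i* (Im z + s * Re z))%C).
  apply: (measurableT_comp mg); apply: measurable_complexC; first exact: measurable_Re.
  apply: measurable_funD; first exact: measurable_Im.
  by apply: measurable_funM => //; exact: measurable_Re.
rewrite -(integral_shear_Re t mh); last by move=> z; exact: f0.
apply: eq_integral => z _; rewrite /g/=; case: z => x y /=; congr f.
have ts : s * t = c - 1 by rewrite /t mulrN mulrCA divff// mulr1 opprB.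
have tc : t * (1 + c) = - s.
  by apply: (mulfI s0); rewrite mulrA ts mulrN -expr2 -[s ^+ 2](addKr (c ^+ 2)) cs; ring.
apply/eqP; rewrite eq_complex/=; apply/andP; split; apply/eqP.
  rewrite (_ : _ + t * (y + _) = (1 + s * t) * x + t * (2 + s * t) * y); last by ring.
  by rewrite ts (_ : 2 + (c - 1) = 1 + c) ?tc; ring.
rewrite (_ : y + s * _ = (1 + s * t) * y + s * x); last by ring.
by rewrite ts; ring.
Qed.

Definition scale_tuple (w : R[i]) n (t : n.-tuple R[i]) : n.-tuple R[i] :=
  [tuple of [seq w * z | z <- t]].

Lemma measurable_scale_tuple (w : R[i]) n :
  measurable_fun setT (@scale_tuple w n).
Proof.
apply/measurable_fun_tnthP => i; rewrite (_ : _ \o _ = (fun t => w * tnth t i)).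
  by apply: measurable_funMC; [exact: measurable_cst|exact: measurable_tnth].
by apply/funext => t /=; rewrite tnth_map.
Qed.

Lemma integral_rotation_tuple (c s : R) n (f : n.-tuple R[i] -> \bar R) :
  s != 0 -> c ^+ 2 + s ^+ 2 = 1 ->
  measurable_fun setT f -> (forall z, 0 <= f z)%E ->
  (\int[tuple_measure lebesgueC n]_t f (scale_tuple (c +i* s)%C t) =
   \int[tuple_measure lebesgueC n]_t f t)%E.
Proof.
move=> s0 cs; elim: n f => [|n ih] f mf f0.
  by apply: eq_integral => t _; congr f; rewrite [RHS]tuple0 [LHS]tuple0.
rewrite !integral_tupleS//; last first.
  exact: (measurableT_comp mf (@measurable_scale_tuple (c +i* s)%C n.+1)).
pose G x := (\int[tuple_measure lebesgueC n]_t f [tuple of x :: t])%E.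
have mcons : measurable_fun setT
    (fun p : R[i] * n.-tuple R[i] => f [tuple of p.1 :: p.2]).
  by apply: (measurableT_comp mf); apply: measurable_cons;
     [exact: measurable_fst|exact: measurable_snd].
have mG : measurable_fun setT G.
  exact: (@measurable_fun_fubini_tonelli_F _ _ _ _ R (tuple_measure lebesgueC n)
    (fun p => f [tuple of p.1 :: p.2])).
rewrite -[RHS](integral_rotation s0 cs mG); last by move=> z; exact: integral_ge0.
apply: eq_integral => x _; rewrite /G.
rewrite -(ih (fun t => f [tuple of ((c +i* s)%C * x) :: t]))//; last first.
  exact: measurable_fun_pair2 mcons.
by apply: eq_integral => t _; congr f; exact/val_inj.
Qed.

End rotation_invariance.

(** * The integrals of powers of the cosine *)

Section cosine_powers.
Context {R : realType}.
Local Notation mu := (@lebesgue_measure R).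

Lemma derive_eq (f : R -> R) (x d d' : R) :
  is_derive x 1 f d -> d = d' -> is_derive x 1 f d'.
Proof. by move=> h <-. Qed.

Lemma derive_add (f g : R -> R) (x df dg : R) :
  is_derive x 1 f df -> is_derive x 1 g dg ->
  is_derive x 1 (fun y => f y + g y) (df + dg).
Proof. by move=> hf hg; exact: is_deriveD. Qed.

Lemma derive_mul (f g : R -> R) (x df dg : R) :
  is_derive x 1 f df -> is_derive x 1 g dg ->
  is_derive x 1 (fun y => f y * g y) (df * g x + f x * dg).
Proof.
move=> hf hg; apply: (@is_derive_eq _ _ _ (f * g) _ _ _ _ (is_deriveM hf hg)).
by rewrite /GRing.scale/= addrC (mulrC df).
Qed.

Lemma derive_scale (f : R -> R) (k x df : R) :
  is_derive x 1 f df -> is_derive x 1 (fun y => k * f y) (k * df).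
Proof. by move=> hf; exact: (is_deriveZ k). Qed.

Lemma derive_exp (f : R -> R) (n : nat) (x df : R) :
  is_derive x 1 f df ->
  is_derive x 1 (fun y => f y ^+ n) (n%:R * f x ^+ n.-1 * df).
Proof.
move=> hf; rewrite (_ : (fun y => _) = f ^+ n); last first.
  by apply/funext => y; rewrite exprfctE.
by apply: is_derive_eq; rewrite /GRing.scale/= mulr_natl.
Qed.

Lemma integral_FTC0y (f F : R -> R) (l : R) :
  (forall x : R, 0 <= x -> 0 <= f x) ->
  (forall x : R, 0 <= x -> {for x, continuous f}) ->
  (forall x : R, 0 <= x -> is_derive x 1 F (f x)) ->
  F x @[x --> +oo%R] --> l ->
  (\int[mu]_(x in `[0%R, +oo[) (f x)%:E = (l - F 0)%:E)%E.
Proof.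
move=> f0 cf dF Fl.
rewrite (@ge0_continuous_FTC2y R f F 0 l)//.
- apply/continuous_within_itvcyP; split.
    by move=> x; rewrite in_itv/= andbT => /ltW; exact: cf.
  exact/cvg_at_right_filter/cf.
- by move=> x /ltW x0; have [] := dF x x0.
- apply: cvg_at_right_filter; apply: differentiable_continuous.
  by apply/derivable1_diffP; have [] := dF 0 (lexx _).
- move=> x; rewrite in_itv/= andbT => /ltW x0.
  by rewrite derive1E; have [_ ->] := dF x x0.
Qed.

Lemma cosa_cos (t : R) : cosa t = cos (atan t).
Proof. by rewrite cos_atan. Qed.

Lemma sin_atan (t : R) : sin (atan t) = t * cosa t.
Proof.
have c0 : cos (atan t) != 0 by rewrite -cosa_cos gt_eqF// cosa_gt0.
by rewrite cosa_cos -{2}[t]atanK /tan divfK.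
Qed.

(** The recursion is the integration by parts of [cos ^ n]. *)
Fixpoint cos_primitive (n : nat) (x : R) : R :=
  match n with
  | 0 => x
  | 1 => sin x
  | n'.+2 => (n'.+2%:R)^-1 * (sin x * cos x ^+ n'.+1 + n'.+1%:R * cos_primitive n' x)
  end.

Lemma nat_ind2 (P : nat -> Prop) :
  P 0%N -> P 1%N -> (forall n, P n -> P n.+1 -> P n.+2) -> forall n, P n.
Proof.
move=> P0 P1 PS n; suff: P n /\ P n.+1 by case.
by elim: n => [//|n [? ?]]; split=> //; exact: PS.
Qed.

Lemma is_derive_cos_primitive n (x : R) :
  is_derive x 1 (cos_primitive n) (cos x ^+ n).
Proof.
elim/nat_ind2: n => [||n ih _] /=; first exact: is_derive_id.
  exact: is_derive_sin.
have h1 := derive_scale n.+1%:R ih.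
have h2 := derive_mul (is_derive_sin x) (derive_exp n.+1 (is_derive_cos x)).
apply: (derive_eq (derive_scale n.+2%:R^-1 (derive_add h2 h1))).
apply: (mulfI (_ : n.+2%:R != 0)); first by rewrite pnatr_eq0.
rewrite mulVKf ?pnatr_eq0//=.
have s2 : sin x ^+ 2 = 1 - cos x ^+ 2 by rewrite -(cos2Dsin2 x) addrAC subrr add0r.
rewrite (_ : sin x * _ = - (n.+1%:R * cos x ^+ n * sin x ^+ 2)); last by ring.
by rewrite s2 -natr1 !exprSr; ring.
Qed.

(** The integral of [cos ^ n] over a half-turn, by the Wallis recursion. *)
Fixpoint wallis (n : nat) : R :=
  match n with
  | 0 => pi
  | 1 => 2
  | n'.+2 => n'.+1%:R / n'.+2%:R * wallis n'
  end.

Lemma cos_primitive_pihalf n : cos_primitive n (pi / 2) = wallis n / 2.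
Proof.
elim/nat_ind2: n => [||n ih _] //=; first by rewrite sin_pihalf divff.
rewrite sin_pihalf cos_pihalf expr0n/= mulr0 add0r ih; ring.
Qed.

Lemma cos_primitive0 n : cos_primitive n 0 = 0.
Proof.
by elim/nat_ind2: n => [||n ih _] //=; rewrite sin0 // ih mul0r mulr0 addr0 mulr0.
Qed.

Lemma continuous_cosa : continuous (@cosa R).
Proof.
move=> t; rewrite (_ : cosa = cos \o atan); last first.
  by apply/funext => x; rewrite cosa_cos.
by apply: continuous_comp; [exact: continuous_atan|exact: continuous_cos].
Qed.

(** The substitution [t = tan u] turns [cosa t ^+ n.+2 dt] into
  [cos u ^+ n du]. *)
Lemma integral_cosa n : (\int[mu]_t (cosa t ^+ n.+2)%:E = (wallis n)%:E)%E.
Proof.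
have c0 (t : R) : 0 <= cosa t ^+ n.+2 by rewrite exprn_ge0// ltW// cosa_gt0.
have cc : continuous (fun t : R => cosa t ^+ n.+2).
  move=> t; apply: (@continuous_comp _ _ _ (@cosa R) (fun x => x ^+ n.+2)).
    exact: continuous_cosa.
  exact: exprn_continuous.
rewrite (ge0_symfun_integralT c0 cc); last first.
  by move=> t; rewrite /= /cosa sqrrN.
have dF (t : R) : 0 <= t ->
    is_derive t 1 (cos_primitive n \o atan) (cosa t ^+ n.+2).
  move=> _; have dF := is_derive1_comp (is_derive_cos_primitive n (atan t)) (is_derive1_atan t).
  apply: (derive_eq dF).
  by rewrite -cosa_cos -sqr_cosa !exprSr; ring.
have Fl : (cos_primitive n \o atan) x @[x --> +oo%R] --> wallis n / 2.
  rewrite -cos_primitive_pihalf; apply: (@cvg_comp _ _ _ (@atan R) (cos_primitive n) _ _ _ (@cvgy_atan R)).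
  apply: differentiable_continuous; apply/derivable1_diffP.
  by have [] := is_derive_cos_primitive n (pi / 2).
rewrite -set_itvcy (integral_FTC0y (fun t _ => c0 t) (fun t _ => cc t) dF Fl).
rewrite /= atan0 cos_primitive0 subr0 -EFinM; congr EFin.
by rewrite mulrC divfK.
Qed.

Lemma wallis_gt0 n : 0 < wallis n.
Proof.
elim/nat_ind2: n => [||n ih _] //=; first exact: pi_gt0.
by rewrite mulr_gt0// divr_gt0.
Qed.

(** The product of two consecutive Wallis integrals telescopes. *)
Lemma wallisM n : wallis n.+1 * wallis n * n.+1%:R = 2 * pi.
Proof.
elim/nat_ind2: n => [||n ih _]; rewrite //=.
- by rewrite mulr1.
- by field.
- rewrite -ih/=; field; do ?[apply/andP; split];
  by rewrite ?(pnatr_eq0, natr1, addrC 1) // nat1r ?pnatr_eq0.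
Qed.

End cosine_powers.

(** * Spatial integrals *)

Section spatial_integrals.
Context {R : realType}.
Local Notation mu := (@lebesgue_measure R).

Lemma sqrtV_double (x : R) k : 0 <= x -> (Num.sqrt x)^-1 ^+ k.*2 = x^-1 ^+ k.
Proof. by move=> x0; rewrite -mul2n exprM exprVn sqr_sqrtr. Qed.

(** The substitution [s * (x - b) = A * t] reduces this to [integral_cosa]. *)
Lemma integral_inv_sqrt (n : nat) (A s b : R) : 0 < A -> 0 < s ->
  (\int[mu]_x (((Num.sqrt (A ^+ 2 + (s * (x - b)) ^+ 2))^-1 ^+ n.+2)%R)%:E =
   (wallis n / s * A^-1 ^+ n.+1)%:E)%E.
Proof.
move=> A0 s0; have As0 : 0 < A / s by rewrite divr_gt0.
have m0 : measurable_fun [set: R]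
    (fun x => (Num.sqrt (A ^+ 2 + (s * (x - b)) ^+ 2))^-1 ^+ n.+2).
  apply: measurable_funX; apply: measurable_funVr; apply: measurable_fun_sqrt.
    by move=> x; rewrite addr_ge0 ?sqr_ge0.
  apply: measurable_funD => //; apply: measurable_funX; apply: measurable_funM => //.
  exact: measurable_funB.
rewrite (integral_affine b As0)//; last exact/measurable_EFinP.
rewrite (eq_integral_line (g := fun t => (A^-1 ^+ n.+2)%:E * (cosa t ^+ n.+2)%:E)%E); last first.
  move=> t; rewrite -EFinM -exprMn; congr (_ ^+ _)%:E.
  rewrite /cosa -invfM; congr _^-1.
  rewrite addrK mulrA (mulrC s) divfK ?gt_eqF// exprMn.
  rewrite (_ : A ^+ 2 + _ = A ^+ 2 * (1 + t ^+ 2)); last by ring.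
  by rewrite sqrtrM ?sqr_ge0// sqrtr_sqr gtr0_norm.
rewrite ge0_integralZl//; last 3 first.
- by apply/measurable_EFinP/measurable_funX; exact: measurable_cosa.
- by move=> t _; rewrite lee_fin exprn_ge0// ltW// cosa_gt0.
- by rewrite lee_fin exprn_ge0// invr_ge0 ltW.
rewrite integral_cosa -!EFinM; congr EFin.
by rewrite [A^-1 ^+ n.+2]exprS; field; rewrite !gt_eqF.
Qed.

Lemma wallis_odd_even k : wallis k.*2.+1 * wallis k.*2.+2 = pi / k.+1%:R :> R.
Proof.
have := @wallisM R k.*2.+1; rewrite -doubleS -mul2n natrM => /(canRL (mulfK _)) h.
rewrite mulrC h ?mulf_neq0 ?pnatr_eq0// invfM; field.
by rewrite addrC natr1 pnatr_eq0.
Qed.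

Lemma normcE2 (z : R[i]) : normc z ^+ 2 = Re z ^+ 2 + Im z ^+ 2.
Proof. by case: z => x y /=; rewrite sqr_sqrtr// addr_ge0 ?sqr_ge0. Qed.

(** Each of the two real integrations is an instance of [integral_inv_sqrt]. *)
Lemma integral_lebesgueC_inv (B : R) (a : R[i]) (k : nat) : 0 < B ->
  (\int[lebesgueC]_w ((((B + normc (w - a) ^+ 2)^-1 ^+ k.+2)%R)%:E) =
   (pi / k.+1%:R * B^-1 ^+ k.+1)%:E)%E.
Proof.
move=> B0.
have mf : measurable_fun setT (fun w : R[i] => (B + normc (w - a) ^+ 2)^-1 ^+ k.+2).
  apply: measurable_funX; apply: measurable_funVr; apply: measurable_funD => //.
  apply: measurable_funX; apply: measurable_normc; apply: measurable_funDC => //.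
rewrite integral_lebesgueC; last 2 first.
- exact/measurable_EFinP.
- by move=> w; rewrite lee_fin exprn_ge0// invr_ge0 addr_ge0 ?sqr_ge0// ltW.
have p0 x : 0 < Num.sqrt (B + (1 * (x - Re a)) ^+ 2).
  by rewrite sqrtr_gt0 ltr_pwDl ?sqr_ge0.
rewrite (eq_integral_line (g := fun x => (wallis k.*2.+2)%:E *
    ((Num.sqrt (Num.sqrt B ^+ 2 + (1 * (x - Re a)) ^+ 2))^-1 ^+ k.*2.+3)%:E)%E); last first.
  move=> x; rewrite sqr_sqrtr ?ltW// -EFinM.
  have := integral_inv_sqrt k.*2.+2 (Im a) (p0 x) (@ltr01 R).
  rewrite divr1 => <-; apply: eq_integral => y _; congr EFin.
  rewrite sqr_sqrtr; last by rewrite addr_ge0 ?sqr_ge0// ltW.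
  rewrite -[k.*2.+4]/(k.+2.*2) sqrtV_double; last first.
    by rewrite !addr_ge0 ?sqr_ge0// ltW.
  rewrite normcE2; case: (a) => a1 a2 /=; rewrite !mul1r addrA //.
rewrite ge0_integralZl//; last 2 first.
- apply/measurable_EFinP/measurable_funX/measurable_funVr/measurable_fun_sqrt.
    by move=> x; rewrite addr_ge0 ?sqr_ge0.
  apply: measurable_funD => //; apply: measurable_funX; apply: measurable_funM => //.
  exact: measurable_funB.
- by rewrite lee_fin ltW// wallis_gt0.
rewrite integral_inv_sqrt ?sqrtr_gt0// -EFinM; congr EFin.
rewrite divr1 mulrA (mulrC (wallis k.*2.+2)) wallis_odd_even; congr (_ * _).
by rewrite -[k.*2.+2]/(k.+1.*2) sqrtV_double ?ltW.
Qed.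

Definition sqnorm n (t : n.-tuple R[i]) : R := \sum_(j < n) normc (tnth t j) ^+ 2.

Definition sqdist n (t s : n.-tuple R[i]) : R :=
  \sum_(j < n) normc (tnth t j - tnth s j) ^+ 2.

Lemma sqdist_ge0 n (t s : n.-tuple R[i]) : 0 <= sqdist t s.
Proof. by apply: sumr_ge0 => j _; exact: sqr_ge0. Qed.

Lemma sqnorm_ge0 n (t : n.-tuple R[i]) : 0 <= sqnorm t.
Proof. by apply: sumr_ge0 => j _; exact: sqr_ge0. Qed.

Lemma measurable_sqdist n (s : n.-tuple R[i]) :
  measurable_fun setT (fun t => sqdist t s).
Proof.
apply: measurable_sum => j; apply: measurable_funX; apply: measurable_normc.
by apply: measurable_funDC; [exact: measurable_tnth|exact: measurable_cst].
Qed.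

Lemma measurable_sqnorm n : measurable_fun setT (@sqnorm n).
Proof.
apply: measurable_sum => j; apply: measurable_funX; apply: measurable_normc.
exact: measurable_tnth.
Qed.

Lemma sqdist_cons n (x : R[i]) (t : n.-tuple R[i]) (s : n.+1.-tuple R[i]) :
  sqdist [tuple of x :: t] s =
  normc (x - thead s) ^+ 2 + sqdist t [tuple of behead s].
Proof.
rewrite /sqdist big_ord_recl; congr (_ + _); apply: eq_bigr => j _.
by rewrite tnthS; congr (normc (_ - _) ^+ 2); rewrite [in LHS](tuple_eta s) tnthS.
Qed.

(** Each coordinate that is integrated out lowers the exponent by one, by
  [integral_lebesgueC_inv]. *)
Lemma integral_tuple_inv (n k : nat) (B : R) (s : n.-tuple R[i]) : 0 < B ->
  (\int[tuple_measure lebesgueC n]_t (((B + sqdist t s)^-1 ^+ (n + k).+1)%R)%:E =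
   (pi ^+ n * k`!%:R / (n + k)`!%:R * B^-1 ^+ k.+1)%:E)%E.
Proof.
elim: n k B s => [|n ih] k B s B0.
  rewrite integral_tuple0; last first.
    apply/measurable_EFinP/measurable_funX/measurable_funVr/measurable_funD => //.
    exact: measurable_sqdist.
  rewrite add0n /sqdist big_ord0 addr0 expr0 mul1r divff ?mul1r//.
have mf : measurable_fun setT
    (fun t : n.+1.-tuple R[i] => (B + sqdist t s)^-1 ^+ (n.+1 + k).+1).
  apply/measurable_funX/measurable_funVr/measurable_funD => //.
  exact: measurable_sqdist.
rewrite integral_tupleS; last 2 first.
- exact/measurable_EFinP.
- by move=> t; rewrite lee_fin exprn_ge0// invr_ge0 addr_ge0 ?sqdist_ge0// ltW.
rewrite (eq_integral (fun x : R[i] => (pi ^+ n * k.+1`!%:R / (n + k.+1)`!%:R)%:E *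
   ((B + normc (x - thead s) ^+ 2)^-1 ^+ k.+2)%:E)%E); last first.
  move=> x _; rewrite -EFinM -(ih k.+1 _ [tuple of behead s]); last first.
    by rewrite ltr_pwDl ?sqr_ge0.
  by apply: eq_integral => t _; rewrite sqdist_cons addrA addnS addSn.
rewrite ge0_integralZl//; last 3 first.
- apply/measurable_EFinP/measurable_funX/measurable_funVr/measurable_funD => //.
  by apply/measurable_funX/measurable_normc/measurable_funDC => //.
- by move=> x _; rewrite lee_fin exprn_ge0// invr_ge0 addr_ge0 ?sqr_ge0// ltW.
- by rewrite lee_fin divr_ge0// mulr_ge0// exprn_ge0// pi_ge0.
rewrite integral_lebesgueC_inv// -EFinM; congr EFin.
rewrite addnS -addSn mulrA; congr (_ * _).
rewrite factS natrM exprS; field.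
by rewrite addrC natr1 !pnatr_eq0 -lt0n fact_gt0.
Qed.

End spatial_integrals.

(** * The volume of balls *)

Section ball_volume.
Context {R : realType}.
Local Notation mu := (@lebesgue_measure R).

Lemma integral_scaleC (a : R) (f : R[i] -> \bar R) : 0 < a ->
  measurable_fun setT f -> (forall z, 0 <= f z)%E ->
  (\int[lebesgueC]_z f z = (a ^+ 2)%:E * \int[lebesgueC]_z f (a%:C%C * z)%R)%E.
Proof.
move=> a0 mf f0.
have ms : measurable_fun setT (fun z : R[i] => a%:C%C * z).
  by apply: measurable_funMC => //; exact: measurable_cst.
rewrite (integral_lebesgueC mf)// (integral_lebesgueC (measurableT_comp mf ms)); last first.
  by move=> x; exact: f0.
have mpair : measurable_fun setT (fun p : R * R => f (p.1 +i* p.2)%C).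
  exact: (measurableT_comp mf measurable_complex_of_pair).
have mF : measurable_fun [set: R] (fun x => \int[mu]_y f (x +i* y)%C)%E.
  exact: (@measurable_fun_fubini_tonelli_F _ _ _ _ R mu (fun p : R * R => f (p.1 +i* p.2)%C)).
rewrite (integral_affine 0 a0 mF); last by move=> x; exact: integral_ge0.
rewrite expr2 EFinM -muleA; congr (_ * _)%E.
have mF' : measurable_fun [set: R] (fun x => \int[mu]_y f (a%:C%C * (x +i* y)%C)%R)%E.
  pose g (p : R * R) := f (a%:C%C * (p.1 +i* p.2)%C).
  have mg : measurable_fun setT g.
    exact: (measurableT_comp (measurableT_comp mf ms) measurable_complex_of_pair).
  apply: (measurable_ge0_integral mu (g := fun x y => f (a%:C%C * (x +i* y)%C)));
    [exact: mg|by move=> x y; exact: f0].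
rewrite -ge0_integralZl//; last 2 first.
- by move=> x _; apply: integral_ge0 => y _; exact: f0.
- by rewrite lee_fin ltW.
apply: eq_integral => x _.
rewrite (integral_affine 0 a0)//; last first.
  by apply: (measurableT_comp mf); apply: measurable_funC => //=.
congr (_ * _)%E; apply: eq_integral => y _; congr f.
by apply/eqP; rewrite eq_complex/=; apply/andP; split; apply/eqP; ring.
Qed.

Lemma integral_scale_tuple (a : R) n (f : n.-tuple R[i] -> \bar R) : 0 < a ->
  measurable_fun setT f -> (forall z, 0 <= f z)%E ->
  (\int[tuple_measure lebesgueC n]_t f t =
   ((a ^+ 2) ^+ n)%:E *
     \int[tuple_measure lebesgueC n]_t f (scale_tuple a%:C%C t))%E.
Proof.
move=> a0; elim: n f => [|n ih] f mf f0.
  rewrite expr0 mul1e; apply: eq_integral => t _; congr f.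
  by rewrite [LHS]tuple0 [RHS]tuple0.
have mcons : measurable_fun setT
    (fun p : R[i] * n.-tuple R[i] => f [tuple of p.1 :: p.2]).
  by apply: (measurableT_comp mf); apply: measurable_cons;
     [exact: measurable_fst|exact: measurable_snd].
have msc : measurable_fun setT (fun t => f (scale_tuple a%:C%C t)).
  exact: (measurableT_comp mf (@measurable_scale_tuple R a%:C%C n.+1)).
rewrite (integral_tupleS _ mf)// (integral_tupleS _ msc)//.
pose G x := (\int[tuple_measure lebesgueC n]_t f [tuple of x :: t])%E.
have mG : measurable_fun setT G.
  exact: (@measurable_fun_fubini_tonelli_F _ _ _ _ R (tuple_measure lebesgueC n)
    (fun p => f [tuple of p.1 :: p.2])).
have G0 x : (0 <= G x)%E by exact: integral_ge0.
rewrite (integral_scaleC a0 mG)// (exprS (a ^+ 2) n) (EFinM (a ^+ 2)) -muleA; congr (_ * _)%E.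
have an0 : (0 <= ((a ^+ 2) ^+ n)%:E)%E by rewrite lee_fin !exprn_ge0// ltW.
have mcons' : measurable_fun setT
    (fun p : R[i] * n.-tuple R[i] => f (scale_tuple a%:C%C [tuple of p.1 :: p.2])).
  by apply: (measurableT_comp msc); apply: measurable_cons;
     [exact: measurable_fst|exact: measurable_snd].
rewrite -ge0_integralZl//; last 2 first.
- exact: (@measurable_fun_fubini_tonelli_F _ _ _ _ R (tuple_measure lebesgueC n)
    (fun p => f (scale_tuple a%:C%C [tuple of p.1 :: p.2]))).
- by move=> x _; exact: integral_ge0.
apply: eq_integral => x _; rewrite /G.
rewrite (ih (fun t => f [tuple of (a%:C%C * x) :: t]))//; last first.
  exact: measurable_fun_pair2 mcons.
by congr (_ * _)%E; apply: eq_integral => t _; congr f; exact/val_inj.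
Qed.

Lemma cvg_invDy (c : R) : (c + x)^-1 @[x --> +oo%R] --> (0 : R).
Proof.
apply/cvgrPdist_le => e e0; near=> v.
have v0 : 0 < c + v by rewrite -ltrBlDl sub0r; near: v; apply: nbhs_pinfty_gt; exact: num_real.
rewrite sub0r normrN gtr0_norm ?invr_gt0// -[e]invrK lef_pV2 ?posrE ?invr_gt0//.
by rewrite -lerBlDl; near: v; apply: nbhs_pinfty_ge; exact: num_real.
Unshelve. all: by end_near. Qed.

Lemma is_derive_invX (c x : R) n : c + x != 0 ->
  is_derive x 1 (fun v => (c + v)^-1 ^+ n) (- (n%:R * (c + x)^-1 ^+ n.+1)).
Proof.
move=> cx; have h1 : is_derive x 1 (fun v => c + v) 1.
  by apply: (derive_eq (derive_add (is_derive_cst c x 1) (is_derive_id x 1))); rewrite add0r.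
have h2 := is_deriveV cx h1.
apply: (derive_eq (derive_exp n h2)).
rewrite /GRing.scale/= mulr1 mulrN -mulrA; congr (- _).
by case: n => [|n]; rewrite ?mul0r// -exprVn -exprD addn2.
Qed.

Lemma integral_inv_tail (c : R) n : 0 < c ->
  (\int[mu]_(v in `[0%R, +oo[) (((n.+1%:R * (c + v)^-1 ^+ n.+2))%R)%:E =
   (c^-1 ^+ n.+1)%:E)%E.
Proof.
move=> c0.
have cv0 (v : R) : 0 <= v -> c + v != 0 by move=> v0; rewrite gt_eqF// ltr_pwDl.
have dF (v : R) : 0 <= v -> is_derive v 1 (fun v => - 1 * (c + v)^-1 ^+ n.+1)
    (n.+1%:R * (c + v)^-1 ^+ n.+2).
  move=> v0; apply: (derive_eq (derive_scale (- 1) (is_derive_invX n.+1 (cv0 v v0)))).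
  by rewrite mulN1r opprK.
have Fl : (fun v => - 1 * (c + v)^-1 ^+ n.+1) x @[x --> +oo%R] --> (0 : R).
  have h : (c + x)^-1 ^+ n.+1 @[x --> +oo%R] --> (0 ^+ n.+1 : R).
    apply: (@cvg_comp _ _ _ (fun x => (c + x)^-1) (fun y => y ^+ n.+1) _ _ _ (cvg_invDy c)).
    exact: exprn_continuous.
  rewrite (_ : 0 = -1 * 0 ^+ n.+1 :> R); last by rewrite expr0n mulr0.
  by apply: cvgM; [exact: cvg_cst|exact: h].
rewrite (integral_FTC0y _ _ dF Fl).
- by rewrite addr0 mulN1r opprK add0r.
- by move=> v v0; rewrite mulr_ge0// exprn_ge0// invr_ge0 addr_ge0// ltW.
- move=> v v0; apply: differentiable_continuous; apply/derivable1_diffP.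
  by have [] := derive_scale n.+1%:R (is_derive_invX n.+2 (cv0 v v0)).
Qed.

Lemma integral_ratio n :
  (\int[mu]_(v in `[0%R, +oo[) (((n.+1%:R * v ^+ n * (1 + v)^-1 ^+ n.+2))%R)%:E = 1)%E.
Proof.
have cv0 (v : R) : 0 <= v -> 1 + v != 0 by move=> v0; rewrite gt_eqF// ltr_pwDl.
have dF (v : R) : 0 <= v -> is_derive v 1 (fun v => (1 - (1 + v)^-1) ^+ n.+1)
    (n.+1%:R * v ^+ n * (1 + v)^-1 ^+ n.+2).
  move=> v0; have h1 := derive_scale (-1) (is_derive_invX 1 (cv0 v v0)).
  have h2 := derive_add (is_derive_cst (1 : R) v 1) h1.
  have h3 := derive_exp n.+1 h2.
  rewrite (_ : (fun v => (1 - (1 + v)^-1) ^+ n.+1) =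
     (fun y => (cst 1 y + -1 * (1 + y)^-1 ^+ 1) ^+ n.+1)); last first.
    by apply/funext => y; rewrite mulN1r.
  apply: (derive_eq h3) => /=.
  rewrite (_ : 1 + -1 * _ = v * (1 + v)^-1); last by field; exact: cv0.
  by rewrite exprMn !exprS; ring.
have Fl : (fun v => (1 - (1 + v)^-1) ^+ n.+1) x @[x --> +oo%R] --> (1 : R).
  have h : 1 - (1 + x)^-1 @[x --> +oo%R] --> (1 - 0 : R).
    by apply: cvgB; [exact: cvg_cst|exact: cvg_invDy].
  rewrite [X in _ --> X](_ : _ = (1 - 0) ^+ n.+1); last by rewrite subr0 expr1n.
  apply: (@cvg_comp _ _ _ (fun x => 1 - (1 + x)^-1) (fun y => y ^+ n.+1) _ _ _ h).
  exact: exprn_continuous.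
rewrite (integral_FTC0y _ _ dF Fl).
- by rewrite addr0 invr1 subrr expr0n subr0.
- move=> v v0; apply: mulr_ge0; first by apply: mulr_ge0 => //; exact: exprn_ge0.
  by rewrite exprn_ge0// invr_ge0 addr_ge0.
- move=> v v0; apply: differentiable_continuous; apply/derivable1_diffP.
  have h1 := derive_scale n.+1%:R (derive_exp n (is_derive_id v 1)).
  by have [] := derive_mul h1 (is_derive_invX n.+2 (cv0 v v0)).
Qed.

Definition ball_indic n (v : R) (t : n.-tuple R[i]) : R := (sqnorm t < v)%R%:R.

Lemma measurable_ball_indic d (T : measurableType d) n (v : T -> R)
    (g : T -> n.-tuple R[i]) :
  measurable_fun setT v -> measurable_fun setT g ->
  measurable_fun setT (fun x => ball_indic (v x) (g x)).
Proof.
move=> mv mg; have ms : measurable_fun setT (fun x => v x - sqnorm (g x)).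
  by apply: measurable_funB => //; exact: (measurableT_comp (@measurable_sqnorm R n) mg).
rewrite (_ : (fun x => _) =
    \1_((fun x => v x - sqnorm (g x)) @^-1` (`]0, +oo[%classic : set R))).
  apply: measurable_indic; rewrite -[X in measurable X]setTI; exact: ms.
apply/funext => x; rewrite indicE /ball_indic; congr (nat_of_bool _)%:R.
by apply/idP/idP; rewrite !inE/= in_itv/= andbT subr_gt0.
Qed.

(** By scaling, the volume is [v ^+ n] times that of the unit ball; the latter is
  found by integrating [(1 + |t|^2) ^ -(n + 1)] over the space in two ways. *)
Lemma volume_ball n (v : R) : 0 < v ->
  (\int[tuple_measure lebesgueC n]_t (ball_indic v t)%:E =
   (pi ^+ n / n`!%:R * v ^+ n)%:E)%E.
Proof.
pose m := (\int[tuple_measure lebesgueC n]_t (ball_indic 1 t)%:E)%E.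
have mB u : measurable_fun setT (fun t : n.-tuple R[i] => (ball_indic u t)%:E).
  apply/measurable_EFinP; apply: measurable_ball_indic; [exact: measurable_cst|exact: measurable_id].
have B0 u (t : n.-tuple R[i]) : (0 <= (ball_indic u t)%:E)%E by rewrite lee_fin.
have m_ge0 : (0 <= m)%E by exact: integral_ge0.
have hm u : 0 < u ->
    (\int[tuple_measure lebesgueC n]_t (ball_indic u t)%:E = (u ^+ n)%:E * m)%E.
  move=> u0; have su0 : 0 < Num.sqrt u by rewrite sqrtr_gt0.
  rewrite (integral_scale_tuple su0 (mB u))// sqr_sqrtr ?ltW//; congr (_ * _)%E.
  apply: eq_integral => t _; congr (_%:R%:E); rewrite /sqnorm.
  rewrite (eq_bigr (fun j => u * normc (tnth t j) ^+ 2)) => [|j _].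
    by rewrite -mulr_sumr -[X in _ < X](mulr1 u) ltr_pM2l.
  rewrite tnth_map ComplexField.Normc.normcM exprMn /= expr0n addr0.
  by rewrite sqrtr_sqr ger0_norm ?ltW// sqr_sqrtr ?ltW.
suff mE : m = (pi ^+ n / n`!%:R)%:E by move=> v0; rewrite hm// mE -EFinM mulrC.
(* [(1 + |t|^2) ^ -(n + 1)] is the integral of the density [w] over the levels
   [u] exceeding [|t|^2]. *)
have := @integral_tuple_inv R n 0 1 [tuple 0 | i < n] ltr01.
rewrite addn0 mulr1 invr1 expr1 mulr1 => <-.
pose w (u : R) := n.+1%:R * (1 + u)^-1 ^+ n.+2.
have mw : measurable_fun [set: R] w.
  by apply: measurable_funM => //; apply/measurable_funX/measurable_funVr/measurable_funD.
pose pos (u : R) : R := (0 < u)%R%:R.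
have mpos : measurable_fun [set: R] pos.
  rewrite (_ : pos = \1_(`]0%R, +oo[%classic : set R)).
    by apply: measurable_indic; exact: measurable_itv.
  by apply/funext => u; rewrite indicE mem_setE/= in_itv/= andbT.
have posE (g : R -> R) : measurable_fun [set: R] g ->
    (\int[mu]_u (pos u * g u)%:E = \int[mu]_(u in `[0%R, +oo[) (g u)%:E)%E.
  move=> mg; rewrite -integral_itv_obnd_cbnd; last first.
    by apply/measurable_EFinP; exact: measurable_funTS.
  rewrite [RHS]integral_mkcond; apply: eq_integral => u _.
  rewrite patchE mem_setE/= in_itv/= andbT /pos.
  by case: ifP => _; rewrite ?mul1r// mul0r.
have w0 u : 0 <= u -> 0 <= w u.
  by move=> u0; rewrite mulr_ge0// exprn_ge0// invr_ge0 addr_ge0.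
have pw0 u : (0 <= (pos u * w u)%:E)%E.
  rewrite lee_fin /pos; case: (ltP 0 u) => [/ltW/w0|_]; by rewrite ?mul1r ?mul0r.
have mtail (c : R) : measurable_fun [set: R] (fun u => n.+1%:R * (c + u)^-1 ^+ n.+2).
  by apply: measurable_funM => //; apply/measurable_funX/measurable_funVr/measurable_funD.
have mr : measurable_fun [set: R] (fun u => n.+1%:R * u ^+ n * (1 + u)^-1 ^+ n.+2).
  apply: measurable_funM; last by apply/measurable_funX/measurable_funVr/measurable_funD.
  by apply: measurable_funM => //; exact: measurable_funX.
pose G (t : n.-tuple R[i]) (u : R) := ((pos u * w u)%:E * (ball_indic u t)%:E)%E.
have G0 t u : (0 <= G t u)%E by exact: mule_ge0.
have mG : measurable_fun setT (fun p => G p.1 p.2).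
  apply: emeasurable_funM.
    apply/measurable_EFinP.
    by apply: (measurableT_comp (measurable_funM mpos mw)); exact: measurable_snd.
  apply/measurable_EFinP.
  by apply: measurable_ball_indic; [exact: measurable_snd|exact: measurable_fst].
transitivity (\int[tuple_measure lebesgueC n]_t \int[mu]_u G t u)%E; last first.
  apply: eq_integral => t _.
  rewrite (_ : (1 + sqdist t _)^-1 ^+ n.+1 = (1 + sqnorm t)^-1 ^+ n.+1); last first.
    congr ((_ + _)^-1 ^+ _); apply: eq_bigr => j _.
    by rewrite tnth_mktuple subr0.
  have s0 := sqnorm_ge0 t.
  have s1 : 0 < 1 + sqnorm t by rewrite ltr_pwDl.
  rewrite -(integral_inv_tail n s1).
  rewrite (integral_affine (sqnorm t) (@ltr01 R)); last 2 first.
  - exact: (measurable_fun_pair2 t mG).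
  - exact: G0.
  rewrite mul1e -(posE _ (mtail _)); apply: eq_integral => u _.
  rewrite /G /ball_indic /pos mul1r -EFinM ltrDr.
  have [u0|u0] := ltP 0 u; last by rewrite mulr0 mul0r.
  have -> : 0 < u + sqnorm t by rewrite ltr_pwDl.
  by rewrite mul1r mulr1 mul1r /w -addrA (addrC (sqnorm t)).
rewrite (@ge0_integral_exchange R _ _ _ _ (tuple_measure lebesgueC n) mu G mG G0).
transitivity (\int[mu]_u ((pos u * (n.+1%:R * u ^+ n * (1 + u)^-1 ^+ n.+2))%:E * m))%E.
  rewrite ge0_integralZr//.
  - by rewrite posE// integral_ratio mul1e.
  - by apply/measurable_EFinP; exact: measurable_funM.
  - move=> u _; rewrite lee_fin /pos; case: (ltP 0 u) => [/ltW u0|_].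
      rewrite mul1r; apply: mulr_ge0; first by apply: mulr_ge0 => //; exact: exprn_ge0.
      by rewrite exprn_ge0// invr_ge0 addr_ge0.
    by rewrite mul0r.
apply: eq_integral => u _; rewrite /G /pos.
have [u0|u0] := ltP 0 u; last by rewrite !mul0r mul0e integral0_eq// => t _; rewrite mul0e.
rewrite !mul1r ge0_integralZl//; last by rewrite lee_fin w0// ltW.
by rewrite hm// muleA -EFinM /w; congr (_%:E * _)%E; ring.
Qed.

End ball_volume.

(** * The fundamental theorem of calculus on the half-line *)

Section half_line.
Context {R : realType}.
Local Notation mu := (@lebesgue_measure R).

Definition pos_itv (k : nat) : set R := `[(k.+2%:R)^-1, k.+2%:R].
Local Notation K := pos_itv.

Lemma bigcup_pos_itv : \bigcup_k K k = `]0, +oo[%classic.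
Proof.
apply/seteqP; split => [x [k _]|x]; rewrite /pos_itv /= !in_itv/= ?andbT.
  by move=> /andP[+ _]; apply: lt_le_trans; rewrite invr_gt0.
move=> x0; have y0 : 0 <= Num.max x x^-1 by rewrite le_max ltW.
have := archi_boundP y0; set k := Num.bound _ => hk; exists k => //.
have hk2 : Num.max x x^-1 <= k.+2%:R.
  by rewrite (le_trans (ltW hk))// ler_nat -addn2 leq_addr.
move: hk2; rewrite ge_max => /andP[h1 h2]; rewrite /= in_itv/= h1 andbT.
by rewrite -[leRHS]invrK lef_pV2// ?posrE// invr_gt0.
Qed.

Lemma nondecreasing_pos_itv : nondecreasing_seq K.
Proof.
move=> i j ij; apply/subsetPset => x; rewrite /pos_itv /= !in_itv/= => /andP[h1 h2].
have hij : i.+2%:R <= j.+2%:R :> R by rewrite ler_nat !ltnS.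
by rewrite (le_trans h2 hij) andbT (le_trans _ h1)// lef_pV2 ?posrE.
Qed.

Let mK k : measurable (K k). Proof. exact: measurable_itv. Qed.

Let KS k : K k `<=` `]0, +oo[%classic.
Proof. by rewrite -bigcup_pos_itv; exact: bigcup_sup. Qed.

Let FTC_K (f F : R -> R) k :
  (forall x : R, 0 < x -> {for x, continuous f}) ->
  (forall x : R, 0 < x -> is_derive x 1 F (f x)) ->
  (\int[mu]_(x in K k) (f x)%:E = (F k.+2%:R - F (k.+2%:R)^-1)%:E)%E.
Proof.
move=> cf dF; have k0 : 0 < (k.+2%:R)^-1 :> R by rewrite invr_gt0.
have kk : (k.+2%:R)^-1 < k.+2%:R :> R.
  by rewrite (@lt_trans _ _ 1)// ?ltr1n// invf_lt1// ltr1n.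
have cF (x : R) : 0 < x -> {for x, continuous F}.
  move=> x0; apply: differentiable_continuous; apply/derivable1_diffP.
  by have [] := dF x x0.
rewrite /pos_itv (@continuous_FTC2 R f F _ _ kk)//.
- apply: continuous_in_subspaceT => x /set_mem; rewrite /= in_itv/= => /andP[h _].
  by apply: cf; exact: lt_le_trans h.
- split.
  + move=> x; rewrite in_itv/= => /andP[h _].
    by have [] := dF x (lt_trans k0 h).
  + by apply: cvg_at_right_filter; exact: cF.
  + by apply: cvg_at_left_filter; apply: cF; exact: lt_trans kk.
- move=> x; rewrite in_itv/= => /andP[h _].
  by rewrite derive1E; have [_ ->] := dF x (lt_trans k0 h).
Qed.

Lemma continuous_pos_measurable (f : R -> R) :
  (forall x : R, 0 < x -> {for x, continuous f}) ->
  measurable_fun (`]0, +oo[%classic : set R) f.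
Proof.
move=> cf; apply: open_continuous_measurable_fun => //.
by move=> x; rewrite inE/= in_itv/= andbT; exact: cf.
Qed.

(** Monotone convergence along the intervals [[1 / (k + 2), k + 2]]. *)
Lemma integral_FTC_pos_ge0 (f F : R -> R) (l : R) :
  (forall x : R, 0 < x -> 0 <= f x) ->
  (forall x : R, 0 < x -> {for x, continuous f}) ->
  (forall x : R, 0 < x -> is_derive x 1 F (f x)) ->
  F k.+2%:R - F (k.+2%:R)^-1 @[k --> \oo] --> l ->
  (\int[mu]_(x in `]0%R, +oo[) (f x)%:E = l%:E)%E.
Proof.
move=> f0 cf dF Fl.
have mf : measurable_fun (`]0, +oo[%classic : set R) (EFin \o f).
  by apply/measurable_EFinP; exact: continuous_pos_measurable.
have mfk k : measurable_fun (K k) (EFin \o f).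
  by apply: measurable_funS mf => //; exact: KS.
have f0k k x : K k x -> (0 <= (EFin \o f) x)%E.
  by move=> /KS; rewrite /= in_itv/= andbT lee_fin; exact: f0.
have := ge0_nondecreasing_set_cvg_integral (mu := mu) nondecreasing_pos_itv mK mfk f0k.
rewrite bigcup_pos_itv => h; apply/esym; move: h.
under eq_fun do rewrite (FTC_K _ cf dF).
move=> h; apply: (cvg_unique _ _ h) => //.
by apply: cvg_EFin => //; exact: nearW.
Qed.

(** Dominated convergence along the intervals [[1 / (k + 2), k + 2]]. *)
Lemma integral_FTC_pos (f F : R -> R) (l : R) :
  mu.-integrable (`]0, +oo[%classic : set R) (EFin \o f) ->
  (forall x : R, 0 < x -> {for x, continuous f}) ->
  (forall x : R, 0 < x -> is_derive x 1 F (f x)) ->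
  F k.+2%:R - F (k.+2%:R)^-1 @[k --> \oo] --> l ->
  (\int[mu]_(x in `]0%R, +oo[) (f x)%:E = l%:E)%E.
Proof.
move=> If cf dF Fl.
have mD : measurable (`]0, +oo[%classic : set R) by exact: measurable_itv.
have mf : measurable_fun (`]0, +oo[%classic : set R) (EFin \o f).
  by case/integrableP : If.
have mfk k : measurable_fun (`]0, +oo[%classic : set R) ((EFin \o f) \_ (K k)).
  apply/measurable_restrict => //.
  by apply: measurable_funS mf => // x [].
have fK : {ae mu, forall x, (`]0, +oo[%classic : set R) x ->
    ((EFin \o f) \_ (K k)) x @[k --> \oo] --> (EFin \o f) x}.
  apply: aeW => x /=; rewrite -[X in X -> _]/((`]0, +oo[%classic : set R) x) -bigcup_pos_itv.
  move=> [k _ Kx]; apply: cvg_near_cst; near=> j.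
  have kj : (k <= j)%N by near: j; exact: nbhs_infty_ge.
  by have /subsetPset Kkj := nondecreasing_pos_itv kj; rewrite patchE mem_set//; exact: Kkj.
have f_g : {ae mu, forall x k, (`]0, +oo[%classic : set R) x ->
    (`|((EFin \o f) \_ (K k)) x| <= (abse \o (EFin \o f)) x)%E}.
  apply: aeW => x k _ /=; rewrite patchE; case: ifP => //; by rewrite abse0.
have [_ _] := @dominated_convergence _ _ _ mu _ mD _ _ _ mfk mf fK (integrable_abse If) f_g.
rewrite (_ : [sequence _]_n = fun k => (F k.+2%:R - F (k.+2%:R)^-1)%:E); last first.
  apply/funext => k /=; rewrite -(FTC_K _ cf dF) [RHS]integral_mkcond [LHS]integral_mkcond.
  apply: eq_integral => x _; rewrite !patchE; case: ifPn => // xD.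
  by case: ifPn => // /set_mem/KS/mem_set; rewrite (negbTE xD).
move=> h; apply: (cvg_unique _ h) => //.
by apply: cvg_EFin => //; exact: nearW.
Unshelve. all: by end_near. Qed.

End half_line.

(** * Integrals of powers and the Gamma function *)

Section power_integrals.
Context {R : realType}.
Local Notation mu := (@lebesgue_measure R).
Local Notation pos := (`]0, +oo[%classic : set (measurableTypeR R)).

Lemma measurable_pos : measurable pos.
Proof. exact: measurable_itv. Qed.

Lemma posP (x : R) : pos x <-> 0 < x.
Proof. by rewrite /= in_itv/= andbT. Qed.

Lemma integrable_pos_le (f g : R -> R) : measurable_fun pos f ->
  mu.-integrable pos (EFin \o g) -> (forall x : R, 0 < x -> `|f x| <= g x) ->
  mu.-integrable pos (EFin \o f).
Proof.
move=> mf ig fg; apply: (le_integrable measurable_pos _ _ ig).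
  exact/measurable_EFinP.
move=> x /posP x0 /=; rewrite lee_fin; apply: le_trans (fg x x0) _.
exact: ler_norm.
Qed.

Lemma ge0_integrable_pos (f : R -> R) (l : R) : measurable_fun pos f ->
  (forall x : R, 0 < x -> 0 <= f x) ->
  (\int[mu]_(x in pos) (f x)%:E = l%:E)%E -> mu.-integrable pos (EFin \o f).
Proof.
move=> mf f0 fl; apply/integrableP; split; first exact/measurable_EFinP.
rewrite (_ : (\int[mu]_(x in pos) _ = \int[mu]_(x in pos) (f x)%:E)%E).
  by rewrite fl ltry.
apply: eq_integral => x /set_mem/posP x0 /=.
by rewrite ger0_norm// f0.
Qed.

Lemma cvg_inv_powR (b : R) : 0 < b -> (k.+2%:R^-1 `^ b : R) @[k --> \oo] --> (0 : R).
Proof.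
move=> b0; have /cvg_at_rightP := powR_cvg0 b0; apply; split.
  by move=> k; rewrite invr_gt0.
have := @cvg_harmonic R; rewrite -(cvg_shiftS (@harmonic R)) /harmonic/=.
exact.
Qed.

Lemma cvg_inv_nat : (k.+2%:R^-1 : R) @[k --> \oo] --> (0 : R).
Proof.
have := @cvg_harmonic R; rewrite -(cvg_shiftS (@harmonic R)) /harmonic/=.
exact.
Qed.

Lemma continuous_powR (b x : R) : 0 < x -> {for x, continuous (fun y : R => y `^ b)}.
Proof.
move=> x0; apply: differentiable_continuous; apply/derivable1_diffP.
by apply: derivable_powR; rewrite in_itv/= andbT.
Qed.

Lemma is_derive_powRD (c b x : R) : 0 < c + x ->
  is_derive x 1 (fun y => (c + y) `^ b) (b * (c + x) `^ (b - 1)).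
Proof.
move=> x0; have h1 : is_derive x 1 (fun v => c + v) 1.
  by apply: (derive_eq (derive_add (is_derive_cst c x 1) (is_derive_id x 1))); rewrite add0r.
by apply: (derive_eq (is_derive1_comp (is_derive1_powR b x0) h1)); rewrite mulr1.
Qed.

Lemma continuous_powRD (c b x : R) : 0 < c + x ->
  {for x, continuous (fun y : R => (c + y) `^ b)}.
Proof.
move=> x0; apply: differentiable_continuous; apply/derivable1_diffP.
by have [] := is_derive_powRD b x0.
Qed.

Lemma measurable_powR_in (b : R) (D : set R) : measurable_fun D (fun x : R => x `^ b).
Proof. by apply: measurable_funTS; exact: measurable_powR. Qed.

Lemma measurable_powRD_in (c b : R) (D : set R) :
  measurable_fun D (fun x : R => (c + x) `^ b).
Proof.
apply: measurable_funTS; apply: (measurableT_comp (measurable_powR b)).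
exact: measurable_funD.
Qed.

Lemma powRNV (y b : R) : 0 <= y -> y `^ (- b) = y^-1 `^ b.
Proof. by move=> y0; rewrite -powR_inv1// -powRrM mulN1r. Qed.

Lemma powR_pred (y b : R) : 0 < y -> y `^ b = y * y `^ (b - 1).
Proof.
move=> y0; rewrite -[X in _ = X * _](powRr1 (ltW y0)) -powRD.
  by rewrite addrC subrK.
by rewrite (gt_eqF y0) implybT.
Qed.

(** A primitive is [(x / (1 + x)) ^ a]. *)
Lemma integral_powR_ratio (a : R) : 0 < a ->
  (\int[mu]_(x in pos) (a * (x `^ (a - 1) * (1 + x) `^ (- a - 1)))%:E = 1)%E.
Proof.
move=> a0.
have x1 (x : R) : 0 < x -> 0 < 1 + x by move=> x0; rewrite addr_gt0.
have dF (x : R) : 0 < x -> is_derive x 1 (fun x => x `^ a * (1 + x) `^ (- a))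
    (a * (x `^ (a - 1) * (1 + x) `^ (- a - 1))).
  move=> x0.
  apply: (derive_eq (derive_mul (is_derive1_powR a x0) (is_derive_powRD (- a) (x1 x x0)))).
  have -> : x `^ a = x * x `^ (a - 1) by rewrite mulr_powRB1// ltW.
  by rewrite (powR_pred (- a) (x1 x x0)); ring.
apply: (integral_FTC_pos_ge0 _ _ dF).
- by move=> x x0; rewrite mulr_ge0 ?ltW// mulr_gt0// powR_gt0// x1.
- move=> x x0; apply: cvgM; first exact: cvg_cst.
  by apply: cvgM; [exact: continuous_powR|apply: continuous_powRD; exact: x1].
rewrite [X in _ --> X](_ : _ = 1 - 0); last by rewrite subr0.
apply: cvgB.
  rewrite (_ : (fun k => _) = (fun k : nat => (1 - (k.+3%:R)^-1) `^ a)); last first.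
    apply/funext => k; have k0 : 0 <= 1 + k.+2%:R :> R by rewrite nat1r.
    rewrite powRNV// -powRM ?invr_ge0//; congr (_ `^ _).
    have k1 : 1 + k.+2%:R != 0 :> R by rewrite nat1r pnatr_eq0.
    by apply: (mulIf k1); rewrite divfK// -[k.+3%:R]nat1r mulrBl mul1r mulVf// addrC addKr.
  have h : (1 - (k.+3%:R)^-1 : R) @[k --> \oo] --> (1 - 0 : R).
    apply: cvgB; first exact: cvg_cst.
    by have := cvg_inv_nat; rewrite -(cvg_shiftS (fun k : nat => k.+2%:R^-1 : R)).
  rewrite [X in _ --> X](_ : _ = (1 - 0) `^ a); last by rewrite subr0 powR1.
  apply: (@cvg_comp _ _ _ (fun k : nat => 1 - (k.+3%:R)^-1) (fun y : R => y `^ a) _ _ _ h).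
  by apply: continuous_powR; rewrite subr0.
apply: (@squeeze_cvgr _ _ _ _ (cst 0) (fun k : nat => (k.+2%:R^-1 : R) `^ a)).
- near=> k; rewrite mulr_ge0 ?powR_ge0//=.
  rewrite -[leRHS]mulr1 ler_wpM2l ?powR_ge0// powRN invf_le1 ?powR_gt0 ?addr_gt0 ?invr_gt0//.
  by rewrite -[leLHS](powRr0 (1 + k.+2%:R^-1)) ler_powR ?(ltW a0)// lerDl invr_ge0.
- exact: cvg_cst.
- exact: cvg_inv_powR.
Unshelve. all: by end_near. Qed.

Lemma integral_powRD (d : R) : 0 < d ->
  (\int[mu]_(x in pos) (d * (1 + x) `^ (- d - 1))%:E = 1)%E.
Proof.
move=> d0.
have x1 (x : R) : 0 < x -> 0 < 1 + x by move=> x0; rewrite addr_gt0.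
have dF (x : R) : 0 < x -> is_derive x 1 (fun x => -1 * (1 + x) `^ (- d))
    (d * (1 + x) `^ (- d - 1)).
  move=> x0; apply: (derive_eq (derive_scale (-1) (is_derive_powRD (- d) (x1 x x0)))).
  by ring.
apply: (integral_FTC_pos_ge0 _ _ dF).
- by move=> x x0; rewrite mulr_ge0 ?ltW// powR_gt0// x1.
- move=> x x0; apply: cvgM; first exact: cvg_cst.
  by apply: continuous_powRD; exact: x1.
rewrite [X in _ --> X](_ : _ = 0 - (-1)); last by rewrite sub0r opprK.
apply: cvgB.
  rewrite [X in _ --> X](_ : _ = -1 * 0); last by rewrite mulr0.
  apply: cvgM; first exact: cvg_cst.
  rewrite (_ : (fun k => _) = (fun k : nat => (k.+3%:R)^-1 `^ d)); last first.
    by apply/funext => k; rewrite nat1r powRNV.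
  have := cvg_inv_powR d0.
  by rewrite -(cvg_shiftS (fun k : nat => (k.+2%:R^-1 : R) `^ d)).
rewrite [X in _ --> X](_ : _ = -1 * (1 + 0) `^ (- d)); last by rewrite addr0 powR1 mulr1.
apply: cvgM; first exact: cvg_cst.
have h : (1 + (k.+2%:R)^-1 : R) @[k --> \oo] --> (1 + 0 : R).
  by apply: cvgD; [exact: cvg_cst|exact: cvg_inv_nat].
apply: (@cvg_comp _ _ _ (fun k : nat => 1 + (k.+2%:R)^-1) (fun y : R => y `^ (- d)) _ _ _ h).
by apply: continuous_powR; rewrite addr0.
Qed.

(** Near 0 the integrand is dominated by that of [integral_powR_ratio], and beyond
  1 by that of [integral_powRD]. *)
Lemma integrable_beta (a m : R) : 0 < a -> a < m ->
  mu.-integrable pos (EFin \o (fun x => x `^ (a - 1) * (1 + x) `^ (- m))).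
Proof.
move=> a0 am; have d0 : 0 < m - a by rewrite subr_gt0.
have x1 (x : R) : 0 < x -> 0 < 1 + x by move=> x0; rewrite addr_gt0.
have i1 : mu.-integrable pos
    (EFin \o (fun x => a * (x `^ (a - 1) * (1 + x) `^ (- a - 1)))).
  apply: (ge0_integrable_pos _ _ (integral_powR_ratio a0)).
    apply: measurable_funM => //; apply: measurable_funM.
      exact: measurable_powR_in.
    exact: measurable_powRD_in.
  by move=> x x0; rewrite mulr_ge0 ?ltW// mulr_gt0// powR_gt0// x1.
have i2 : mu.-integrable pos
    (EFin \o (fun x => (m - a) * (1 + x) `^ (- (m - a) - 1))).
  apply: (ge0_integrable_pos _ _ (integral_powRD d0)).
    by apply: measurable_funM => //; exact: measurable_powRD_in.
  by move=> x x0; rewrite mulr_ge0 ?(ltW d0)// powR_ge0.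
pose C1 := 2 `^ (a + 1) / a; pose C2 := 2 / (m - a).
have ig := integrableD measurable_pos (integrableZl measurable_pos C1 i1)
   (integrableZl measurable_pos C2 i2).
apply: (integrable_pos_le (g := fun x => C1 * (a * (x `^ (a - 1) * (1 + x) `^ (- a - 1))) +
   C2 * ((m - a) * (1 + x) `^ (- (m - a) - 1)))).
- by apply: measurable_funM; [exact: measurable_powR_in|exact: measurable_powRD_in].
- exact: ig.
move=> x x0; have x2 := x1 x x0.
rewrite ger0_norm ?mulr_ge0 ?powR_ge0//.
have -> : C1 * (a * (x `^ (a - 1) * (1 + x) `^ (- a - 1))) =
    2 `^ (a + 1) * (1 + x) `^ (- a - 1) * x `^ (a - 1).
  by rewrite /C1; field; rewrite gt_eqF.
have -> : C2 * ((m - a) * (1 + x) `^ (- (m - a) - 1)) = 2 * (1 + x) `^ (- (m - a) - 1).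
  by rewrite /C2; field; rewrite gt_eqF.
have [xle1|xgt1] := leP x 1.
  rewrite -[leLHS]addr0 lerD ?mulr_ge0 ?powR_ge0// mulrC ler_wpM2r ?powR_ge0//.
  rewrite (@le_trans _ _ 1)//.
    by rewrite -[leRHS](powRr0 (1 + x)) ler_powR ?lerDl ?(ltW x0)// oppr_le0 (ltW (lt_trans a0 am)).
  rewrite -opprD powRN ler_pdivlMr ?powR_gt0// mul1r.
  by rewrite ge0_ler_powR ?nnegrE ?addr_ge0 ?(ltW a0) ?(ltW x0)// lerD2l.
rewrite -[leLHS]add0r lerD ?mulr_ge0 ?powR_ge0//.
rewrite (_ : - (m - a) - 1 = (a - 1) + - m); last by ring.
rewrite (@powRD _ (1 + x) (a - 1) (- m)) ?(gt_eqF x2) ?implybT// mulrA.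
rewrite ler_wpM2r ?powR_ge0//.
have [a1|a1] := leP 1 a.
  rewrite (@le_trans _ _ ((1 + x) `^ (a - 1)))//.
    by rewrite ge0_ler_powR ?nnegrE ?subr_ge0 ?(ltW x0) ?(ltW x2)// lerDr.
  by rewrite ler_peMl ?powR_ge0// ler1n.
have e0 : 0 <= 1 - a by rewrite subr_ge0 ltW.
have e1 : 1 - a <= 1 by rewrite lerBlDr lerDl ltW.
rewrite -(opprB 1 a) !powRN ler_pdivlMr ?powR_gt0// mulrC ler_pdivrMr ?powR_gt0//.
rewrite (@le_trans _ _ ((2 * x) `^ (1 - a)))//.
  by rewrite ge0_ler_powR ?nnegrE ?mulr_ge0 ?(ltW x2) ?(ltW x0)// mulr2n mulrDl !mul1r lerD2r ltW.
rewrite powRM ?(ltW x0)// ler_wpM2r ?powR_ge0//.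
by rewrite -[leRHS]powRr1// ler_powR// ler1n.
Qed.

End power_integrals.

Section gamma_function.
Context {R : realType}.
Local Notation mu := (@lebesgue_measure R).
Local Notation pos := (`]0, +oo[%classic : set (measurableTypeR R)).

(** This is [y <= expR y] for [y = (1 + t) / s], raised to the power [s]. *)
Lemma powR_le_expR (s t : R) : 0 < s -> 0 < t ->
  (1 + t) `^ s <= s `^ s * expR 1 * expR t.
Proof.
move=> s0 t0; rewrite -mulrA -expRD.
rewrite (_ : 1 + t = s * ((1 + t) / s)); last by rewrite mulrC divfK// gt_eqF.
have u0 : 0 <= (1 + t) / s by rewrite divr_ge0 ?addr_ge0 ?(ltW s0) ?(ltW t0).
rewrite powRM ?(ltW s0)// ler_wpM2l ?powR_ge0//.
rewrite [s * _]mulrC expRM ge0_ler_powR ?nnegrE ?expR_ge0 ?(ltW s0)//.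
by rewrite (le_trans _ (expR_ge1Dx _))// lerDr.
Qed.

Lemma measurable_expRN (D : set R) : measurable_fun D (fun t : R => expR (- t)).
Proof.
by apply: measurable_funTS; apply: (measurableT_comp (@measurable_expR R)).
Qed.

Lemma integrable_Gamma (s : R) : 0 < s ->
  mu.-integrable pos (EFin \o (fun t => t `^ (s - 1) * expR (- t))).
Proof.
move=> s0; have s1 : 0 < s + 1 by rewrite addr_gt0.
have ss : s < s + 1 by rewrite ltrDl.
pose C := (s + 1) `^ (s + 1) * expR 1.
have ib := integrable_beta s0 ss.
apply: (integrable_pos_le (g := fun t => C * (t `^ (s - 1) * (1 + t) `^ (- (s + 1))))).
- apply: measurable_funM; [exact: measurable_powR_in|exact: measurable_expRN].
- exact: (integrableZl measurable_pos C ib).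
move=> t t0; rewrite ger0_norm ?mulr_ge0 ?powR_ge0 ?expR_ge0//.
rewrite mulrCA ler_wpM2l ?powR_ge0// powRN expRN ler_pdivlMr ?powR_gt0 ?addr_gt0//.
by rewrite mulrC ler_pdivrMr ?expR_gt0// powR_le_expR.
Qed.

(** Integrating the derivative of [t ^ s * expR (- t)], which vanishes at both ends. *)
Lemma GammaS (s : R) : 0 < s -> Gamma (s + 1) = s * Gamma s.
Proof.
move=> s0; have s1 : 0 < s + 1 by rewrite addr_gt0.
pose f (t : R) := s * (t `^ (s - 1) * expR (- t)) - t `^ (s + 1 - 1) * expR (- t).
have i1 := integrableZl measurable_pos s (integrable_Gamma s0).
have i2 := integrable_Gamma s1.
have dN (x : R) : is_derive x 1 (fun t => expR (- t)) (- expR (- x)).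
  by apply: (derive_eq (is_derive1_comp (is_derive_expR (- x)) (is_deriveNid x 1))); rewrite mulrN1.
have dF (x : R) : 0 < x -> is_derive x 1 (fun t => t `^ s * expR (- t)) (f x).
  move=> x0; apply: (derive_eq (derive_mul (is_derive1_powR s x0) (dN x))).
  by rewrite /f addrK; ring.
have I0 : (\int[mu]_(t in pos) (f t)%:E = 0%:E)%E.
  apply: (integral_FTC_pos _ _ dF).
  - exact: (integrableB measurable_pos i1 i2).
  - move=> x x0; have ce : {for x, continuous (fun t : R => expR (- t))}.
      by apply: differentiable_continuous; apply/derivable1_diffP; have [] := dN x.
    apply: cvgB.
      apply: cvgM; first exact: cvg_cst.
      by apply: cvgM; [exact: continuous_powR|exact: ce].
    by apply: cvgM; [exact: continuous_powR|exact: ce].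
  rewrite [X in _ --> X](_ : _ = 0 - 0); last by rewrite subr0.
  apply: cvgB; last first.
    apply: (@squeeze_cvgr _ _ _ _ (cst 0) (fun k : nat => (k.+2%:R^-1 : R) `^ s)).
    - near=> k; rewrite mulr_ge0 ?powR_ge0 ?expR_ge0//=.
      by rewrite -[leRHS]mulr1 ler_wpM2l ?powR_ge0// expR_le1 oppr_le0 invr_ge0.
    - exact: cvg_cst.
    - exact: cvg_inv_powR.
  pose C := (s + 1) `^ (s + 1) * expR 1.
  apply: (@squeeze_cvgr _ _ _ _ (cst 0) (fun k : nat => C * (k.+2%:R^-1 : R))).
  - near=> k; rewrite mulr_ge0 ?powR_ge0 ?expR_ge0//= expRN.
    rewrite ler_pdivrMr ?expR_gt0// mulrAC ler_pdivlMr//.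
    have k0 : 0 < k.+2%:R :> R by [].
    rewrite (le_trans _ (powR_le_expR s1 k0))//.
    rewrite mulrC -[X in X * _](powRr1 (ltW k0)) -powRD ?(gt_eqF k0) ?implybT// addrC.
    by rewrite ge0_ler_powR ?nnegrE ?(ltW s1) ?nat1r// ler_nat.
  - exact: cvg_cst.
  - rewrite [X in _ --> X](_ : _ = C * 0); last by rewrite mulr0.
    by apply: cvgM; [exact: cvg_cst|exact: cvg_inv_nat].
have := congr1 fine I0; rewrite -[LHS]/(\int[mu]_(t in pos) (f t)) /=.
rewrite (@RintegralB _ _ _ mu pos _ _ measurable_pos i1 i2).
rewrite (@RintegralZl _ _ _ mu pos _ s measurable_pos (integrable_Gamma s0)).
by move/eqP; rewrite subr_eq0 => /eqP/esym; exact.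
Unshelve. all: by end_near. Qed.

Lemma Gamma1 : Gamma (1 : R) = 1.
Proof.
rewrite /Gamma /Rintegral (_ : (\int[mu]_(t in _) _ =
  \int[mu]_(t in pos) (expR (- t))%:E)%E); last first.
  by apply: eq_integral => t _; rewrite subrr powRr0 mul1r.
have dN (x : R) : 0 < x -> is_derive x 1 (fun t => -1 * expR (- t)) (expR (- x)).
  move=> _; have h := is_derive1_comp (is_derive_expR (- x)) (is_deriveNid x 1).
  by apply: (derive_eq (derive_scale (-1) h)); rewrite mulrN1 mulN1r opprK.
have ce (x : R) : {for x, continuous (fun t : R => expR (- t))}.
  by apply: continuous_comp; [exact: continuousN|exact: continuous_expR].
rewrite (integral_FTC_pos_ge0 (l := 1) _ _ dN)//.
rewrite [X in _ --> X](_ : _ = -1 * 0 - (-1 * expR (- 0))); last first.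
  by rewrite oppr0 expR0 mulr0 mulr1 sub0r opprK.
apply: cvgB; (apply: cvgM; first exact: cvg_cst).
  have := @cvgn_expR R; rewrite -(cvg_shiftS (fun n : nat => expR (- n%:R) : R)).
  by rewrite -(cvg_shiftS (fun n : nat => expR (- n.+1%:R) : R)).
apply: (@cvg_comp _ _ _ (fun k : nat => k.+2%:R^-1) (fun y : R => expR (- y)) _ _ _ cvg_inv_nat).
exact: ce.
Qed.

Lemma Gamma_nat n : Gamma (n.+1%:R : R) = n`!%:R.
Proof.
elim: n => [|n ih]; first exact: Gamma1.
by rewrite -natr1 GammaS// ih factS natrM.
Qed.

(** Integrals over the half-line are written over the line with this factor, so
  that the affine substitutions apply to them. *)
Definition pos_indic (x : R) : R := (0 < x)%R%:R.

Lemma measurable_pos_indic : measurable_fun [set: R] pos_indic.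
Proof.
rewrite (_ : pos_indic = \1_(`]0%R, +oo[%classic : set R)).
  by apply: measurable_indic; exact: measurable_itv.
by apply/funext => u; rewrite indicE mem_setE/= in_itv/= andbT.
Qed.

Lemma integral_pos_indic (g : R -> R) :
  (\int[mu]_x (pos_indic x * g x)%:E = \int[mu]_(x in pos) (g x)%:E)%E.
Proof.
rewrite [RHS]integral_mkcond; apply: eq_integral => x _.
rewrite patchE mem_setE/= in_itv/= andbT /pos_indic.
by case: ifP => _; rewrite ?mul1r// mul0r.
Qed.

Lemma EFin_Gamma (s : R) : 0 < s ->
  (Gamma s)%:E = (\int[mu]_t (pos_indic t * (t `^ (s - 1) * expR (- t)))%:E)%E.
Proof.
move=> s0; rewrite integral_pos_indic /Gamma /Rintegral fineK//.
apply: integrable_fin_num; first exact: measurable_pos.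
exact: integrable_Gamma.
Qed.

(** Euler's formula for the Beta integral, by exchanging the integrations in the
  product of the two Gamma integrals. *)
Lemma GammaM (a b : R) m : 0 < a -> 0 < b -> a + b = m.+1%:R ->
  (Gamma a * Gamma b)%:E =
  (m`!%:R%:E * \int[mu]_(x in pos) (x `^ (a - 1) * (1 + x)^-1 ^+ m.+1)%:E)%E.
Proof.
move=> a0 b0 ab.
pose g (s t : R) := pos_indic t * (t `^ (s - 1) * expR (- t)).
have mg s : measurable_fun [set: R] (g s).
  apply: measurable_funM; first exact: measurable_pos_indic.
  by apply: measurable_funM; [exact: measurable_powR_in|exact: measurable_expRN].
have mgE s : measurable_fun [set: R] (fun t => (g s t)%:E) by apply/measurable_EFinP; exact: mg.
have g0 s t : 0 <= g s t by rewrite !mulr_ge0// ?powR_ge0 ?expR_ge0.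
have gE s : 0 < s -> (\int[mu]_t (g s t)%:E = (Gamma s)%:E)%E by move=> /EFin_Gamma ->.
rewrite mulrC EFinM -(gE b b0) -ge0_integralZr//; last 3 first.
- exact: mgE.
- by move=> t _; rewrite lee_fin.
- by rewrite -gE// integral_ge0// => t _; rewrite lee_fin.
pose H (s x : R) := pos_indic x * x `^ (a - 1) * (pos_indic s * (s ^+ m * expR (- (s * (1 + x))))).
have mH : measurable_fun setT (fun p : R * R => (H p.1 p.2)%:E).
  apply/measurable_EFinP; apply: measurable_funM.
    apply: (@measurableT_comp _ _ _ _ _ _ (fun x : R => pos_indic x * x `^ (a - 1))).
      by apply: measurable_funM; [exact: measurable_pos_indic|exact: measurable_powR_in].
    exact: measurable_snd.
  apply: measurable_funM.
    by apply: (measurableT_comp measurable_pos_indic); exact: measurable_fst.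
  apply: measurable_funM; first by apply: measurable_funX; exact: measurable_fst.
  apply: (measurableT_comp (@measurable_expR R)); apply: measurableT_comp => //.
  apply: measurable_funM; first exact: measurable_fst.
  by apply: measurable_funD => //; exact: measurable_snd.
have H0 s x : (0 <= (H s x)%:E)%E.
  rewrite lee_fin /H /pos_indic; case: (ltP 0 s) => [s0|_]; last by rewrite !(mul0r, mulr0).
  by rewrite !mulr_ge0// ?powR_ge0 ?expR_ge0 ?exprn_ge0 ?ltW.
(* For fixed [s], the variable of [Gamma a] is replaced by [s * x]. *)
transitivity (\int[mu]_s \int[mu]_x (H s x)%:E)%E.
  apply: eq_integral => s _; rewrite /H /g.
  have [s0|s0] := ltP 0 s; last first.
    rewrite /pos_indic ltNge s0 !mul0r mul0e integral0_eq// => x _.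
    by rewrite !mul0r mulr0.
  rewrite -(gE a a0) (integral_affine 0 s0); [|exact: mgE|by move=> x; rewrite lee_fin].
  rewrite muleA -EFinM -ge0_integralZl//; last 3 first.
  - apply/measurable_EFinP; apply: (measurableT_comp (mg a)); exact: measurable_affine.
  - by move=> x _; rewrite lee_fin.
  - by rewrite lee_fin !mulr_ge0// ?powR_ge0 ?expR_ge0 ?ltW.
  apply: eq_integral => x _; rewrite -EFinM addr0; congr EFin.
  rewrite /g /pos_indic s0 pmulr_rgt0//; have [x0|x0] := ltP 0 x; last by rewrite !mul0r mulr0.
  rewrite !mul1r powRM ?(ltW s0) ?(ltW x0)// mulrDr mulr1 opprD expRD.
  rewrite -powR_mulrn ?(ltW s0)// (_ : m%:R = (b - 1) + 1 + (a - 1)); last first.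
    by rewrite subrK addrA (addrC b) ab -natr1 addrK.
  rewrite (@powRD _ s (b - 1 + 1) (a - 1)) ?(gt_eqF s0) ?implybT//.
  rewrite (@powRD _ s (b - 1) 1) ?(gt_eqF s0) ?implybT// powRr1 ?(ltW s0)//; ring.
rewrite (@ge0_integral_exchange R _ _ _ _ mu mu (fun s x => (H s x)%:E) mH H0).
rewrite -integral_pos_indic -ge0_integralZl//; last 2 first.
- apply/measurable_EFinP; apply: measurable_funM; first exact: measurable_pos_indic.
  apply: measurable_funM; first exact: measurable_powR_in.
  by apply: measurable_funX; apply: measurable_funVr; exact: measurable_funD.
- move=> x _; rewrite lee_fin /pos_indic; case: (ltP 0 x) => [x0|_]; last by rewrite mul0r.
  by rewrite mul1r mulr_ge0 ?powR_ge0// exprn_ge0// invr_ge0 addr_ge0// ltW.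
apply: eq_integral => x _; have [x0|x0] := ltP 0 x; last first.
  rewrite /H /pos_indic ltNge x0 !mul0r mule0 integral0_eq// => s _.
  by rewrite !mul0r.
have x1 : 0 < 1 + x by rewrite addr_gt0.
pose h (s : R) := pos_indic s * (s ^+ m * expR (- (s * (1 + x)))).
have mh : measurable_fun [set: R] h.
  apply: measurable_funM; first exact: measurable_pos_indic.
  apply: measurable_funM; first exact: measurable_funX.
  apply: (measurableT_comp (@measurable_expR R)); apply: measurableT_comp => //.
  exact: measurable_funM.
have mhE : measurable_fun [set: R] (fun s => (h s)%:E) by apply/measurable_EFinP; exact: mh.
have h0 s : 0 <= h s.
  rewrite /h /pos_indic; case: (ltP 0 s) => [s0|_]; last by rewrite mul0r.
  by rewrite !mulr_ge0// ?expR_ge0 ?exprn_ge0 ?ltW.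
transitivity ((x `^ (a - 1))%:E * \int[mu]_s (h s)%:E)%E.
  rewrite -ge0_integralZl//; last 2 first.
  - by move=> s _; rewrite lee_fin.
  - by rewrite lee_fin powR_ge0.
  by apply: eq_integral => s _; rewrite /H -EFinM /pos_indic x0 mul1r.
have ix1 : 0 < (1 + x)^-1 by rewrite invr_gt0.
rewrite (integral_affine 0 ix1); [|exact: mhE|by move=> s; rewrite lee_fin].
rewrite (eq_integral_line (g := fun s => ((1 + x)^-1 ^+ m)%:E * (g m.+1%:R s)%:E)%E); last first.
  move=> s; rewrite -EFinM; congr EFin; rewrite /h /g addr0 /pos_indic pmulr_rgt0//.
  have [s0|s0] := ltP 0 s; last by rewrite !mul0r mulr0.
  rewrite /= !mul1r (_ : m.+1%:R - 1 = m%:R :> R); last first.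
    by rewrite -natr1 addrK.
  rewrite powR_mulrn ?(ltW s0)// (_ : (1 + x)^-1 * s * (1 + x) = s).
    by rewrite exprMn mulrA.
  by rewrite mulrAC mulVf ?mul1r// gt_eqF.
rewrite ge0_integralZl//; last 3 first.
- exact: mgE.
- by move=> s _; rewrite lee_fin.
- by rewrite lee_fin exprn_ge0// ltW.
rewrite gE// Gamma_nat -!EFinM /pos_indic x0; congr EFin.
by rewrite (exprS _ m) [true%:R]/(1 : R) mul1r; ring.
Qed.

(** By [GammaM], the square is the integral of the derivative of
  [2 * atan (sqrt x)]. *)
Lemma Gamma_half : Gamma (2^-1 : R) ^+ 2 = pi.
Proof.
have h0 : 0 < 2^-1 :> R by rewrite invr_gt0.
have hh : 2^-1 + 2^-1 = 1%:R :> R by field.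
apply: EFin_inj; rewrite expr2 (GammaM (m := 0) h0 h0 hh) fact0 mul1e.
have dF (x : R) : 0 < x -> is_derive x 1 (fun x => 2 * atan (x `^ 2^-1))
    (x `^ (2^-1 - 1) * (1 + x)^-1 ^+ 1).
  move=> x0; have h1 := @is_derive1_comp R (@atan R) (fun y => y `^ 2^-1) x _ _ (is_derive1_atan _) (is_derive1_powR 2^-1 x0).
  apply: (derive_eq (derive_scale 2 h1)).
  by rewrite powR12_sqrt ?(ltW x0)// sqr_sqrtr ?(ltW x0)// expr1; field; rewrite gt_eqF// addr_gt0.
apply: (integral_FTC_pos_ge0 _ _ dF).
- by move=> x x0; rewrite mulr_ge0 ?powR_ge0// exprn_ge0// invr_ge0 addr_ge0// ltW.
- move=> x x0; have x1 : 1 + x != 0 by rewrite gt_eqF// addr_gt0.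
  have c1 : {for x, continuous (fun y : R => (1 + y)^-1 ^+ 1)}.
    have h1 : {for x, continuous (fun y : R => 1 + y)}.
      by apply: cvgD; [exact: cvg_cst|exact: cvg_id].
    exact: (cvgV x1 h1).
  by apply: cvgM; [exact: continuous_powR|exact: c1].
rewrite [X in _ --> X](_ : _ = 2 * (pi / 2) - 2 * atan 0); last first.
  by rewrite atan0 mulr0 subr0 mulrC divfK.
apply: cvgB; (apply: cvgM; first exact: cvg_cst).
  have hk : ((k.+2%:R : R) `^ 2^-1) @[k --> \oo] --> +oo%R.
    apply/cvgryPge => A; near=> k.
    rewrite powR12_sqrt// (le_trans (ler_norm A))// -sqrtr_sqr ler_sqrt//.
    rewrite (le_trans (ltW (archi_boundP (sqr_ge0 A))))// ler_nat.
    by apply: (@leq_trans k); [near: k; exact: nbhs_infty_ge|rewrite -addn2 leq_addr].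
  exact: (@cvg_comp _ _ _ _ (@atan R) _ _ _ hk (@cvgy_atan R)).
apply: (@cvg_comp _ _ _ (fun k : nat => k.+2%:R^-1 `^ 2^-1) (@atan R) _ _ _ (cvg_inv_powR h0)).
exact: continuous_atan.
Unshelve. all: by end_near. Qed.

(** Both sides satisfy the same recursion of step two. *)
Lemma wallis_Gamma n :
  wallis n * 2 ^+ n * Gamma (n.+2%:R / 2 : R) ^+ 2 = pi * n`!%:R.
Proof.
elim/nat_ind2: n => [||n ih _].
- by rewrite divff// Gamma1 expr1n !mulr1.
- rewrite (_ : 3%:R / 2 = 2^-1 + 1 :> R); last by field.
  by rewrite GammaS ?invr_gt0// exprMn Gamma_half /= expr1 mulr1; field.
have n0 : 0 < n.+2%:R / 2 :> R by rewrite divr_gt0.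
rewrite (_ : n.+4%:R / 2 = n.+2%:R / 2 + 1 :> R); last first.
  by rewrite -[n.+4]addn2 natrD; field.
rewrite GammaS//= !factS !natrM.
transitivity (n.+2%:R * n.+1%:R * (wallis n * 2 ^+ n * Gamma (n.+2%:R / 2 : R) ^+ 2)).
  have n2 : n.+2%:R != 0 :> R by rewrite pnatr_eq0.
  move: n2; move: (n.+2%:R : R) (n.+1%:R : R) => u v u0.
  by rewrite !exprS; field.
by rewrite ih; ring.
Qed.

End gamma_function.

Lemma ge0_integral_EFinZl d (T : measurableType d) (R : realType)
    (m : {measure set T -> \bar R}) (k : R) (g : T -> R) :
  0 <= k -> measurable_fun setT g -> (forall x, 0 <= g x) ->
  (\int[m]_x (k * g x)%:E = k%:E * \int[m]_x (g x)%:E)%E.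
Proof.
move=> k0 mg g0; rewrite -ge0_integralZl//; last by move=> x _; rewrite lee_fin.
exact/measurable_EFinP.
Qed.

(** * Rotating the contour of the Beta integral *)

Section complex_facts.
Context {R : realType}.
Implicit Types (z w : R[i]) (x y : R).

Definition cis (t : R) : R[i] := (cos t +i* sin t)%C.

Lemma cis0 : cis 0 = 1.
Proof. by rewrite /cis cos0 sin0. Qed.

Lemma cisD s t : cis (s + t) = cis s * cis t.
Proof.
by apply/eqP; rewrite eq_complex /cis /= cosD sinD eqxx addrC eqxx.
Qed.

Lemma cis_nat m t : cis (m%:R * t) = cis t ^+ m.
Proof.
elim: m => [|m ih]; first by rewrite mul0r cis0 expr0.
by rewrite -natr1 mulrDl mul1r cisD ih exprSr.
Qed.

Lemma normc_cis t : normc (cis t) = 1.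
Proof. by rewrite /cis /= cos2Dsin2 sqrtr1. Qed.

Lemma normc_ge0 z : 0 <= normc z.
Proof. by case: z => x y; exact: sqrtr_ge0. Qed.

Lemma normcM z w : normc (z * w) = normc z * normc w.
Proof. exact: ComplexField.Normc.normcM. Qed.

Lemma normcV z : normc z^-1 = (normc z)^-1.
Proof. exact: ComplexField.Normc.normcV. Qed.

Lemma normcX z k : normc (z ^+ k) = normc z ^+ k.
Proof.
elim: k => [|k ih]; first by rewrite !expr0; exact: ComplexField.Normc.normc1.
by rewrite !exprS normcM ih.
Qed.

Lemma normc_real x : normc x%:C%C = `|x|.
Proof. by rewrite /= expr0n addr0 sqrtr_sqr. Qed.

Lemma normc_ge_Re z : `|Re z| <= normc z.
Proof.
by case: z => x y /=; rewrite -sqrtr_sqr ler_sqrt ?addr_ge0 ?sqr_ge0// lerDl sqr_ge0.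
Qed.

Lemma normc_ge_Im z : `|Im z| <= normc z.
Proof.
by case: z => x y /=; rewrite -sqrtr_sqr ler_sqrt ?addr_ge0 ?sqr_ge0// lerDr sqr_ge0.
Qed.

Lemma le_normcD z w : normc (z + w) <= normc z + normc w.
Proof. exact: le_normcD. Qed.

Lemma normc_eq0 z : (normc z == 0) = (z == 0).
Proof.
apply/eqP/eqP => [/ComplexField.Normc.eq0_normc//|->].
exact: ComplexField.Normc.normc0.
Qed.

Lemma ReMr x z : Re (x%:C%C * z) = x * Re z.
Proof. by case: z => a b /=; rewrite mul0r subr0. Qed.

Lemma ImMr x z : Im (x%:C%C * z) = x * Im z.
Proof. by case: z => a b /=; rewrite mul0r addr0. Qed.

End complex_facts.

Section complex_derivative.
Context {R : realType}.
Implicit Types (f g : R -> R[i]) (d : R[i]) (x : R).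

Definition cderive f x d :=
  is_derive x 1 (fun y => Re (f y)) (Re d) /\
  is_derive x 1 (fun y => Im (f y)) (Im d).

Lemma cderive_eq f x d d' : cderive f x d -> d = d' -> cderive f x d'.
Proof. by move=> h <-. Qed.

Lemma cderive_cst d x : cderive (fun=> d) x 0.
Proof. by split; exact: is_derive_cst. Qed.

Lemma cderive_real (h : R -> R) x (dh : R) : is_derive x 1 h dh ->
  cderive (fun y => (h y)%:C%C) x dh%:C%C.
Proof. by move=> hh; split => //=; exact: is_derive_cst. Qed.

Lemma cderive_add f g x df dg : cderive f x df -> cderive g x dg ->
  cderive (fun y => f y + g y) x (df + dg).
Proof.
move=> [f1 f2] [g1 g2]; split.
  rewrite (_ : (fun y => _) = (fun y => Re (f y) + Re (g y))); last first.
    by apply/funext => y; case: (f y) (g y) => ? ? [].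
  by apply: (derive_eq (derive_add f1 g1)); case: df dg {f1 f2 g1 g2} => ? ? [].
rewrite (_ : (fun y => _) = (fun y => Im (f y) + Im (g y))); last first.
  by apply/funext => y; case: (f y) (g y) => ? ? [].
by apply: (derive_eq (derive_add f2 g2)); case: df dg {f1 f2 g1 g2} => ? ? [].
Qed.

Lemma cderive_mul f g x df dg : cderive f x df -> cderive g x dg ->
  cderive (fun y => f y * g y) x (df * g x + f x * dg).
Proof.
move=> [f1 f2] [g1 g2]; split.
  rewrite (_ : (fun y => _) =
    (fun y => Re (f y) * Re (g y) + -1 * (Im (f y) * Im (g y)))); last first.
    by apply/funext => y; case: (f y) (g y) => ? ? [? ?] /=; rewrite mulN1r.
  apply: (derive_eq (derive_add (derive_mul f1 g1) (derive_scale (-1) (derive_mul f2 g2)))).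
  by case: df dg (f x) (g x) {f1 f2 g1 g2} => ? ? [? ?] [? ?] [? ?] /=; ring.
rewrite (_ : (fun y => _) =
  (fun y => Re (f y) * Im (g y) + Im (f y) * Re (g y))); last first.
  by apply/funext => y; case: (f y) (g y) => ? ? [? ?].
apply: (derive_eq (derive_add (derive_mul f1 g2) (derive_mul f2 g1))).
by case: df dg (f x) (g x) {f1 f2 g1 g2} => ? ? [? ?] [? ?] [? ?] /=; ring.
Qed.

Lemma derive_inv (h : R -> R) x (dh : R) : h x != 0 -> is_derive x 1 h dh ->
  is_derive x 1 (fun y => (h y)^-1) (- dh * (h x)^-1 ^+ 2).
Proof.
move=> h0 hh; apply: (derive_eq (is_deriveV h0 hh)).
by rewrite exprVn mulNr scaleNr; congr (- _); exact: mulrC.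
Qed.

Lemma cderive_inv f x df : cderive f x df -> f x != 0 ->
  cderive (fun y => (f y)^-1) x (- df * (f x)^-1 ^+ 2).
Proof.
move=> [f1 f2] fx0.
have n0 : Re (f x) ^+ 2 + Im (f x) ^+ 2 != 0.
  by rewrite -normcE2 sqrf_eq0 normc_eq0.
have hn := @derive_inv (fun y => Re (f y) ^+ 2 + Im (f y) ^+ 2) x _ n0 (derive_add (derive_exp 2 f1) (derive_exp 2 f2)).
split.
  rewrite (_ : (fun y => _) =
    (fun y => Re (f y) * (Re (f y) ^+ 2 + Im (f y) ^+ 2)^-1)); last first.
    by apply/funext => y; case: (f y).
  apply: (derive_eq (derive_mul f1 hn)).
  move: n0; case: (f x) {f1 f2 hn fx0} => a b; case: df => c d /= => n0.
  by field.
rewrite (_ : (fun y => _) =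
  (fun y => -1 * (Im (f y) * (Re (f y) ^+ 2 + Im (f y) ^+ 2)^-1))); last first.
  by apply/funext => y; case: (f y) => ? ? /=; rewrite mulN1r.
apply: (derive_eq (derive_scale (-1) (derive_mul f2 hn))).
move: n0; case: (f x) {f1 f2 hn fx0} => a b; case: df => c d /= => n0.
by field.
Qed.

Lemma cderive_exp f x df k : cderive f x df ->
  cderive (fun y => f y ^+ k) x (k%:R * f x ^+ k.-1 * df).
Proof.
move=> hf; elim: k => [|k ih].
  by rewrite !mul0r; exact: cderive_cst.
rewrite (_ : (fun y => _) = (fun y => f y * f y ^+ k)); last first.
  by apply/funext => y; rewrite exprS.
apply: (cderive_eq (cderive_mul hf ih)).
by case: k {ih} => [|k] /=; rewrite ?expr0 -?natr1 ?(exprS (f x) k); ring.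
Qed.

Lemma cderive_cis (b x : R) :
  cderive (fun y => cis (b * y)) x ((0 +i* b)%C * cis (b * x)).
Proof.
have hb : is_derive x 1 (fun y => b * y) (b * 1) by exact: (derive_scale b (is_derive_id x 1)).
split.
  have h := is_derive1_comp (is_derive_cos (b * x)) hb.
  by apply: (derive_eq h); rewrite /cis /=; ring.
have h := is_derive1_comp (is_derive_sin (b * x)) hb.
by apply: (derive_eq h); rewrite /cis /=; ring.
Qed.

Lemma cderive_opp f x d : cderive f x d -> cderive (fun y => - f y) x (- d).
Proof.
move=> hf; rewrite (_ : (fun y => _) = (fun y => -1 * f y)); last first.
  by apply/funext => y; rewrite mulN1r.
by apply: (cderive_eq (cderive_mul (cderive_cst (-1) x) hf)); rewrite mul0r add0r mulN1r.
Qed.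

Lemma cderive_continuous_Re f x d : cderive f x d ->
  {for x, continuous (fun y => Re (f y))}.
Proof.
by case=> -[h _] _; apply: differentiable_continuous; apply/derivable1_diffP.
Qed.

End complex_derivative.

Lemma derive0_cst (R : realType) (F : R -> R) (u t : R) :
  (forall s : R, `|s| < u -> is_derive s 1 F 0) -> `|t| < u -> F t = F 0.
Proof.
move=> dF tu.
have key (r s : R) : r <= s -> `|r| < u -> `|s| < u -> F s = F r.
  move=> rs ru su.
  have du z : z \in `[r, s] -> `|z| < u.
    rewrite in_itv/= => /andP[rz zs]; move: ru su; rewrite !ltr_norml.
    move=> /andP[h1 _] /andP[_ h2].
    by rewrite (lt_le_trans h1 rz) (le_lt_trans zs h2).
  have [||z _] := @MVT_segment R F (fun=> 0) r s rs.
  - by move=> z /subset_itv_oo_cc zrs; apply: dF; exact: du.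
  - by apply: derivable_within_continuous => z /du/dF[].
  by rewrite mul0r => /eqP; rewrite subr_eq0 => /eqP.
have u0 : `|0 : R| < u by rewrite normr0 (le_lt_trans _ tu).
by have [t0|/ltW t0] := leP 0 t; [exact: key|rewrite (key t 0)].
Qed.

Section contour_rotation.
Context {R : realType}.
Local Notation mu := (@lebesgue_measure R).
Local Notation pos := (`]0, +oo[%classic : set (measurableTypeR R)).
Variables (a : R) (m : nat).
Hypotheses (a0 : 0 < a) (am : a < m%:R).

(** The square of the norm is [(1 + x)^2 - 2 x (1 - cos t)], and
  [4 x <= (1 + x)^2]. *)
Lemma cis_lower_bound (t x : R) : 0 < x ->
  (1 + x) * Num.sqrt ((1 + cos t) / 2) <= normc (1 + x%:C%C * cis t).
Proof.
move=> x0; have x1 : 0 <= 1 + x by rewrite addr_ge0// ltW.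
have c1 : 0 <= 1 + cos t by rewrite -lerBlDl sub0r cos_geN1.
rewrite -[X in X * _](ger0_norm x1) -sqrtr_sqr -sqrtrM ?sqr_ge0//=.
rewrite ler_sqrt ?addr_ge0 ?sqr_ge0// -subr_ge0.
have -> : (1 + (x * cos t - 0 * sin t)) ^+ 2 + (0 + (x * sin t + 0 * cos t)) ^+ 2 -
    (1 + x) ^+ 2 * ((1 + cos t) / 2) = (1 - cos t) / 2 * (1 - x) ^+ 2.
  by rewrite !mul0r subr0 addr0 add0r exprMn sin2cos2; field.
by rewrite mulr_ge0 ?sqr_ge0// divr_ge0// subr_ge0 cos_le1.
Qed.

(** The pullback of the form [z ^ (a - 1) / (1 + z) ^ m dz] to the ray of angle
  [t]; the factor [cis t] of [dz] is absorbed in [cis (a * t)]. *)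
Definition rotated (t x : R) : R[i] :=
  cis (a * t) * (x `^ (a - 1))%:C%C * (1 + x%:C%C * cis t)^-1 ^+ m.

(** The derivative of [rotated] in the angle, which is also [i] times the
  derivative of [x * rotated t x] in [x]. *)
Definition rotated_dtheta (t x : R) : R[i] :=
  (0 +i* 1)%C * (cis (a * t) * (a%:C%C * (x `^ (a - 1))%:C%C * (1 + x%:C%C * cis t)^-1 ^+ m
   - m%:R * (x `^ a)%:C%C * (1 + x%:C%C * cis t)^-1 ^+ m.+1 * cis t)).

Lemma rotated_den_neq0 (t x : R) : 0 < x -> 0 < 1 + cos t -> 1 + x%:C%C * cis t != 0.
Proof.
move=> x0 c0; rewrite -normc_eq0 gt_eqF// (lt_le_trans _ (cis_lower_bound t x0))//.
by rewrite mulr_gt0 ?addr_gt0// sqrtr_gt0 divr_gt0.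
Qed.

Lemma cderive_cis1 (x : R) : cderive (@cis R) x ((0 +i* 1)%C * cis x).
Proof.
have h := cderive_cis 1 x; rewrite mul1r in h.
have e : @cis R = (fun y => cis (1 * y)) by apply: funext => y; rewrite mul1r.
by rewrite [X in cderive X _ _]e; exact: h.
Qed.

Lemma cderive_rotated_theta c (t x : R) : 0 < x -> 0 < 1 + cos t ->
  cderive (fun t => c * rotated t x) t (c * rotated_dtheta t x).
Proof.
move=> x0 c0; have d0 := rotated_den_neq0 x0 c0.
have h1 := cderive_mul (cderive_cis a t) (cderive_cst (x `^ (a - 1))%:C%C t).
have h2 := cderive_add (cderive_cst 1 t) (cderive_mul (cderive_cst x%:C%C t) (cderive_cis1 t)).
have h3 := cderive_exp m (cderive_inv h2 d0).
apply: (cderive_eq (cderive_mul (cderive_cst c t) (cderive_mul h1 h3))).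
rewrite mul0r add0r; congr (_ * _); rewrite /rotated_dtheta.
have -> : x `^ a = x * x `^ (a - 1) by exact: powR_pred.
have -> : (0 +i* a)%C = a%:C%C * (0 +i* 1)%C :> R[i] by simpc.
rewrite (rmorphM (real_complex R)).
have [->|m0] := eqVneq m 0%N; first by rewrite !mul0r !expr0; ring.
have [k mk] : exists k, m = k.+1 by exists m.-1; rewrite prednK// lt0n.
rewrite mk [k.+1.-1]/= !exprS.
move: (cis (a * t)) (cis t) (1 + _)^-1 => A B D; move: (0 +i* 1)%C => I.
rewrite expr0; ring.
Qed.

Lemma cderive_rotated_x c (t x : R) : 0 < x -> 0 < 1 + cos t ->
  cderive (fun x => c * (0 +i* 1)%C * (cis (a * t) * (x `^ a)%:C%C * (1 + x%:C%C * cis t)^-1 ^+ m)) x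
   (c * rotated_dtheta t x).
Proof.
move=> x0 c0; have d0 := rotated_den_neq0 x0 c0.
have h1 := cderive_mul (cderive_cst (cis (a * t)) x) (cderive_real (is_derive1_powR a x0)).
have h2 := cderive_add (cderive_cst 1 x) (cderive_mul (cderive_real (is_derive_id x 1)) (cderive_cst (cis t) x)).
have h3 := cderive_exp m (cderive_inv h2 d0).
apply: (cderive_eq (cderive_mul (cderive_cst (c * (0 +i* 1)%C) x) (cderive_mul h1 h3))).
rewrite mul0r add0r -mulrA; congr (_ * _); rewrite /rotated_dtheta; congr (_ * _).
have -> : x `^ a = x * x `^ (a - 1) by exact: powR_pred.
rewrite !(rmorphM (real_complex R)) (rmorph1 (real_complex R)).
have [->|m0] := eqVneq m 0%N; first by rewrite !mul0r !expr0; ring.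
have [k mk] : exists k, m = k.+1 by exists m.-1; rewrite prednK// lt0n.
rewrite mk [k.+1.-1]/= !exprS.
move: (cis (a * t)) (cis t) (1 + _)^-1 => A B D.
rewrite expr0; ring.
Qed.

Lemma measurable_rotated_den (t : R) : measurable_fun [set: R] (fun x : R => 1 + x%:C%C * cis t).
Proof.
apply: measurable_funDC; first exact: measurable_cst.
by apply: measurable_funMC; [exact: measurable_fun_realC|exact: measurable_cst].
Qed.

Lemma measurable_rotated (t : R) : measurable_fun [set: R] (rotated t).
Proof.
apply: measurable_funMC.
  apply: measurable_funMC; first exact: measurable_cst.
  by apply: measurable_fun_realC; exact: measurable_powR.
by apply: measurable_funXC; apply: measurable_funVC; exact: measurable_rotated_den.
Qed.

Lemma measurable_rotated_dtheta (t : R) : measurable_fun [set: R] (rotated_dtheta t).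
Proof.
have mD k := measurable_funXC k (measurable_funVC (measurable_rotated_den t)).
apply: measurable_funMC; first exact: measurable_cst.
apply: measurable_funMC; first exact: measurable_cst.
apply: measurable_funDC.
  apply: measurable_funMC => //; apply: measurable_funMC; first exact: measurable_cst.
  by apply: measurable_fun_realC; exact: measurable_powR.
apply: measurable_funNC; apply: measurable_funMC; last exact: measurable_cst.
apply: measurable_funMC => //; apply: measurable_funMC; first exact: measurable_cst.
by apply: measurable_fun_realC; exact: measurable_powR.
Qed.

Section bounds.
Variable u : R.
Hypotheses (u0 : 0 < u) (upi : u < pi).

Let k := Num.sqrt ((1 + cos u) / 2).

Let k0 : 0 < k.
Proof.
rewrite sqrtr_gt0 divr_gt0// -ltrBlDl sub0r -cospi ltr_cos// in_itv/= ?pi_ge0 ?lexx//.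
by rewrite (ltW u0) (ltW upi).
Qed.

Let cos_ge (t : R) : `|t| < u -> cos u <= cos t.
Proof.
move=> tu; have -> : cos t = cos `|t| by case: (ger0P t) => _; rewrite ?cosN.
apply: ltW; rewrite ltr_cos// in_itv/=.
  by rewrite normr_ge0 (ltW (lt_trans tu upi)).
by rewrite (ltW u0) (ltW upi).
Qed.

Let cos_gt (t : R) : `|t| < u -> 0 < 1 + cos t.
Proof.
move=> tu; rewrite (@lt_le_trans _ _ (1 + cos u))//.
  by move: k0; rewrite sqrtr_gt0 pmulr_lgt0// invr_gt0.
by rewrite lerD2l; exact: cos_ge.
Qed.

Let den_le (t x : R) : `|t| < u -> 0 < x ->
  normc (1 + x%:C%C * cis t)^-1 <= k^-1 * (1 + x)^-1.
Proof.
move=> tu x0; have x1 : 0 < 1 + x by rewrite addr_gt0.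
rewrite normcV -invfM lef_pV2 ?posrE ?mulr_gt0//; last first.
  rewrite (lt_le_trans _ (cis_lower_bound t x0))// mulr_gt0// sqrtr_gt0 divr_gt0//.
  exact: cos_gt.
rewrite mulrC (le_trans _ (cis_lower_bound t x0))// ler_wpM2l ?(ltW x1)//.
rewrite ler_sqrt ?divr_ge0// ?(ltW (cos_gt tu))// ler_pM2r// lerD2l.
exact: cos_ge.
Qed.

Lemma normc_rotated_le (t x : R) : `|t| < u -> 0 < x ->
  normc (rotated t x) <= k^-1 ^+ m * (x `^ (a - 1) * (1 + x) `^ (- m%:R)).
Proof.
move=> tu x0; have x1 : 0 < 1 + x by rewrite addr_gt0.
rewrite /rotated 2!normcM normc_cis mul1r normc_real ger0_norm ?powR_ge0//.
rewrite powRN powR_mulrn ?(ltW x1)// -exprVn mulrCA ler_wpM2l ?powR_ge0//.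
by rewrite -exprMn normcX lerXn2r ?nnegrE ?normc_ge0 ?mulr_ge0 ?invr_ge0 ?(ltW k0) ?(ltW x1)// den_le.
Qed.

Lemma normc_rotated_dtheta_le (t x : R) : `|t| < u -> 0 < x ->
  normc (rotated_dtheta t x) <=
  (a + m%:R * k^-1) * k^-1 ^+ m * (x `^ (a - 1) * (1 + x) `^ (- m%:R)).
Proof.
move=> tu x0; have x1 : 0 < 1 + x by rewrite addr_gt0.
have E0 := den_le tu x0; have k1 : 0 <= k^-1 by rewrite invr_ge0 ltW.
have n1 : normc ((0 +i* 1)%C : R[i]) = 1 by rewrite /= expr0n expr1n add0r sqrtr1.
rewrite /rotated_dtheta 2!normcM normc_cis n1 !mul1r.
rewrite (le_trans (le_normcD _ _))// normcN !normcM normc_cis mulr1 !normcX !normc_real.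
rewrite (ger0_norm (ltW a0)) !(ger0_norm (powR_ge0 _ _)).
have -> : normc (m%:R : R[i]) = m%:R.
  by rewrite -(rmorph_nat (real_complex R)) normc_real ger0_norm.
have -> : x `^ a = x * x `^ (a - 1) by exact: powR_pred.
have hm : normc (1 + x%:C%C * cis t)^-1 ^+ m <= k^-1 ^+ m * (1 + x) `^ (- m%:R).
  rewrite powRN powR_mulrn ?(ltW x1)// -exprVn -exprMn.
  by rewrite lerXn2r ?nnegrE ?normc_ge0 ?mulr_ge0 ?invr_ge0 ?(ltW k0) ?(ltW x1).
have xE : x * normc (1 + x%:C%C * cis t)^-1 <= k^-1.
  rewrite (@le_trans _ _ (x * (k^-1 * (1 + x)^-1)))//; first by rewrite ler_wpM2l ?(ltW x0).
  by rewrite mulrCA ler_piMr// ler_pdivrMr// mul1r lerDr.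
have -> : (a + m%:R * k^-1) * k^-1 ^+ m * (x `^ (a - 1) * (1 + x) `^ (- m%:R)) =
  a * x `^ (a - 1) * (k^-1 ^+ m * (1 + x) `^ (- m%:R)) +
  m%:R * x `^ (a - 1) * (k^-1 * (k^-1 ^+ m * (1 + x) `^ (- m%:R))) by ring.
apply: lerD; first by rewrite ler_wpM2l ?mulr_ge0 ?(ltW a0) ?powR_ge0.
move: (normc _) hm xE (normc_ge0 (1 + x%:C%C * cis t)^-1) => z hm xE z0.
rewrite (_ : _ * z ^+ m.+1 = m%:R * x `^ (a - 1) * ((x * z) * z ^+ m)); last first.
  by rewrite exprS; ring.
rewrite ler_wpM2l ?mulr_ge0 ?powR_ge0// ler_pM ?mulr_ge0 ?exprn_ge0 ?(ltW x0)//.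
Qed.

Let integrable_le (h : R -> R[i]) (C : R) (c : R[i]) : measurable_fun [set: R] h ->
  (forall x, 0 < x -> normc (h x) <= C * (x `^ (a - 1) * (1 + x) `^ (- m%:R))) ->
  mu.-integrable pos (EFin \o (fun x => Re (c * h x))).
Proof.
move=> mh hC; have ib := integrable_beta a0 am.
apply: (integrable_pos_le (g := fun x => normc c * C * (x `^ (a - 1) * (1 + x) `^ (- m%:R)))).
- apply: measurable_funTS; apply: measurable_ReC; apply: measurable_funMC => //.
- exact: (integrableZl measurable_pos _ ib).
- move=> x x0; rewrite (le_trans (normc_ge_Re _))// normcM -mulrA ler_wpM2l ?normc_ge0//.
  exact: hC.
Qed.

Lemma integrable_Re_rotated c (t : R) : `|t| < u ->
  mu.-integrable pos (EFin \o (fun x => Re (c * rotated t x))).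
Proof.
move=> tu; apply: integrable_le; first exact: measurable_rotated.
by move=> x x0; exact: normc_rotated_le.
Qed.

Let integral_dtheta c (t : R) : `|t| < u ->
  \int[mu]_(x in pos) Re (c * rotated_dtheta t x) = 0.
Proof.
move=> tu; rewrite /Rintegral.
have c0 := cos_gt tu.
rewrite (integral_FTC_pos _ _ (fun x x0 => (cderive_rotated_x c x0 c0).1) (l := 0))//.
- apply: integrable_le; first exact: measurable_rotated_dtheta.
  by move=> x x0; exact: normc_rotated_dtheta_le.
- move=> x x0; have d0 := rotated_den_neq0 x0 c0.
  have h2 := cderive_add (cderive_cst 1 x) (cderive_mul (cderive_real (is_derive_id x 1)) (cderive_cst (cis t) x)).
  have h3 j := cderive_exp j (cderive_inv h2 d0).
  have hp b := cderive_real (is_derive1_powR b x0).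
  have h4 := cderive_mul (cderive_mul (cderive_cst a%:C%C x) (hp (a - 1))) (h3 m).
  have h5 := cderive_mul (cderive_mul (cderive_mul (cderive_cst m%:R x) (hp a)) (h3 m.+1)) (cderive_cst (cis t) x).
  have h6 := cderive_mul (cderive_cst (cis (a * t)) x) (cderive_add h4 (cderive_opp h5)).
  have h7 := cderive_mul (cderive_cst c x) (cderive_mul (cderive_cst (0 +i* 1)%C x) h6).
  exact: (cderive_continuous_Re h7).
pose C := normc c * k^-1 ^+ m.
have C0 : 0 <= C by rewrite mulr_ge0 ?normc_ge0// exprn_ge0// invr_ge0 ltW.
have n1 : normc ((0 +i* 1)%C : R[i]) = 1 by rewrite /= expr0n expr1n add0r sqrtr1.
pose V (x : R) := Re (c * (0 +i* 1)%C * (cis (a * t) * (x `^ a)%:C%C * (1 + x%:C%C * cis t)^-1 ^+ m)).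
have bV (x : R) : 0 < x -> `|V x| <= C * (x `^ a * (1 + x)^-1 ^+ m).
  move=> x0; have x1 : 0 < 1 + x by rewrite addr_gt0.
  rewrite (le_trans (normc_ge_Re _))// !normcM n1 normc_cis mul1r mulr1 normc_real.
  rewrite ger0_norm ?powR_ge0// /C -mulrA ler_wpM2l ?normc_ge0// mulrCA ler_wpM2l ?powR_ge0//.
  by rewrite -exprMn normcX lerXn2r ?nnegrE ?normc_ge0 ?mulr_ge0 ?invr_ge0 ?(ltW k0) ?(ltW x1)// den_le.
rewrite [X in _ --> X](_ : _ = 0 - 0); last by rewrite subr0.
apply: cvgB.
  apply/norm_cvg0P.
  apply: (@squeeze_cvgr _ _ _ _ (cst 0) (fun j : nat => C * (j.+2%:R^-1 : R) `^ (m%:R - a))).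
  - near=> j; rewrite normr_ge0/= (le_trans (bV _ _))// ler_wpM2l//.
    have j0 : 0 < j.+2%:R :> R by [].
    rewrite -powRNV ?(ltW j0)// opprB (@powRD _ _ a (- m%:R)) ?(gt_eqF j0) ?implybT//.
    rewrite ler_wpM2l ?powR_ge0// powRN powR_mulrn ?(ltW j0)// -exprVn.
    by rewrite lerXn2r ?nnegrE ?invr_ge0 ?nat1r// lef_pV2 ?posrE// ler_nat.
  - exact: cvg_cst.
  - rewrite [X in _ --> X](_ : _ = C * 0); last by rewrite mulr0.
    by apply: cvgM; [exact: cvg_cst|apply: cvg_inv_powR; rewrite subr_gt0].
apply/norm_cvg0P.
apply: (@squeeze_cvgr _ _ _ _ (cst 0) (fun j : nat => C * (j.+2%:R^-1 : R) `^ a)).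
- near=> j; have j0 : 0 < j.+2%:R^-1 :> R by rewrite invr_gt0.
  rewrite normr_ge0/= (le_trans (bV _ j0))// ler_wpM2l// ler_piMr ?powR_ge0//.
  by rewrite exprn_ile1 ?invr_ge0 ?addr_ge0 ?(ltW j0)// invf_le1 ?addr_gt0// lerDl ltW.
- exact: cvg_cst.
- rewrite [X in _ --> X](_ : _ = C * 0); last by rewrite mulr0.
  by apply: cvgM; [exact: cvg_cst|exact: cvg_inv_powR].
Unshelve. all: by end_near. Qed.

Lemma integral_rotated_cst c (t : R) : `|t| < u ->
  \int[mu]_(x in pos) Re (c * rotated t x) = \int[mu]_(x in pos) Re (c * rotated 0 x).
Proof.
move=> tu; apply: (@derive0_cst _ (fun t => \int[mu]_(x in pos) Re (c * rotated t x)) u) => // s su.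
pose C := normc c * ((a + m%:R * k^-1) * k^-1 ^+ m).
pose G x : R := C * (x `^ (a - 1) * (1 + x) `^ (- m%:R)).
have Iu (r : R) : (`]- u, u[%classic : set R) r -> `|r| < u by rewrite /= in_itv/= ltr_norml.
have Is : (`]- u, u[%classic : set R) s by rewrite /= in_itv/= -ltr_norml.
pose f (r x : R) := Re (c * rotated r x).
have intf (r : R) : (`]- u, u[%classic : set R) r -> mu.-integrable pos (EFin \o f r).
  by move=> /Iu; exact: integrable_Re_rotated.
have df (r x : R) : (`]- u, u[%classic : set R) r -> pos x ->
    is_derive r 1 (f ^~ x) (Re (c * rotated_dtheta r x)).
  by move=> /Iu/cos_gt r0 /posP x0; exact: (cderive_rotated_theta c x0 r0).1.
have derf (r x : R) : (`]- u, u[%classic : set R) r -> pos x -> derivable (f ^~ x) r 1.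
  by move=> h1 h2; have [] := df _ _ h1 h2.
have C0 : 0 <= C.
  rewrite !mulr_ge0 ?normc_ge0 ?exprn_ge0 ?addr_ge0 ?mulr_ge0 ?invr_ge0 ?(ltW a0)//; exact: ltW.
have G0 x : 0 <= G x by rewrite /G (mulr_ge0 C0)// mulr_ge0 ?powR_ge0.
have iG : mu.-integrable pos (EFin \o G).
  exact: (integrableZl measurable_pos _ (integrable_beta a0 am)).
have Gub (r x : R) : (`]- u, u[%classic : set R) r -> pos x -> `|partial1of2 f r x| <= G x.
  move=> h1 h2; rewrite partial1of2E; have [_ ->] := df _ _ h1 h2.
  rewrite (le_trans (normc_ge_Re _))// normcM /G /C -mulrA ler_wpM2l ?normc_ge0//.
  by apply: normc_rotated_dtheta_le; [exact: Iu|exact/posP].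
have h1 := @derivable_under_integral R _ _ mu f pos measurable_pos s (- u) u Is intf derf G G0 iG Gub.
have h2 := @differentiation_under_integral R _ _ mu f pos measurable_pos s (- u) u Is intf derf G G0 iG Gub.
apply: DeriveDef; first exact: h1.
rewrite -derive1E; apply: (etrans h2); apply: (etrans _ (integral_dtheta c su)).
rewrite /Rintegral; congr fine; apply: eq_integral => x /set_mem xp; congr EFin.
by rewrite partial1of2E; have [_ ->] := df _ _ Is xp.
Qed.

End bounds.

Lemma integrable_rotated c (t : R) : `|t| < pi ->
  mu.-integrable pos (EFin \o (fun x => Re (c * rotated t x))).
Proof.
move=> tpi; have [h1 h2] := midf_lt tpi.
by apply: (integrable_Re_rotated _ h2 _ h1); exact: le_lt_trans h1.
Qed.

(** Turning the ray of integration of the Beta integral by an angle less than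
  pi does not change it: the derivative of the rotated integrand in the angle
  is 'i times a derivative along the ray. *)
Lemma integral_rotated c (t : R) : `|t| < pi ->
  \int[mu]_(x in pos) Re (c * rotated t x) =
  Re c * \int[mu]_(x in pos) (x `^ (a - 1) * (1 + x)^-1 ^+ m).
Proof.
move=> tpi; have [h1 h2] := midf_lt tpi.
rewrite (integral_rotated_cst (le_lt_trans (normr_ge0 t) h1) h2 c h1).
have r0 x : rotated 0 x = (x `^ (a - 1) * (1 + x)^-1 ^+ m)%:C%C.
  rewrite /rotated mulr0 !cis0 mulr1 mul1r (rmorphM (real_complex R)) (rmorphXn (real_complex R)).
  by rewrite (fmorphV (real_complex R)) (rmorphD (real_complex R)).
rewrite -RintegralZl//; last first.
  have := @integrable_rotated 1 0; rewrite normr0 => /(_ (pi_gt0 R)).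
  apply: eq_integrable; first exact: measurable_pos.
  by move=> x _ /=; rewrite r0 mul1r.
rewrite /Rintegral; congr fine; apply: eq_integral => x _; congr EFin.
by rewrite r0 mulrC ReMr mulrC.
Qed.

End contour_rotation.

Section reflection.
Context {R : realType}.
Local Notation mu := (@lebesgue_measure R).
Local Notation pos := (`]0, +oo[%classic : set (measurableTypeR R)).

(** The powers [y ^ a] with [a <= 1] are subadditive. *)
Lemma powR_le_1D (a y : R) : 0 < a -> a <= 1 -> 0 < y -> (1 + y) `^ a <= 1 + y `^ a.
Proof.
move=> a0 a1 y0; have y1 : 0 < 1 + y by rewrite addr_gt0.
rewrite (powR_pred a y1) (powR_pred a y0) mulrDl mul1r -(opprB 1 a) !powRN.
have b0 : 0 <= 1 - a by rewrite subr_ge0.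
apply: lerD.
  rewrite invf_le1 ?powR_gt0// -[leLHS](powRr0 (1 + y)) ler_powR// lerDl ltW//.
by rewrite ler_wpM2l ?(ltW y0)// lef_pV2 ?posrE ?powR_gt0// ge0_ler_powR ?nnegrE ?(ltW y0) ?(ltW y1)// lerDr.
Qed.

Lemma integral_powR_cauchy_fin (a : R) : 0 < a -> a < 1 ->
  exists M : R, (\int[mu]_(y in pos) (y `^ a * (1 + y ^+ 2)^-1)%:E)%E = M%:E.
Proof.
move=> a0 a1; have h : a + 1 < 2 by rewrite -ltrBrDr (_ : 2 - 1 = 1 :> R)//; ring.
have ib := integrable_beta (addr_gt0 a0 ltr01) h.
have ig : mu.-integrable pos (EFin \o (fun y => y `^ a * (1 + y ^+ 2)^-1)).
  apply: (integrable_pos_le (g := fun y => 2 * (y `^ (a + 1 - 1) * (1 + y) `^ (- 2)))).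
  - apply: measurable_funM; first exact: measurable_powR_in.
    by apply: measurable_funTS; apply: measurable_funVr; apply: measurable_funD => //; exact: measurable_funX.
  - exact: (integrableZl measurable_pos 2 ib).
  - move=> y y0; have y1 : 0 < 1 + y by rewrite addr_gt0.
    have y2 : 0 < 1 + y ^+ 2 by rewrite ltr_pwDl ?sqr_ge0.
    rewrite addrK ger0_norm ?mulr_ge0 ?powR_ge0 ?invr_ge0 ?(ltW y2)//.
    rewrite mulrCA ler_wpM2l ?powR_ge0// powRN (powR_mulrn 2 (ltW y1)).
    rewrite ler_pdivlMr ?exprn_gt0// mulrC ler_pdivrMr// -subr_ge0.
    by rewrite (_ : _ - _ = (1 - y) ^+ 2) ?sqr_ge0//; ring.
have := integrable_fin_num measurable_pos ig.
by move=> /fineK <-; eexists.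
Qed.

(** The imaginary part of [integral_rotated] for the angle [pi - d], with the phase
  [cis (a * (pi - d))] moved to the side of the Beta integral. *)
Lemma sin_beta_le (a M d : R) : 0 < a -> a < 1 -> 0 < d < pi ->
  (\int[mu]_(y in pos) (y `^ a * (1 + y ^+ 2)^-1)%:E)%E = M%:E ->
  sin (a * (pi - d)) * \int[mu]_(x in pos) (x `^ (a - 1) * (1 + x)^-1 ^+ 1) <=
  pi + (sin d) `^ a * M.
Proof.
move=> a0 a1 /andP[d0 dpi] hM.
have t1 : `|pi - d| < pi by rewrite ger0_norm ?subr_ge0 ?ltW// ltrBlDr ltrDl.
have s0 : 0 < sin d by apply: sin_gt0_pi; rewrite d0 dpi.
set t := pi - d in t1 *.
pose c : R[i] := (0 +i* 1)%C * cis (- (a * t)).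
have a1' : a < 1%:R by [].
have ir := integrable_rotated a0 a1' c t1.
have rot := integral_rotated a0 a1' c t1.
have Rec : Re c = sin (a * t) by rewrite /c /= mul0r sub0r sinN mul1r opprK.
have E (x : R) : 0 < x -> Re (c * rotated a 1 t x) =
    x `^ a * (sin d * (Num.sqrt (sin d ^+ 2 + (1 * (x - cos d)) ^+ 2))^-1 ^+ 2).
  move=> x0; rewrite mul1r (@sqrtV_double _ _ 1) ?addr_ge0 ?sqr_ge0// !expr1.
  rewrite /rotated expr1 !mulrA /c -(mulrA _ (cis _) (cis _)) -cisD addNr cis0 mulr1.
  rewrite (_ : _ * _ / _ = (x `^ (a - 1))%:C%C * ((0 +i* 1)%C / (1 + x%:C%C * cis t))); last by ring.
  rewrite ReMr (powR_pred a x0).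
  have -> : 1 + x%:C%C * cis t = ((1 - x * cos d) +i* (x * sin d))%C.
    rewrite /cis /t addrC [pi - d]addrC cosDpi sinDpi cosN sinN opprK; simpc.
    by rewrite addrC.
  rewrite /= !mul0r sub0r mul1r opprK.
  have -> : (1 - x * cos d) ^+ 2 + (x * sin d) ^+ 2 = sin d ^+ 2 + (x - cos d) ^+ 2.
    by rewrite exprMn sin2cos2; ring.
  by ring.
(* [k] is a Poisson kernel of mass [pi] centred at [cos d], and [x ^ a] is at most
   [1 + (x - cos d) ^ a] to the right of the centre and at most 1 to its left. *)
pose k (x : R) := sin d * (Num.sqrt (sin d ^+ 2 + (1 * (x - cos d)) ^+ 2))^-1 ^+ 2.
pose f (x : R) := pos_indic (x - cos d) * (x - cos d) `^ a * k x.
have mk : measurable_fun [set: R] k.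
  apply: measurable_funM => //; apply: measurable_funX; apply: measurable_funVr.
  apply: measurable_fun_sqrt; first by move=> x; rewrite addr_ge0 ?sqr_ge0.
  apply: measurable_funD => //; apply: measurable_funX; apply: measurable_funM => //.
  exact: measurable_funB.
have mf : measurable_fun [set: R] f.
  have ms : measurable_fun [set: R] (fun x : R => x - cos d) by exact: measurable_funB.
  apply: measurable_funM => //; apply: measurable_funM.
    exact: (measurableT_comp measurable_pos_indic).
  exact: (measurableT_comp (measurable_powR a)).
have k0 x : 0 <= k x by rewrite mulr_ge0 ?(ltW s0)// exprn_ge0// invr_ge0 sqrtr_ge0.
have f0 x : 0 <= f x by rewrite mulr_ge0// mulr_ge0 ?powR_ge0.
have Ik : (\int[mu]_x (k x)%:E = pi%:E)%E.
  pose k1 (x : R) := (Num.sqrt (sin d ^+ 2 + (1 * (x - cos d)) ^+ 2))^-1 ^+ 2.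
  have mk1 : measurable_fun [set: R] k1.
    apply: measurable_funX; apply: measurable_funVr.
    apply: measurable_fun_sqrt; first by move=> x; rewrite addr_ge0 ?sqr_ge0.
    apply: measurable_funD => //; apply: measurable_funX; apply: measurable_funM => //.
    exact: measurable_funB.
  have k10 x : 0 <= k1 x by rewrite exprn_ge0// invr_ge0 sqrtr_ge0.
  rewrite (ge0_integral_EFinZl mu (ltW s0) mk1 k10) /k1.
  rewrite (integral_inv_sqrt 0)// -EFinM /=; congr EFin.
  by rewrite divr1 expr1 mulrCA divff ?mulr1// gt_eqF.
have mfE : measurable_fun [set: R] (fun x => (f x)%:E) by apply/measurable_EFinP; exact: mf.
have If : (\int[mu]_x (f x)%:E = (sin d `^ a * M)%:E)%E.
  rewrite (integral_affine (cos d) s0); [|exact: mfE|by move=> x; rewrite lee_fin].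
  pose g (y : R) := pos_indic y * (y `^ a * (1 + y ^+ 2)^-1).
  have mg : measurable_fun [set: R] g.
    apply: measurable_funM; first exact: measurable_pos_indic.
    apply: measurable_funM; first exact: measurable_powR.
    by apply: measurable_funVr; apply: measurable_funD => //; exact: measurable_funX.
  have mgE : measurable_fun [set: R] (fun x => (g x)%:E) by apply/measurable_EFinP; exact: mg.
  have g0 y : 0 <= g y by rewrite mulr_ge0// mulr_ge0 ?powR_ge0// invr_ge0 addr_ge0 ?sqr_ge0.
  rewrite (eq_integral_line (g := fun y => ((sin d)^-1 * sin d `^ a)%:E * (g y)%:E)%E); last first.
    move=> y; rewrite -EFinM; congr EFin; rewrite /f /k /g addrK mul1r.
    rewrite /pos_indic pmulr_rgt0//; have [y0|y0] := ltP 0 y; last by rewrite !mul0r mulr0.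
    rewrite [true%:R]/(1 : R) !mul1r powRM ?(ltW s0) ?(ltW y0)//.
    rewrite (@sqrtV_double _ _ 1) ?addr_ge0 ?sqr_ge0// expr1 exprMn.
    have y2 : 1 + y ^+ 2 != 0 by rewrite gt_eqF// ltr_pwDl ?sqr_ge0.
    rewrite (_ : sin d ^+ 2 + _ = sin d ^+ 2 * (1 + y ^+ 2)); last by ring.
    by field; rewrite y2 gt_eqF.
  rewrite ge0_integralZl//; last 2 first.
  - by move=> x _; rewrite lee_fin.
  - by rewrite lee_fin mulr_ge0 ?powR_ge0// invr_ge0 ltW.
  rewrite integral_pos_indic hM -!EFinM; congr EFin.
  by rewrite !mulrA divff ?mul1r// gt_eqF.
rewrite -Rec -rot -lee_fin EFinD -Ik -If -ge0_integralD//; last 3 first.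
- by move=> x _; rewrite lee_fin.
- by apply/measurable_EFinP; exact: mk.
- by move=> x _; rewrite lee_fin.
rewrite /Rintegral fineK; last exact: (integrable_fin_num measurable_pos ir).
rewrite -integral_pos_indic; apply: le_ge0_integral => x _.
  rewrite lee_fin /pos_indic; case: (ltP 0 x) => [x0|_]; last by rewrite mul0r.
  by rewrite [true%:R]/(1 : R) mul1r E// -/(k x) mulr_ge0 ?powR_ge0.
rewrite -EFinD lee_fin /pos_indic; case: (ltP 0 x) => [x0|_]; last by rewrite mul0r addr_ge0.
rewrite [true%:R]/(1 : R) mul1r E// -/(k x) /f -[X in _ <= X + _]mul1r -mulrDl ler_wpM2r//.
rewrite /pos_indic; have [y0|y0] := ltP 0 (x - cos d).
  rewrite [true%:R]/(1 : R) mul1r (le_trans _ (powR_le_1D a0 (ltW a1) y0))//.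
  have y1 : 0 <= 1 + (x - cos d) by apply: addr_ge0 => //; exact: ltW.
  rewrite ge0_ler_powR ?nnegrE ?(ltW a0) ?(ltW x0) ?y1//.
  by rewrite addrCA lerDl subr_ge0 cos_le1.
rewrite [false%:R]/(0 : R) mul0r addr0 [leRHS](_ : _ = 1 `^ a); last by rewrite powR1.
rewrite ge0_ler_powR ?nnegrE ?(ltW a0) ?(ltW x0)//.
by rewrite (le_trans _ (cos_le1 d))// -subr_le0.
Qed.

(** The upper half of Euler's reflection formula: turning the ray by an angle
  close to pi makes the integrand approach a Poisson kernel of mass pi. *)
Lemma beta_reflection_le (a : R) : 0 < a -> a < 1 ->
  (\int[mu]_(x in pos) (x `^ (a - 1) * (1 + x)^-1)%:E <= (pi / sin (pi * a))%:E)%E.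
Proof.
move=> a0 a1; have [M hM] := integral_powR_cauchy_fin a0 a1.
pose d (k : nat) : R := k.+2%:R^-1.
have d01 k : 0 < d k < pi.
  rewrite invr_gt0 ltr0Sn/= (@lt_le_trans _ _ 1)//; first by rewrite invf_lt1 ?ltr1n.
  by have := @pihalf_ge1 R; rewrite ler_pdivlMr// mul1r; apply: le_trans; rewrite ler1n.
set B := \int[mu]_(x in pos) (x `^ (a - 1) * (1 + x)^-1 ^+ 1).
have h k : sin (a * (pi - d k)) * B <= pi + sin (d k) `^ a * M.
  exact: sin_beta_le.
have cd : d k @[k --> \oo] --> (0 : R) := cvg_inv_nat.
have csin : sin (d k) @[k --> \oo] --> (0 : R).
  rewrite -[X in _ --> X](@sin0 R).
  by apply: (@cvg_comp _ _ _ d (@sin R) _ _ _ cd); exact: continuous_sin.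
have cs : sin (d k) `^ a @[k --> \oo] --> (0 : R).
  have /cvg_at_rightP := powR_cvg0 a0; apply; split=> // k.
  exact: sin_gt0_pi.
have c1 : sin (a * (pi - d k)) * B @[k --> \oo] --> sin (a * (pi - 0)) * B.
  apply: cvgM; last exact: cvg_cst.
  have hc : a * (pi - d k) @[k --> \oo] --> a * (pi - 0).
    by apply: cvgM; [exact: cvg_cst|apply: cvgB => //; exact: cvg_cst].
  by apply: (@cvg_comp _ _ _ (fun k => a * (pi - d k)) (@sin R) _ _ _ hc); exact: continuous_sin.
have c2 : pi + sin (d k) `^ a * M @[k --> \oo] --> pi + 0 * M.
  by apply: cvgD; [exact: cvg_cst|apply: cvgM => //; exact: cvg_cst].
have lim : sin (a * (pi - 0)) * B <= pi + 0 * M.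
  by apply: (ler_cvg_to c1 c2); near=> k; exact: h.
move: lim; rewrite subr0 mul0r addr0 [a * _]mulrC => lim.
have sa : 0 < sin (pi * a).
  by apply: sin_gt0_pi; rewrite mulr_gt0 ?pi_gt0//= gtr_pMr ?pi_gt0.
have a1' : a < 1%:R by [].
rewrite (_ : (\int[mu]_(x in pos) _)%E = B%:E).
  by rewrite lee_fin ler_pdivlMr// mulrC.
rewrite /B /Rintegral fineK//.
have ib := integrable_beta a0 a1'.
apply: (integrable_fin_num measurable_pos).
apply: eq_integrable ib => // x /set_mem/posP x0 /=.
by rewrite powRN powRr1 ?addr_ge0 ?(ltW x0)// expr1.
Unshelve. all: by end_near. Qed.

End reflection.

(** * The Schur test *)

Section schur.
Context d (T : measurableType d) (R : realType).
Variable m : {sigma_finite_measure set T -> \bar R}.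
Variables (p q : R) (K : T -> T -> R) (h f : T -> R) (C : R).
Hypotheses (p0 : 0 < p) (q0 : 0 < q) (pq : p^-1 + q^-1 = 1).
Hypotheses (mK : measurable_fun setT (fun s : T * T => K s.1 s.2))
  (K0 : forall z w, 0 <= K z w).
Hypotheses (mh : measurable_fun setT h) (h0 : forall z, 0 <= h z).
Hypotheses (mf : measurable_fun setT f) (f0 : forall z, 0 <= f z).
Hypotheses (hf : forall z, h z = 0 -> f z = 0) (C0 : 0 <= C).
Hypothesis Kq : forall z, 0 < h z ->
  (\int[m]_w (K z w * h w `^ q)%:E <= (C * h z `^ q)%:E)%E.
Hypothesis Kp : forall w, 0 < h w ->
  (\int[m]_z (K z w * h z `^ p)%:E <= (C * h w `^ p)%:E)%E.

Let measurable_powR_comp (r : R) (g : T -> R) :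
  measurable_fun setT g -> measurable_fun setT (fun w => g w `^ r).
Proof. by move=> mg; exact: (measurableT_comp (measurable_powR r)). Qed.

Let mKz z : measurable_fun setT (K z).
Proof. exact: (measurable_fun_pair2 z mK). Qed.

(** Hoelder's inequality with the weight distributed between the two factors. *)
Let schur_pointwise z : 0 < h z ->
  ((\int[m]_w (K z w * f w)%:E) `^ p <=
   (C `^ (p / q) * h z `^ p)%:E * \int[m]_w (K z w * (h w `^ (- p) * f w `^ p))%:E)%E.
Proof.
move=> hz.
(* [K * f] is the product of [K ^ (1 / q) * h] and [K ^ (1 / p) * f / h]. *)
pose F w := K z w `^ q^-1 * h w; pose G w := K z w `^ p^-1 * (h w `^ (-1) * f w).
have mF : measurable_fun setT F by apply: measurable_funM => //; exact: measurable_powR_comp.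
have mG : measurable_fun setT G.
  apply: measurable_funM; first exact: measurable_powR_comp.
  by apply: measurable_funM => //; exact: measurable_powR_comp.
have F0 w : 0 <= F w by rewrite mulr_ge0 ?powR_ge0.
have G0 w : 0 <= G w by rewrite !mulr_ge0 ?powR_ge0.
have := hoelder m mF mG q0 p0; rewrite addrC pq => /(_ erefl).
rewrite Lnorm1 (_ : (\int[m]_x `|(EFin \o (F \* G)%R) x|)%E =
    (\int[m]_w (K z w * f w)%:E)%E); last first.
  apply: eq_integral => w _; rewrite /= ger0_norm ?(mulr_ge0 (F0 w) (G0 w))//; congr EFin.
  rewrite /F /G mulrACA -powRD; last by rewrite addrC pq oner_eq0.
  rewrite addrC pq powRr1//; congr (_ * _).
  have [hw|hw] := eqVneq (h w) 0; first by rewrite (hf hw) !mulr0.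
  by rewrite mulrA powR_inv1// divff// mul1r.
rewrite unlock /Lnorm.
rewrite (_ : (\int[m]_x (`|(EFin \o F) x| `^ q))%E =
    (\int[m]_w (K z w * h w `^ q)%:E)%E); last first.
  apply: eq_integral => w _; rewrite /= ger0_norm//; congr EFin.
  by rewrite /F powRM ?powR_ge0// -powRrM mulVf ?gt_eqF// powRr1.
rewrite (_ : (\int[m]_x (`|(EFin \o G) x| `^ p))%E =
    (\int[m]_w (K z w * (h w `^ (- p) * f w `^ p))%:E)%E); last first.
  apply: eq_integral => w _; rewrite /= ger0_norm//; congr EFin.
  rewrite /G powRM ?mulr_ge0 ?powR_ge0// -powRrM mulVf ?gt_eqF// powRr1//.
  by rewrite powRM ?powR_ge0// -powRrM mulN1r.
have I0 (g : T -> R) : (forall w, 0 <= g w) -> (0 <= \int[m]_w (g w)%:E)%E.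
  by move=> g0; apply: integral_ge0 => w _; rewrite lee_fin.
set A := (\int[m]_w (K z w * f w)%:E)%E; set B := (\int[m]_w (K z w * h w `^ q)%:E)%E.
set E := (\int[m]_w (K z w * (h w `^ (- p) * f w `^ p))%:E)%E => hol.
have A0 : (0 <= A)%E by apply: I0 => w; rewrite mulr_ge0.
have B0 : (0 <= B)%E by apply: I0 => w; rewrite mulr_ge0 ?powR_ge0.
have E0 : (0 <= E)%E by apply: I0 => w; rewrite !mulr_ge0 ?powR_ge0.
have h1 : (A `^ p <= (B `^ q^-1 * E `^ p^-1) `^ p)%E.
  by rewrite gt0_ler_poweR ?(ltW p0)// in_itv/= leey andbT// mule_ge0// poweR_ge0.
rewrite (le_trans h1)// poweRM ?poweR_ge0// -!poweRrM mulVf ?gt_eqF// poweRe1//.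
apply: lee_wpmul2r => //.
rewrite (@le_trans _ _ ((C * h z `^ q)%:E `^ (q^-1 * p))%E)//.
  rewrite gt0_ler_poweR ?in_itv/= ?leey ?andbT ?B0 ?lee_fin ?mulr_ge0 ?powR_ge0 ?invr_ge0 ?(ltW q0) ?(ltW p0)//.
  exact: Kq.
rewrite poweR_EFin lee_fin powRM ?powR_ge0// [q^-1 * p]mulrC -powRrM.
by rewrite [q * _]mulrC divfK// gt_eqF.
Qed.

(** The pointwise bound is integrated in [z], and the order of integration is
  exchanged to use the second hypothesis on the weight. *)
Lemma schur_test :
  (\int[m]_(z in [set z | (0 < h z)%R]) (\int[m]_w (K z w * f w)%:E) `^ p <=
   (C `^ p)%:E * \int[m]_w (f w `^ p)%:E)%E.
Proof.
pose k w := h w `^ (- p) * f w `^ p.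
have mk : measurable_fun setT k by apply: measurable_funM; exact: measurable_powR_comp.
have k0 w : 0 <= k w by rewrite mulr_ge0 ?powR_ge0.
have I0 (g : T -> R) : (forall w, 0 <= g w) -> (0 <= \int[m]_w (g w)%:E)%E.
  by move=> g0; apply: integral_ge0 => w _; rewrite lee_fin.
have cpq : C `^ p = C `^ (p / q) * C.
  have -> : C `^ (p / q) * C = C `^ (p / q) * C `^ 1 by rewrite powRr1.
  rewrite -powRD; last first.
    by rewrite (_ : _ == 0 = false)// gt_eqF// addr_gt0// divr_gt0.
  congr (_ `^ _); rewrite (_ : 1 = p / p); last by rewrite divff// gt_eqF.
  by rewrite -mulrDr addrC pq mulr1.
pose S z w := (K z w * h z `^ p) * k w.
have S0 z w : (0 <= (S z w)%:E)%E by rewrite lee_fin !mulr_ge0 ?powR_ge0.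
have mS : measurable_fun setT (fun s : T * T => (S s.1 s.2)%:E).
  apply/measurable_EFinP; apply: measurable_funM.
    apply: measurable_funM => //.
    apply: (@measurableT_comp _ _ _ _ _ _ (fun z => h z `^ p)); last exact: measurable_fst.
    exact: measurable_powR_comp.
  by apply: (measurableT_comp mk); exact: measurable_snd.
apply: (@le_trans _ _ ((C `^ (p / q))%:E * \int[m]_z \int[m]_w (S z w)%:E)%E).
  rewrite -ge0_integralZl//; last 3 first.
  - exact: measurable_ge0_integral.
  - by move=> z _; exact: integral_ge0.
  - by rewrite lee_fin powR_ge0.
  rewrite [leLHS]integral_mkcond; apply: le_ge0_integral => z _.
    by rewrite patchE; case: ifP => // _; exact: poweR_ge0.
  have SE : (\int[m]_w (S z w)%:E = (h z `^ p)%:E * \int[m]_w (K z w * k w)%:E)%E.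
    rewrite -ge0_integral_EFinZl ?powR_ge0//; last 2 first.
    - exact: measurable_funM.
    - by move=> w; rewrite mulr_ge0.
    by apply: eq_integral => w _; congr EFin; rewrite /S; ring.
  rewrite patchE; case: ifPn => [/set_mem hz|_]; last first.
    by rewrite mule_ge0 ?lee_fin ?powR_ge0// integral_ge0.
  rewrite (le_trans (schur_pointwise hz))// EFinM -muleA.
  by apply: lee_wpmul2l; [rewrite lee_fin powR_ge0|rewrite SE].
rewrite (@ge0_integral_exchange _ _ _ _ _ m m (fun z w => (S z w)%:E) mS S0).
rewrite cpq EFinM -muleA; apply: lee_wpmul2l; first by rewrite lee_fin powR_ge0.
rewrite -(ge0_integral_EFinZl m C0 (measurable_powR_comp p mf)); last first.
  by move=> w; rewrite powR_ge0.
apply: le_ge0_integral => w _; first exact: integral_ge0.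
have -> : (\int[m]_z (S z w)%:E = (k w)%:E * \int[m]_z (K z w * h z `^ p)%:E)%E.
  have mKw : measurable_fun setT (fun z => K z w * h z `^ p).
    apply: measurable_funM; last exact: measurable_powR_comp.
    exact: (measurable_fun_pair1 w mK).
  have Kw0 z : 0 <= K z w * h z `^ p by rewrite mulr_ge0 ?powR_ge0.
  rewrite -(ge0_integral_EFinZl m (k0 w) mKw Kw0).
  by apply: eq_integral => z _; congr EFin; rewrite /S mulrC.
have [hw|hw] := eqVneq (h w) 0.
  by rewrite /k (hf hw) powR0 ?gt_eqF// mulr0 mul0e mulr0.
have hw0 : 0 < h w by rewrite lt_neqAle eq_sym hw h0.
rewrite (le_trans (lee_wpmul2l _ (Kp hw0)))// ?lee_fin//.
rewrite /k (_ : _ * (C * _) = (h w `^ (- p) * h w `^ p) * (C * f w `^ p)); last by ring.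
rewrite powRN mulVf ?mul1r// gt_eqF// powR_gt0//.
Qed.

End schur.

(** * The Bergman kernel of the Siegel upper half-space *)

Section kernel.
Context {R : realType}.
Local Notation mu := (@lebesgue_measure R).
Local Notation pos := (`]0, +oo[%classic : set (measurableTypeR R)).

Lemma ReD (z w : R[i]) : Re (z + w) = Re z + Re w.
Proof. by case: z; case: w. Qed.

Lemma ImD (z w : R[i]) : Im (z + w) = Im z + Im w.
Proof. by case: z; case: w. Qed.

Lemma ReN (z : R[i]) : Re (- z) = - Re z. Proof. by case: z. Qed.

Lemma ImN (z : R[i]) : Im (- z) = - Im z. Proof. by case: z. Qed.

Lemma Re_sum (I : Type) (s : seq I) (F : I -> R[i]) :
  Re (\sum_(i <- s) F i) = \sum_(i <- s) Re (F i).
Proof. by elim/big_rec2: _ => // i x y _ <-; rewrite ReD. Qed.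

Lemma Im_sum (I : Type) (s : seq I) (F : I -> R[i]) :
  Im (\sum_(i <- s) F i) = \sum_(i <- s) Im (F i).
Proof. by elim/big_rec2: _ => // i x y _ <-; rewrite ImD. Qed.

Lemma half_imag : 'i / 2 = (0 +i* 2^-1)%C :> R[i].
Proof.
have -> : (2^-1 : R[i]) = (2^-1)%:C%C.
  by rewrite (fmorphV (real_complex R)) (rmorph_nat (real_complex R)).
by rewrite -complexiE; simpc.
Qed.

Section fixed_dimension.
Variable n : nat.
Implicit Types z w : @Cn1 R n.

(** The distance to the boundary in the direction of [Im w.2]. *)
Definition height w : R := Im w.2 - sqnorm w.1.

Lemma siegelP w : siegel w <-> 0 < height w.
Proof. by rewrite /height subr_gt0. Qed.

Lemma sqdistE (s t : n.-tuple R[i]) :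
  sqdist t s = sqnorm s + sqnorm t - 2 * \sum_(j < n) Re (tnth s j * (tnth t j)^*).
Proof.
rewrite /sqdist /sqnorm mulr_sumr -big_split -sumrB; apply: eq_bigr => j _.
by rewrite !normcE2; case: (tnth t j) (tnth s j) => a b [c e] /=; ring.
Qed.

Lemma sqdistC (s t : n.-tuple R[i]) : sqdist t s = sqdist s t.
Proof.
apply: eq_bigr => j _.
by rewrite !normcE2; case: (tnth t j) (tnth s j) => a b [c e] /=; ring.
Qed.

Lemma Re_rho z w : Re (rho z w) = (height z + height w + sqdist w.1 z.1) / 2.
Proof.
rewrite /rho ReD ReN half_imag /hdot Re_sum sqdistE /height.
by case: (z.2) (w.2) => a b [c e] /=; field.
Qed.

Lemma Im_rho z w : Im (rho z w) = 2^-1 * (Re w.2 - (Re z.2 + 2 * Im (hdot z w))).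
Proof.
rewrite /rho ImD ImN half_imag.
by case: (z.2) (w.2) => a b [c e] /=; field.
Qed.

Lemma Im_hdotC z w : Im (hdot z w) = - Im (hdot w z).
Proof.
rewrite /hdot !Im_sum -sumrN; apply: eq_bigr => j _.
by case: (tnth z.1 j) (tnth w.1 j) => a b [c e] /=; ring.
Qed.

Definition kernel_abs z w : R := (normc (rho z w))^-1 ^+ n.+2.

Lemma kernel_absC z w : kernel_abs z w = kernel_abs w z.
Proof.
rewrite /kernel_abs; congr (_^-1 ^+ _); apply/eqP.
rewrite -(eqrXn2 (_ : 0 < 2)%N) ?normc_ge0//; apply/eqP.
rewrite !normcE2 !Re_rho !Im_rho sqdistC (addrC (height z)) (Im_hdotC w z).
by field.
Qed.

Lemma kernel_abs_ge0 z w : 0 <= kernel_abs z w.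
Proof. by rewrite exprn_ge0// invr_ge0 normc_ge0. Qed.

Lemma measurable_hdot : measurable_fun setT (fun s : @Cn1 R n * @Cn1 R n => hdot s.1 s.2).
Proof.
apply: measurable_fun_sumC => j; apply: measurable_funMC.
  apply: (measurableT_comp (measurable_tnth j)).
  by apply: (measurableT_comp (@measurable_fst _ _ _ _)); exact: measurable_fst.
apply: measurable_fun_conjC; apply: (measurableT_comp (measurable_tnth j)).
by apply: (measurableT_comp (@measurable_fst _ _ _ _)); exact: measurable_snd.
Qed.

Lemma measurable_rho : measurable_fun setT (fun s : @Cn1 R n * @Cn1 R n => rho s.1 s.2).
Proof.
apply: measurable_funDC; last by apply: measurable_funNC; exact: measurable_hdot.
apply: measurable_funMC; first exact: measurable_cst.
apply: measurable_funDC.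
  apply: measurable_fun_conjC.
  by apply: (measurableT_comp (@measurable_snd _ _ _ _)); exact: measurable_snd.
apply: measurable_funNC.
by apply: (measurableT_comp (@measurable_snd _ _ _ _)); exact: measurable_fst.
Qed.

Lemma measurable_kernel_abs :
  measurable_fun setT (fun s : @Cn1 R n * @Cn1 R n => kernel_abs s.1 s.2).
Proof.
apply: measurable_funX; apply: measurable_funVr; apply: measurable_normc.
exact: measurable_rho.
Qed.

Lemma measurable_height : measurable_fun setT height.
Proof.
apply: measurable_funB.
  by apply: measurable_ImC; exact: measurable_snd.
by apply: (measurableT_comp (@measurable_sqnorm _ _)); exact: measurable_fst.
Qed.

Lemma measurable_siegel : measurable (@siegel R n).
Proof.
rewrite (_ : siegel (n:=n) = height @^-1` `]0, +oo[).
  by rewrite -[X in measurable X]setTI; apply: measurable_height.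
by apply/seteqP; split => w /=; rewrite in_itv/= andbT => /siegelP.
Qed.

(** For fixed [w.1], the integral over [Re w.2] is [integral_inv_sqrt]; after the
  substitution of the height for [Im w.2], the integral over [w.1] is
  [integral_tuple_inv]. *)
Lemma integral_kernel (z : @Cn1 R n) (s : R) : 0 < height z ->
  (\int[dV n]_w (kernel_abs z w * (pos_indic (height w) * height w `^ s))%:E =
   (2 ^+ n.+2 * wallis n * (pi ^+ n / n`!%:R))%:E *
   \int[mu]_r (pos_indic r * (r `^ s * (height z + r)^-1))%:E)%E.
Proof.
move=> hz.
pose P (r : R) := pos_indic r * r `^ s.
have mP : measurable_fun [set: R] P.
  by apply: measurable_funM; [exact: measurable_pos_indic|exact: measurable_powR].
have P0 r : 0 <= P r by rewrite mulr_ge0 ?powR_ge0.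
have Pz r : r <= 0 -> P r = 0 by move=> r0; rewrite /P /pos_indic ltNge r0 mul0r.
pose f (w : @Cn1 R n) := kernel_abs z w * P (height w).
have mf : measurable_fun setT (fun w : @Cn1 R n => (f w)%:E).
  apply/measurable_EFinP; apply: measurable_funM.
    exact: (measurable_fun_pair2 z measurable_kernel_abs).
  exact: (measurableT_comp mP measurable_height).
have f0 w : (0 <= (f w)%:E)%E by rewrite lee_fin mulr_ge0 ?kernel_abs_ge0.
rewrite (integral_dV_tuple_first mf f0).
pose c : R := 2 ^+ n.+2 * wallis n.
have c0 : 0 <= c by rewrite mulr_ge0 ?exprn_ge0// ltW// wallis_gt0.
pose G (t : n.-tuple R[i]) (r : R) := c * P r * (height z + r + sqdist t z.1)^-1 ^+ n.+1.
have G0 t r : (0 <= (G t r)%:E)%E.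
  rewrite lee_fin /G; have [r0|r0] := ltP 0 r; last by rewrite (Pz r r0) mulr0 mul0r.
  apply: (mulr_ge0 (mulr_ge0 c0 (P0 r))); apply: exprn_ge0.
  by rewrite invr_ge0 ltW// ltr_pwDl ?sqdist_ge0// addr_gt0.
have mG : measurable_fun setT (fun x : n.-tuple R[i] * R => (G x.1 x.2)%:E).
  apply/measurable_EFinP; apply: measurable_funM.
    apply: measurable_funM; first exact: measurable_cst.
    exact: (measurableT_comp mP (@measurable_snd _ _ _ _)).
  apply: measurable_funX; apply: measurable_funVr; apply: measurable_funD.
    by apply: measurable_funD; [exact: measurable_cst|exact: measurable_snd].
  apply: (measurableT_comp (measurable_sqdist z.1)); exact: measurable_fst.
transitivity (\int[tuple_measure lebesgueC n]_t \int[mu]_r (G t r)%:E)%E.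
  apply: eq_integral => t _.
  have mft : measurable_fun setT (fun w : R[i] => (f (t, w))%:E).
    exact: (@measurable_fun_pair2 _ _ _ _ _ _ (fun w : @Cn1 R n => (f w)%:E) t mf).
  rewrite (integral_lebesgueC_Im_first mft)//.
  pose b := Re z.2 + 2 * Im (hdot z (t, 0)).
  pose F (y : R) := P (y - sqnorm t) * (2 * wallis n * ((height z + (y - sqnorm t) + sqdist t z.1) / 2)^-1 ^+ n.+1).
  rewrite (eq_integral_line (g := fun y => (F y)%:E)); last first.
    move=> y; rewrite /F /f.
    have hy x : height (t, (x +i* y)%C) = y - sqnorm t by [].
    have [y0|y0] := ltP 0 (y - sqnorm t); last first.
      rewrite (Pz _ y0) mul0r; apply: integral0_eq => x _.
      by rewrite mulr0.
    set A := _ / 2.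
    have A0 : 0 < A by rewrite divr_gt0// ltr_pwDl ?sqdist_ge0// addr_gt0.
    have h2 : 0 < 2^-1 :> R by rewrite invr_gt0.
    rewrite EFinM -[2]invrK -[2^-1^-1 * _]mulrC -(integral_inv_sqrt n b A0 h2).
    rewrite -ge0_integral_EFinZl//.
    - apply: eq_integral => x _; congr EFin; rewrite mulrC hy; congr (_ * _).
      rewrite /kernel_abs -[normc _]ger0_norm ?normc_ge0// -sqrtr_sqr normcE2.
      by rewrite Re_rho Im_rho hy.
    - apply: measurable_funX; apply: measurable_funVr.
      apply: measurable_fun_sqrt; first by move=> x; rewrite addr_ge0 ?sqr_ge0.
      apply: measurable_funD => //; apply: measurable_funX; apply: measurable_funM => //.
      exact: measurable_funB.
  have F0 y : (0 <= (F y)%:E)%E.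
    rewrite lee_fin /F; have [r0|r0] := ltP 0 (y - sqnorm t); last by rewrite (Pz _ r0) mul0r.
    apply: (mulr_ge0 (P0 _)); apply: mulr_ge0; first by rewrite mulr_ge0// ltW// wallis_gt0.
    by apply: exprn_ge0; rewrite invr_ge0 divr_ge0// ltW// ltr_pwDl ?sqdist_ge0// addr_gt0.
  have mF : measurable_fun [set: R] (fun y => (F y)%:E).
    have ms : measurable_fun [set: R] (fun y : R => y - sqnorm t) by exact: measurable_funB.
    apply/measurable_EFinP; apply: measurable_funM; first exact: (measurableT_comp mP ms).
    apply: measurable_funM; first exact: measurable_cst.
    apply: measurable_funX; apply: measurable_funVr; apply: measurable_funM => //.
    by apply: measurable_funD => //; exact: measurable_funD.
  rewrite (integral_affine (sqnorm t) ltr01 mF F0) mul1e.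
  apply: eq_integral => r _; congr EFin; rewrite /F mul1r addrK /G /c.
  rewrite invfM invrK exprMn !exprS; ring.
rewrite (@ge0_integral_exchange R _ _ _ _ (tuple_measure lebesgueC n) mu (fun t r => (G t r)%:E) mG G0).
have mQ : measurable_fun [set: R] (fun r => pos_indic r * (r `^ s * (height z + r)^-1)).
  apply: measurable_funM; first exact: measurable_pos_indic.
  apply: measurable_funM; first exact: measurable_powR.
  by apply: measurable_funVr; exact: measurable_funD.
have Q0 r : 0 <= pos_indic r * (r `^ s * (height z + r)^-1).
  rewrite /pos_indic; case: (ltP 0 r) => [r0|_]; last by rewrite mul0r.
  by rewrite !mulr_ge0 ?powR_ge0// invr_ge0 addr_ge0// ltW.
rewrite -(ge0_integral_EFinZl mu _ mQ Q0); last first.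
  by rewrite mulr_ge0 ?divr_ge0 ?exprn_ge0 ?pi_ge0.
apply: eq_integral => r _; have [r0|r0] := ltP 0 r; last first.
  rewrite [pos_indic r](_ : _ = 0); last by rewrite /pos_indic ltNge r0.
  rewrite mul0r mulr0; apply: integral0_eq => t _.
  by rewrite /G (Pz _ r0) mulr0 mul0r.
have B0 : 0 < height z + r by rewrite addr_gt0.
have := @integral_tuple_inv R n 0 (height z + r) z.1 B0; rewrite addn0 => hB.
have mB : measurable_fun setT (fun t : n.-tuple R[i] => (height z + r + sqdist t z.1)^-1 ^+ n.+1).
  apply: measurable_funX; apply: measurable_funVr; apply: measurable_funD => //.
  exact: measurable_sqdist.
have hB0 (t : n.-tuple R[i]) : 0 <= (height z + r + sqdist t z.1)^-1 ^+ n.+1.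
  by rewrite exprn_ge0// invr_ge0 addr_ge0 ?sqdist_ge0// ltW.
rewrite (ge0_integral_EFinZl (tuple_measure lebesgueC n) (mulr_ge0 c0 (P0 r)) mB hB0) hB.
rewrite -EFinM; congr EFin; rewrite fact0 mulr1 expr1 /P /c; ring.
Qed.

(** The substitution [r = height z * x] in [integral_kernel] leaves the integral of
  [beta_reflection_le]. *)
Lemma integral_kernel_le (z : @Cn1 R n) (s : R) : 0 < height z -> -1 < s -> s < 0 ->
  (\int[dV n]_w (kernel_abs z w * (pos_indic (height w) * height w `^ s))%:E <=
   (2 ^+ n.+2 * wallis n * (pi ^+ n / n`!%:R) * (pi / sin (pi * (s + 1))) *
    height z `^ s)%:E)%E.
Proof.
move=> hz s1 s0; rewrite (integral_kernel s hz).
have c0 : 0 <= 2 ^+ n.+2 * wallis n * (pi ^+ n / n`!%:R) :> R.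
  apply: mulr_ge0; last by apply: divr_ge0 => //; apply: exprn_ge0; exact: pi_ge0.
  by apply: mulr_ge0; [exact: exprn_ge0|exact/ltW/wallis_gt0].
move: (_ * _ * _) c0 => c c0.
rewrite -(mulrA c) (EFinM c); apply: lee_wpmul2l => //.
have mQ (v : R) : measurable_fun [set: R] (fun r => pos_indic r * (r `^ s * (v + r)^-1)).
  apply: measurable_funM; first exact: measurable_pos_indic.
  apply: measurable_funM; first exact: measurable_powR.
  by apply: measurable_funVr; exact: measurable_funD.
have Q0 v r : 0 <= v -> 0 <= pos_indic r * (r `^ s * (v + r)^-1).
  move=> v0; rewrite /pos_indic; case: (ltP 0 r) => [r0|_]; last by rewrite mul0r.
  by rewrite !mulr_ge0 ?powR_ge0// invr_ge0 addr_ge0// ltW.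
have mQE : measurable_fun [set: R] (fun r => (pos_indic r * (r `^ s * (height z + r)^-1))%:E).
  by apply/measurable_EFinP; exact: mQ.
rewrite (integral_affine 0 hz mQE); last by move=> x; rewrite lee_fin Q0// ltW.
have E : (\int[mu]_x (pos_indic (height z * x + 0) *
    ((height z * x + 0) `^ s / (height z + (height z * x + 0))))%:E =
    ((height z)^-1 * height z `^ s)%:E * \int[mu]_x (pos_indic x * (x `^ s * (1 + x)^-1))%:E)%E.
  rewrite -(ge0_integral_EFinZl mu _ (mQ 1)); last 2 first.
  - by rewrite mulr_ge0 ?powR_ge0// invr_ge0 ltW.
  - by move=> r; exact: Q0.
  apply: eq_integral => r _; congr EFin; rewrite addr0 /pos_indic pmulr_rgt0//.
  have [r0|r0] := ltP 0 r; last by rewrite !mul0r mulr0.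
  rewrite powRM ?(ltW hz) ?(ltW r0)//.
  by rewrite (_ : height z + height z * r = height z * (1 + r)) ?invfM; ring.
rewrite E muleA -EFinM mulrA divff ?gt_eqF// mul1r mulrC EFinM.
apply: lee_wpmul2l; first by rewrite lee_fin powR_ge0.
have a0 : 0 < s + 1 by rewrite -ltrBlDr sub0r.
have a1 : s + 1 < 1 by rewrite gtrDr.
have := beta_reflection_le a0 a1.
by rewrite addrK -integral_pos_indic.
Qed.

End fixed_dimension.
End kernel.

(** * The upper bound *)

Section complex_integral.
Context d (T : measurableType d) (R : realType).
Variable m : {measure set T -> \bar R}.

Lemma measurable_normc_in (D : set T) (g : T -> R[i]) :
  measurable_fun D g -> measurable_fun D (fun w => normc (g w)).
Proof.
have h := @measurable_normc R _ R[i] id (@measurable_id _ _ _).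
exact: (measurableT_comp h).
Qed.

Lemma measurable_mulC_in (D : set T) (f g : T -> R[i]) : measurable D ->
  measurable_fun D f -> measurable_fun D g -> measurable_fun D (fun w => f w * g w).
Proof.
move=> mD /(measurable_restrictT _ mD) mf /(measurable_restrictT _ mD) mg.
apply/(measurable_restrictT _ mD).
rewrite (_ : _ \_ D = (fun w => (f \_ D) w * (g \_ D) w)); first exact: measurable_funMC.
by apply/funext => w; rewrite !patchE; case: ifP => // _; rewrite mul0r.
Qed.

Lemma integrable_ReC (D : set T) (g : T -> R[i]) : measurable D -> measurable_fun D g ->
  (\int[m]_(w in D) (normc (g w))%:E < +oo)%E ->
  m.-integrable D (EFin \o (fun w => Re (g w))).
Proof.
move=> mD mg goo; apply/integrableP; split.
  by apply/measurable_EFinP; exact: (measurableT_comp measurable_Re mg).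
apply: le_lt_trans goo; apply: le_ge0_integral => w _ //=.
by rewrite lee_fin normc_ge_Re.
Qed.

Lemma integrable_ImC (D : set T) (g : T -> R[i]) : measurable D -> measurable_fun D g ->
  (\int[m]_(w in D) (normc (g w))%:E < +oo)%E ->
  m.-integrable D (EFin \o (fun w => Im (g w))).
Proof.
move=> mD mg goo; apply/integrableP; split.
  by apply/measurable_EFinP; exact: (measurableT_comp measurable_Im mg).
apply: le_lt_trans goo; apply: le_ge0_integral => w _ //=.
by rewrite lee_fin normc_ge_Im.
Qed.

Lemma Re_cintegralM (D : set T) (g : T -> R[i]) (c : R[i]) : measurable D ->
  measurable_fun D g -> (\int[m]_(w in D) (normc (g w))%:E < +oo)%E ->
  Re (c * cintegral m D g) = \int[m]_(w in D) Re (c * g w).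
Proof.
move=> mD mg goo; have i1 := integrable_ReC mD mg goo; have i2 := integrable_ImC mD mg goo.
case: c => a b; rewrite /cintegral /=.
rewrite -(RintegralZl a mD i1) -(RintegralZl b mD i2).
rewrite -(RintegralB mD (integrableZl mD a i1) (integrableZl mD b i2)).
by rewrite /Rintegral; congr fine; apply: eq_integral => w _; case: (g w).
Qed.

(** The integral is rotated to the positive axis, where its norm is its real part.
  If the integral of the norm diverges there is nothing to prove. *)
Lemma normc_cintegral_le (D : set T) (g : T -> R[i]) : measurable D ->
  measurable_fun D g ->
  ((normc (cintegral m D g))%:E <= \int[m]_(w in D) (normc (g w))%:E)%E.
Proof.
move=> mD mg; have [goo|] := ltP (\int[m]_(w in D) (normc (g w))%:E)%E +oo%E; last first.
  by rewrite leye_eq => /eqP ->; exact: leey.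
set I := cintegral m D g.
have [I0|I0] := eqVneq (normc I) 0.
  by rewrite I0; apply: integral_ge0 => w _; rewrite lee_fin normc_ge0.
have ig : m.-integrable D (EFin \o (fun w => normc (g w))).
  apply/integrableP; split; first by apply/measurable_EFinP; exact: measurable_normc_in.
  rewrite (_ : (\int[m]_(x in D) _)%E = (\int[m]_(w in D) (normc (g w))%:E)%E)//.
  by apply: eq_integral => w _ /=; rewrite ger0_norm ?normc_ge0.
rewrite -(fineK (integrable_fin_num mD ig)) lee_fin -[fine _]/(\int[m]_(w in D) normc (g w)).
have Ip : 0 < normc I by rewrite lt_neqAle eq_sym I0 normc_ge0.
rewrite -(ler_pM2l Ip) -(RintegralZl _ mD ig) -expr2.
have -> : normc I ^+ 2 = Re (I^* * I) by rewrite normcE2; case: (I) => a b /=; ring.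
rewrite Re_cintegralM//; apply: le_Rintegral => //.
- apply: integrable_ReC => //; first by apply: measurable_mulC_in => //; exact: measurable_cst.
  under eq_integral do rewrite normcM EFinM.
  rewrite ge0_integralZl//; last 3 first.
  + by case/integrableP : ig.
  + by move=> w _; rewrite lee_fin normc_ge0.
  + by rewrite lee_fin normc_ge0.
  rewrite lte_mul_pinfty// ?lee_fin ?normc_ge0//.
- exact: (integrableZl mD _ ig).
- move=> w _; rewrite (le_trans (ler_norm _))// (le_trans (normc_ge_Re _))// normcM.
  rewrite ler_wpM2r ?normc_ge0// le_eqVlt; apply/orP; left; apply/eqP.
  by case: (I) => a b /=; rewrite sqrrN.
Qed.

End complex_integral.

Section upper_bound.
Context {R : realType}.
Variables (n : nat) (p q : R).
Hypotheses (p1 : 1 < p) (qE : q = p / (p - 1)).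

Let p0 : 0 < p. Proof. exact: lt_trans p1. Qed.

Let q0 : 0 < q. Proof. by rewrite qE divr_gt0// subr_gt0. Qed.

Let pq : p^-1 + q^-1 = 1.
Proof. by rewrite qE; field; rewrite !gt_eqF// subr_gt0. Qed.

Let pV1 : p^-1 < 1. Proof. by rewrite invf_lt1. Qed.

Let pV0 : 0 < p^-1. Proof. by rewrite invr_gt0. Qed.

Let qV0 : 0 < q^-1. Proof. by rewrite invr_gt0. Qed.

Let sinp : 0 < sin (pi / p).
Proof.
by apply: sin_gt0_pi; rewrite divr_gt0 ?pi_gt0//= ltr_pdivrMr// ltr_pMr ?pi_gt0.
Qed.

Let C : R := 2 ^+ n.+2 * wallis n * (pi ^+ n / n`!%:R) * (pi / sin (pi / p)).

Let C0 : 0 <= C.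
Proof.
apply: mulr_ge0; last by rewrite divr_ge0 ?pi_ge0// ltW.
apply: mulr_ge0; last by apply: divr_ge0 => //; apply: exprn_ge0; exact: pi_ge0.
by apply: mulr_ge0; [exact: exprn_ge0|exact/ltW/wallis_gt0].
Qed.

Let h (w : @Cn1 R n) : R := pos_indic (height w) * height w `^ (- (p * q)^-1).

Let h_powR (r : R) (w : @Cn1 R n) : 0 < r ->
  h w `^ r = pos_indic (height w) * height w `^ (- (p * q)^-1 * r).
Proof.
move=> r0; rewrite /h /pos_indic; case: ltP => _; last by rewrite !mul0r powR0// gt_eqF.
by rewrite [true%:R]/(1 : R) !mul1r powRrM.
Qed.

Let h_gt0 (w : @Cn1 R n) : 0 < h w -> 0 < height w.
Proof.
move=> hw; have [//|w0] := ltP 0 (height w).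
by move: hw; rewrite /h (_ : pos_indic _ = 0) ?mul0r ?ltxx// /pos_indic ltNge w0.
Qed.

Let h_siegel (w : @Cn1 R n) : siegel w -> 0 < h w.
Proof. by move=> /siegelP w0; rewrite /h /pos_indic w0 mul1r powR_gt0. Qed.

Let kernel_le (r s : R) (z : @Cn1 R n) : 0 < r -> 0 < s < 1 -> (p * q)^-1 * r = s ->
  sin (pi * (1 - s)) = sin (pi / p) -> 0 < h z ->
  (\int[dV n]_w (kernel_abs z w * h w `^ r)%:E <= (C * h z `^ r)%:E)%E.
Proof.
move=> r0 /andP[s0 s1] rs sE hz; have z0 := h_gt0 hz.
rewrite (h_powR z r0) /pos_indic z0 mul1r mulNr rs.
rewrite (_ : (\int[dV n]_w _)%E = (\int[dV n]_w (kernel_abs z w *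
    (pos_indic (height w) * height w `^ (- s)))%:E)%E); last first.
  by apply: eq_integral => w _; rewrite h_powR// mulNr rs.
have h1 : -1 < - s by rewrite ltrN2.
have h2 : - s < 0 by rewrite oppr_lt0.
by have := integral_kernel_le z0 h1 h2; rewrite addrC sE.
Qed.

Let Gamma_neq0 : Gamma (n.+2%:R / 2 : R) != 0.
Proof.
apply/eqP => G0; have := @wallis_Gamma R n; rewrite G0 expr0n mulr0 => /esym/eqP.
by rewrite mulf_eq0 gt_eqF ?pi_gt0//= pnatr_eq0 -leqn0 leqNgt fact_gt0.
Qed.

Let constantE : n.+1`!%:R / (4 * pi ^+ n.+1) * C =
  n.+1`!%:R / Gamma (n.+2%:R / 2) ^+ 2 * (pi / sin (pi / p)).
Proof.
have := @wallis_Gamma R n; rewrite /C.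
have G2 : Gamma (n.+2%:R / 2 : R) ^+ 2 != 0 by rewrite expf_neq0.
have n0 : n`!%:R != 0 :> R by rewrite pnatr_eq0 -lt0n fact_gt0.
have pi0 : (pi : R) != 0 by rewrite gt_eqF// pi_gt0.
move=> /(canRL (mulfK G2)) W.
rewrite (exprS 2) (exprS 2) (exprS pi).
have -> : 2 * (2 * 2 ^+ n) * wallis n = 4 * (wallis n * 2 ^+ n) :> R by ring.
rewrite W; have P0 : pi ^+ n != 0 :> R by rewrite expf_neq0.
have s0 : sin (pi / p) != 0 by rewrite gt_eqF.
move: (pi : R) pi0 (pi ^+ n) P0 (sin _) s0 (Gamma _ ^+ 2) G2 => x x0 P P0 s s0 g g0.
move: (n.+1`!%:R : R) (n`!%:R : R) n0 => u v v0 {W}.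
by field; rewrite ?s0 ?P0 ?x0 ?g0 ?v0.
Qed.

(** The projection is dominated by the positive operator of kernel [kernel_abs],
  to which the Schur test applies. *)
Lemma Lp_norm_bergman_projection_le (f : @Cn1 R n -> R[i]) :
  measurable_fun (@siegel R n) f ->
  (Lp_norm p (bergman_projection f) <=
   (n.+1`!%:R / Gamma (n.+2%:R / 2) ^+ 2 * (pi / sin (pi / p)))%:E * Lp_norm p f)%E.
Proof.
move=> mf; rewrite -constantE; set c := _ / (4 * _).
have c0 : 0 <= c by apply: divr_ge0 => //; apply: mulr_ge0 => //; apply: exprn_ge0; exact: pi_ge0.
have mS := @measurable_siegel R n.
pose F : @Cn1 R n -> R := (fun w => normc (f w)) \_ (@siegel R n).
have mF : measurable_fun setT F.
  exact: ((measurable_restrictT _ mS).1 (measurable_normc_in mf)).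
have F0 w : 0 <= F w by rewrite /F patchE; case: ifP => // _; exact: normc_ge0.
have Fint : (\int[dV n]_(w in @siegel R n) (normc (f w) `^ p)%:E = \int[dV n]_w (F w `^ p)%:E)%E.
  rewrite integral_mkcond; apply: eq_integral => w _; rewrite /F !patchE.
  by case: ifP => // _; rewrite powR0// gt_eqF.
have hp0 w : 0 <= h w by rewrite mulr_ge0 ?powR_ge0.
have mh : measurable_fun setT h.
  apply: measurable_funM; first exact: (measurableT_comp measurable_pos_indic (@measurable_height _ _)).
  exact: (measurableT_comp (measurable_powR _) (@measurable_height _ _)).
have hF w : h w = 0 -> F w = 0.
  move=> h0; rewrite /F patchE; case: ifPn => // /set_mem/h_siegel.
  by rewrite h0 ltxx.
have k1 z : 0 < h z -> (\int[dV n]_w (kernel_abs z w * h w `^ q)%:E <= (C * h z `^ q)%:E)%E.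
  apply: (@kernel_le q p^-1) => //; first by rewrite pV0 pV1.
    by rewrite invfM divfK// gt_eqF.
  by rewrite mulrBr mulr1 addrC sinDpi sinN opprK.
have k2 w : 0 < h w -> (\int[dV n]_z (kernel_abs z w * h z `^ p)%:E <= (C * h w `^ p)%:E)%E.
  move=> hw; rewrite (_ : (\int[dV n]_z _)%E = (\int[dV n]_z (kernel_abs w z * h z `^ p)%:E)%E).
    apply: (@kernel_le p q^-1) => //.
    - by rewrite qV0 -pq ltrDr.
    - by rewrite invfM mulrC mulrA divff ?mul1r// gt_eqF.
    - by rewrite -pq addrK.
  by apply: eq_integral => z _; rewrite kernel_absC.
have := @schur_test _ _ _ (dV n) p q (@kernel_abs R n) h F C p0 q0 pq
  (@measurable_kernel_abs R n) (@kernel_abs_ge0 R n) mh hp0 mF F0 hF C0 k1 k2.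
rewrite -Fint => schur.
have Pf_le z : siegel z -> ((normc (bergman_projection f z))%:E <=
    c%:E * \int[dV n]_w (kernel_abs z w * F w)%:E)%E.
  move=> Sz; rewrite /bergman_projection normcM normc_real ger0_norm// EFinM.
  apply: lee_wpmul2l; first by rewrite lee_fin.
  have mrho : measurable_fun (@siegel R n) (fun w => rho z w ^- n.+2 * f w).
    apply: measurable_mulC_in => //; apply: measurable_funTS.
    by apply: measurable_funVC; apply: measurable_funXC; exact: (measurable_fun_pair2 z (@measurable_rho _ _)).
  rewrite (le_trans (normc_cintegral_le (dV n) mS mrho))// integral_mkcond.
  rewrite le_eqVlt; apply/orP; left; apply/eqP; apply: eq_integral => w _.
  rewrite /F !patchE; case: ifP => _; last by rewrite mulr0.
  by rewrite normcM normcV normcX /kernel_abs exprVn.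
rewrite /Lp_norm.
have I1 : (\int[dV n]_(z in @siegel R n) (normc (bergman_projection f z) `^ p)%:E <=
    ((c * C) `^ p)%:E * \int[dV n]_(w in @siegel R n) (normc (f w) `^ p)%:E)%E.
  rewrite powRM// EFinM -muleA.
  apply: (@le_trans _ _ ((c `^ p)%:E * \int[dV n]_(z in [set z | (0 < h z)%R])
      (\int[dV n]_w (kernel_abs z w * F w)%:E) `^ p)%E); last first.
    by apply: lee_wpmul2l => //; rewrite lee_fin powR_ge0.
  rewrite -ge0_integralZl//; last 4 first.
  - rewrite (_ : [set z | _] = @siegel R n)//; apply/seteqP; split => z //=.
      by move=> /h_gt0/siegelP.
    exact: h_siegel.
  - apply: measurable_funTS.
    have mI : measurable_fun setT (fun z => \int[dV n]_w (kernel_abs z w * F w)%:E)%E.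
      apply: (@measurable_ge0_integral _ _ _ _ _ (dV n) (fun z w => (kernel_abs z w * F w)%:E)).
        apply/measurable_EFinP; apply: measurable_funM; first exact: measurable_kernel_abs.
        by apply: (measurableT_comp mF); exact: measurable_snd.
      by move=> z w; rewrite lee_fin mulr_ge0// kernel_abs_ge0.
    exact: (measurableT_comp (measurable_poweR _) mI).
  - by move=> z _; exact: poweR_ge0.
  - by rewrite lee_fin powR_ge0.
  rewrite (_ : [set z | _] = @siegel R n); last first.
    apply/seteqP; split => z //=; last exact: h_siegel.
    by move=> /h_gt0/siegelP.
  apply: le_ge0_integral => z Sz; first by rewrite lee_fin powR_ge0.
  have K0 : (0 <= \int[dV n]_w (kernel_abs z w * F w)%:E)%E.
    by apply: integral_ge0 => w _; rewrite lee_fin mulr_ge0// kernel_abs_ge0.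
  rewrite -poweR_EFin -(@poweR_EFin _ c) -poweRM ?lee_fin//.
  rewrite gt0_ler_poweR ?(ltW p0)//; last exact: Pf_le.
  - rewrite in_itv; apply/andP; split; last exact: leey.
    by rewrite lteifT lee_fin; exact: normc_ge0.
  - rewrite in_itv; apply/andP; split; last exact: leey.
    by rewrite lteifT; apply: mule_ge0; rewrite ?lee_fin.
have cC0 : 0 <= c * C by rewrite mulr_ge0.
have If0 : (0 <= \int[dV n]_(w in @siegel R n) (normc (f w) `^ p)%:E)%E.
  by apply: integral_ge0 => w _; rewrite lee_fin powR_ge0.
apply: (@le_trans _ _ ((((c * C) `^ p)%:E *
    \int[dV n]_(w in @siegel R n) (normc (f w) `^ p)%:E) `^ p^-1)%E).
  rewrite gt0_ler_poweR ?(ltW pV0)// in_itv; apply/andP; (split; last exact: leey); rewrite lteifT.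
    by apply: integral_ge0 => w _; rewrite lee_fin powR_ge0.
  by apply: mule_ge0 => //; rewrite lee_fin powR_ge0.
rewrite poweRM ?lee_fin ?powR_ge0// poweR_EFin -powRrM divff ?gt_eqF// powRr1//.
Qed.

Lemma bergman_opnorm_le :
  (bergman_opnorm n p <=
   (n.+1`!%:R / Gamma (n.+2%:R / 2) ^+ 2 * (pi / sin (pi / p)))%:E)%E.
Proof.
set K := (X in X%:E).
have K0 : 0 <= K.
  by rewrite /K mulr_ge0 ?divr_ge0 ?sqr_ge0 ?pi_ge0// ltW.
apply: ge_ereal_sup => _ [f [[mf foo] _] <-].
have := Lp_norm_bergman_projection_le mf; rewrite -/K.
have f0 : (0 <= Lp_norm p f)%E by exact: poweR_ge0.
have Pf0 : (0 <= Lp_norm p (bergman_projection f))%E by exact: poweR_ge0.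
move: foo f0; case: (Lp_norm p f) => [r _|//|//]; rewrite lee_fin => r0.
have [->|rn] := eqVneq r 0.
  rewrite mule0 => h0; have -> : Lp_norm p (bergman_projection f) = 0%E.
    by apply/le_anti/andP; split.
  by rewrite mul0e lee_fin.
by rewrite inver (negbTE rn) lee_pdivrMr// lt_neqAle eq_sym rn.
Qed.

End upper_bound.

(** * The mean value property on balls *)

Section mean_value.
Context {R : realType} (n : nat).
Local Notation tm := (tuple_measure (@lebesgueC R) n).

(** The positive and the negative parts are rotated separately; the rotations with
  a vanishing imaginary part, excluded from [integral_rotation_tuple], are
  products of two others. *)
Lemma integral_rotation_signed (w : R[i]) (f : n.-tuple R[i] -> \bar R) :
  normc w = 1 -> measurable_fun setT f ->
  (\int[tm]_t f (scale_tuple w t) = \int[tm]_t f t)%E.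
Proof.
case: w => c s w1 mf.
have cs : c ^+ 2 + s ^+ 2 = 1.
  by move: w1 => /= w1; rewrite -(sqr_sqrtr (addr_ge0 (sqr_ge0 c) (sqr_ge0 s))) w1 expr1n.
have key (c' s' : R) (g : n.-tuple R[i] -> \bar R) : measurable_fun setT g -> s' != 0 -> c' ^+ 2 + s' ^+ 2 = 1 ->
    (\int[tm]_t g (scale_tuple (c' +i* s')%C t) = \int[tm]_t g t)%E.
  move=> mg s0 cs'; rewrite integralE [RHS]integralE.
  have mp := measurable_funepos mg; have mn := measurable_funeneg mg.
  rewrite -(integral_rotation_tuple s0 cs' mp); last by move=> t; exact: funepos_ge0.
  rewrite -(integral_rotation_tuple s0 cs' mn); last by move=> t; exact: funeneg_ge0.
  by congr (_ - _)%E; apply: eq_integral => t _; rewrite ?funeposE ?funenegE.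
have [s0|s0] := eqVneq s 0; last exact: key.
move: cs; rewrite s0 expr0n addr0 => /eqP; rewrite sqrf_eq1 => /orP[/eqP ->|/eqP ->].
  apply: eq_integral => t _; congr f; apply: eq_from_tnth => j.
  by rewrite tnth_map mul1r.
have i2 : (0 : R) ^+ 2 + 1 ^+ 2 = 1 by rewrite expr0n expr1n add0r.
have mf' : measurable_fun setT (fun t => f (scale_tuple (0 +i* 1)%C t)).
  exact: (measurableT_comp mf (@measurable_scale_tuple R _ n)).
rewrite -(key 0 1 f mf (oner_neq0 _) i2) -(key 0 1 _ mf' (oner_neq0 _) i2).
apply: eq_integral => t _; congr f; apply: eq_from_tnth => j.
rewrite !tnth_map mulrA; congr (_ * _).
by apply/eqP; rewrite eq_complex /= !mul0r !mulr0 mul1r sub0r addr0 !eqxx.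
Qed.

Variables (u : n.-tuple R[i] -> R[i]) (A : R[i]) (N : nat) (v U : R).
Hypotheses (mu : measurable_fun setT u) (v0 : 0 < v) (U0 : 0 < U) (UA : U < normc A).
Hypothesis u_scale : forall w t, u (scale_tuple w t) = w^* * u t.
Local Notation ball := [set t : n.-tuple R[i] | sqnorm t < v].
Hypothesis uU : forall t, ball t -> normc (u t) <= U.

Lemma measurable_ball : measurable ball.
Proof.
rewrite (_ : ball = (@sqnorm R n) @^-1` `]-oo, v[).
  rewrite -[X in measurable X]setTI; exact: measurable_sqnorm.
by apply/seteqP; split => t /=; rewrite in_itv.
Qed.

Lemma integral_ball_cst (k : R) :
  (\int[tm]_(t in ball) k%:E = (k * (pi ^+ n / n`!%:R * v ^+ n))%:E)%E.
Proof.
rewrite integral_cst; last exact: measurable_ball.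
rewrite EFinM -(@volume_ball R n v v0) -[X in (_ * X)%E = _]mul1e.
rewrite -(@integral_cst _ _ _ tm _ measurable_ball 1%E) integral_mkcond; congr (_ * _)%E.
apply: eq_integral => t _; rewrite patchE /ball_indic.
have [h|h] := boolP (sqnorm t < v)%R.
  have hb : ball t by exact: h.
  by rewrite (mem_set hb).
have hb : ~ ball t by exact/negP.
by rewrite (memNset hb).
Qed.

Lemma integrable_ball (g : n.-tuple R[i] -> R) (k : R) : measurable_fun setT g ->
  (forall t, ball t -> `|g t| <= k) -> tm.-integrable ball (EFin \o g).
Proof.
move=> mg gk.
have ic : tm.-integrable ball (EFin \o cst `|k|).
  apply/integrableP; split; first by apply/measurable_EFinP; exact: measurable_cst.
  by rewrite (eq_integral (fun=> `|k|%:E)) ?integral_ball_cst ?ltry// => t _ /=; rewrite normr_id.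
apply: le_integrable ic; first exact: measurable_ball.
  by apply/measurable_EFinP; exact: measurable_funTS.
by move=> t bt; rewrite /= lee_fin normr_id (le_trans (gk t bt))// ler_norm.
Qed.

Let D (l : R[i]) t := A - l * u t.

Let mD l : measurable_fun setT (D l).
Proof.
apply: measurable_funDC; first exact: measurable_cst.
by apply: measurable_funNC; apply: measurable_funMC => //; exact: measurable_cst.
Qed.

Let D_ge l t (B : R) : normc l * U <= B -> ball t -> normc A - B <= normc (D l t).
Proof.
move=> lB bt; rewrite lerBlDr -[X in normc X <= _](subrK (l * u t)).
rewrite (le_trans (le_normcD _ _))// lerD2l normcM (le_trans _ lB)//.
by rewrite ler_wpM2l ?normc_ge0// uU.
Qed.

Let DV_le l t (B : R) : B < normc A -> normc l * U <= B -> ball t ->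
  normc (D l t)^-1 <= (normc A - B)^-1.
Proof.
move=> BA lB bt; have h := D_ge lB bt; have A0 : 0 < normc A - B by rewrite subr_gt0.
by rewrite normcV lef_pV2// posrE (lt_le_trans A0).
Qed.

Let F c l t : R := Re (c * (D l t)^-1 ^+ N).

Let dF c l dl t : R := Re (c * (N%:R * dl * u t * (D l t)^-1 ^+ N.+1)).

Let mF c l : measurable_fun setT (F c l).
Proof.
apply: measurable_ReC; apply: measurable_funMC; first exact: measurable_cst.
by apply: measurable_funXC; exact: measurable_funVC.
Qed.

Let F_le c l t (B : R) : B < normc A -> normc l * U <= B -> ball t ->
  `|F c l t| <= normc c * (normc A - B)^-1 ^+ N.
Proof.
move=> BA lB bt; rewrite (le_trans (normc_ge_Re _))// normcM normcX.
rewrite ler_wpM2l ?normc_ge0// lerXn2r ?nnegrE ?normc_ge0//; last exact: DV_le.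
by rewrite invr_ge0 subr_ge0 ltW.
Qed.

Let dF_le c l dl t (B L : R) : B < normc A -> normc l * U <= B -> normc dl <= L ->
  ball t -> `|dF c l dl t| <= normc c * (N%:R * L * U * (normc A - B)^-1 ^+ N.+1).
Proof.
move=> BA lB dL bt; rewrite (le_trans (normc_ge_Re _))// normcM.
rewrite ler_wpM2l ?normc_ge0// !normcM normcX.
have -> : normc (N%:R : R[i]) = N%:R.
  by rewrite -(rmorph_nat (real_complex R)) normc_real ger0_norm.
have z0 (z : R[i]) : 0 <= normc z := normc_ge0 z.
apply: ler_pM; rewrite ?mulr_ge0 ?exprn_ge0//.
  by apply: ler_pM; rewrite ?mulr_ge0//; [exact: ler_wpM2l|exact: uU].
by rewrite lerXn2r ?nnegrE ?invr_ge0 ?subr_ge0 ?(ltW BA)//; exact: DV_le.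
Qed.

Let Phi c l := \int[tm]_(t in ball) F c l t.

(** Differentiation under the integral sign along a path [l] of multipliers. *)
Let is_derive_Phi c (l dl : R -> R[i]) (s lo B L : R) : B < normc A -> `|s| < lo ->
  (forall r : R, `|r| < lo -> cderive l r (dl r)) ->
  (forall r, `|r| < lo -> normc (l r) * U <= B) ->
  (forall r, `|r| < lo -> normc (dl r) <= L) ->
  is_derive s 1 (fun r => Phi c (l r)) (\int[tm]_(t in ball) dF c (l s) (dl s) t).
Proof.
move=> BA slo hl lB dL.
have Iu (r : R) : (`]- lo, lo[%classic : set R) r -> `|r| < lo by rewrite /= in_itv/= ltr_norml.
have Is : (`]- lo, lo[%classic : set R) s by rewrite /= in_itv/= -ltr_norml.
pose f (r : R) t := F c (l r) t.
have intf (r : R) : (`]- lo, lo[%classic : set R) r -> tm.-integrable ball (EFin \o f r).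
  move=> /Iu rlo; apply: integrable_ball; first exact: mF.
  by move=> t; apply: F_le BA _; exact: lB.
have df (r : R) t : (`]- lo, lo[%classic : set R) r -> ball t ->
    is_derive r 1 (f ^~ t) (dF c (l r) (dl r) t).
  move=> /Iu rlo bt.
  have D0 : D (l r) t != 0.
    rewrite -normc_eq0 gt_eqF// (lt_le_trans _ (D_ge (lB _ rlo) bt))// subr_gt0//.
  have h1 := cderive_add (cderive_cst A r) (cderive_opp (cderive_mul (hl _ rlo) (cderive_cst (u t) r))).
  have h2 := cderive_mul (cderive_cst c r) (cderive_exp N (cderive_inv h1 D0)).
  apply: (derive_eq h2.1); rewrite /dF -/(D (l r) t); congr Re.
  case: (N) => [|N']; first by rewrite /= expr0; ring.
  by rewrite /= !exprS; ring.
have derf (r : R) t : (`]- lo, lo[%classic : set R) r -> ball t -> derivable (f ^~ t) r 1.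
  by move=> h1 h2; have [] := df _ _ h1 h2.
pose G (_ : n.-tuple R[i]) := `|normc c * (N%:R * L * U * (normc A - B)^-1 ^+ N.+1)|.
have G0 t : 0 <= G t by exact: normr_ge0.
have iG : tm.-integrable ball (EFin \o G).
  apply: (integrable_ball (k := `|normc c * (N%:R * L * U * (normc A - B)^-1 ^+ N.+1)|)).
    exact: measurable_cst.
  by move=> t _; rewrite /G normr_id.
have Gub (r : R) t : (`]- lo, lo[%classic : set R) r -> ball t -> `|partial1of2 f r t| <= G t.
  move=> h1 h2; rewrite partial1of2E; have [_ ->] := df _ _ h1 h2.
  rewrite (le_trans _ (ler_norm _))//.
  by apply: dF_le => //; [exact: lB (Iu _ h1)|exact: dL (Iu _ h1)].
have h1 := @derivable_under_integral R _ _ tm f ball measurable_ball s (- lo) lo Is intf derf G G0 iG Gub.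
have h2 := @differentiation_under_integral R _ _ tm f ball measurable_ball s (- lo) lo Is intf derf G G0 iG Gub.
apply: DeriveDef; first exact: h1.
rewrite -derive1E; apply: (etrans h2); rewrite /Rintegral; congr fine.
apply: eq_integral => t /set_mem bt; congr EFin.
by rewrite partial1of2E; have [_ ->] := df _ _ Is bt.
Qed.

(** Multiplying [u] by a phase amounts to rotating the ball. *)
Let Phi_rotation c (x phi : R) : Phi c (x%:C%C * cis phi) = Phi c x%:C%C.
Proof.
suff E : (\int[tm]_(t in ball) (F c (x%:C%C * cis phi) t)%:E =
    \int[tm]_(t in ball) (F c x%:C%C t)%:E)%E by rewrite /Phi /Rintegral E.
rewrite [LHS]integral_mkcond [RHS]integral_mkcond.
pose g := (fun t => (F c x%:C%C t)%:E) \_ ball.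
have mg : measurable_fun setT g.
  apply/(measurable_restrictT _ measurable_ball); apply: measurable_funTS.
  by apply/measurable_EFinP; exact: mF.
have w1 : normc ((cis phi)^*) = 1 by have := normc_cis phi; rewrite /cis /= sqrrN.
rewrite -[RHS](integral_rotation_signed w1 mg); apply: eq_integral => t _.
have bE : sqnorm (scale_tuple (cis phi)^* t) = sqnorm t.
  rewrite /sqnorm; apply: eq_bigr => j _.
  by rewrite tnth_map normcM w1 mul1r.
have bi : (scale_tuple (cis phi)^* t \in ball) = (t \in ball).
  apply/idP/idP => /set_mem h; apply/mem_set.
    by change (is_true (sqnorm t < v)); rewrite -bE; exact: h.
  by change (is_true (sqnorm (scale_tuple (cis phi)^* t) < v)); rewrite bE; exact: h.
rewrite /g !patchE bi /F /D u_scale mulrA.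
rewrite (_ : ((cis phi)^*)^* = cis phi)//.
by rewrite /cis; apply/eqP; rewrite eq_complex /= opprK !eqxx.
Qed.

(** The derivative of [Phi] along the circle of radius [s ^+ 2] vanishes by
  [Phi_rotation], and the radial derivative is a complex multiple of it. *)
Let integral_dF0 c (s B : R) : B < normc A -> s ^+ 2 * U <= B ->
  \int[tm]_(t in ball) dF c (s ^+ 2)%:C%C (s *+ 2)%:C%C t = 0.
Proof.
move=> BA sB.
have [->|s0] := eqVneq s 0.
  rewrite /Rintegral integral0_eq// => t _; congr EFin.
  by rewrite /dF mul0rn mulr0 !mul0r mulr0.
pose l (phi : R) := (s ^+ 2)%:C%C * cis phi.
(* The factor between the derivatives along the circle and along the radius. *)
pose c' := c * (0 +i* (- (2 / s)))%C.
have h : is_derive (0 : R) 1 (fun r => Phi c' (l r))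
    (\int[tm]_(t in ball) dF c' (l 0) ((s ^+ 2)%:C%C * ((0 +i* 1)%C * cis 0)) t).
  have l1 r : normc (l r) = s ^+ 2 by rewrite /l normcM normc_cis mulr1 normc_real ger0_norm ?sqr_ge0.
  apply: (@is_derive_Phi c' l (fun r => (s ^+ 2)%:C%C * ((0 +i* 1)%C * cis r)) 0 1 B (s ^+ 2)) => //.
  - by rewrite normr0.
  - move=> r _; apply: (cderive_eq (cderive_mul (cderive_cst (s ^+ 2)%:C%C r) (cderive_cis1 r))).
    by rewrite mul0r add0r.
  - by move=> r _; rewrite l1.
  - move=> r _; rewrite !normcM normc_cis normc_real ger0_norm ?sqr_ge0//=.
    by rewrite expr0n expr1n add0r sqrtr1 !mulr1.
have cE : (fun r => Phi c' (l r)) = cst (Phi c' (s ^+ 2)%:C%C).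
  by apply/funext => r; rewrite /l Phi_rotation.
have [_ E] := h; rewrite cE derive_cst in E.
rewrite E; apply: eq_Rintegral => t _.
have e : (s *+ 2)%:C%C = (0 +i* (- (2 / s)))%C * (s ^+ 2)%:C%C * (0 +i* 1)%C :> R[i].
  by apply/eqP; rewrite eq_complex /=; apply/andP; split; apply/eqP; field.
rewrite /dF /l cis0 !mulr1 /c' e.
have r4 (i1 x i2 y d : R[i]) :
  c * (N%:R * (i1 * x * i2) * y * d) = c * i1 * (N%:R * (x * i2) * y * d) by ring.
by rewrite r4.
Qed.

(** The mean of a holomorphic function of [u] over a ball is its value at 0:
  rotating the ball shows that the mean of [u * F' (l * u)] vanishes, which is
  the derivative of the mean of [F (l * u)] in [l]. *)
Lemma integral_ball_mean c :
  \int[tm]_(t in ball) Re (c * (A - u t)^-1 ^+ N) =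
  Re (c * A^-1 ^+ N) * (pi ^+ n / n`!%:R * v ^+ n).
Proof.
have [UB BA] := midf_lt UA; set B := (U + normc A) / 2 in UB BA.
have B1 : 1 < B / U by rewrite ltr_pdivlMr// mul1r.
have lo1 : `|1 : R| < Num.sqrt (B / U).
  by rewrite normr1 -[X in X < _]sqrtr1 ltr_sqrt// (lt_trans ltr01).
have lB r : `|r| < Num.sqrt (B / U) -> r ^+ 2 * U <= B.
  move=> rlo; rewrite -ler_pdivlMr// -real_normK ?num_real//.
  have BU0 : 0 <= B / U by rewrite ltW// (lt_trans ltr01).
  by rewrite -(sqr_sqrtr BU0) lerXn2r ?nnegrE ?sqrtr_ge0// ltW.
have der (s : R) : `|s| < Num.sqrt (B / U) ->
    is_derive s 1 (fun r => Phi c (r ^+ 2)%:C%C) 0.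
  move=> slo; rewrite -(integral_dF0 c BA (lB _ slo)).
  apply: (@is_derive_Phi c (fun r => (r ^+ 2)%:C%C) (fun r => (r *+ 2)%:C%C) s
    (Num.sqrt (B / U)) B (Num.sqrt (B / U) *+ 2)) => //.
  - move=> r _; apply: cderive_real; apply: (derive_eq (derive_exp 2 (is_derive_id r 1))).
    by rewrite expr1 mulr1 mulr_natl.
  - by move=> r rlo; rewrite normc_real ger0_norm ?sqr_ge0// lB.
  - by move=> r rlo; rewrite normc_real normrMn lerMn2r /= ltW.
(* The square keeps the multiplier nonnegative on a symmetric interval. *)
have E : Phi c (1 ^+ 2)%:C%C = Phi c (0 ^+ 2)%:C%C := derive0_cst der lo1.
have F1 t : Re (c * (A - u t)^-1 ^+ N) = F c (1 ^+ 2)%:C%C t.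
  by rewrite expr1n /F /D (rmorph1 (real_complex R)) mul1r.
have F0 t : F c (0 ^+ 2)%:C%C t = Re (c * A^-1 ^+ N).
  by rewrite expr2 mul0r /F /D (rmorph0 (real_complex R)) mul0r subr0.
transitivity (Phi c (1 ^+ 2)%:C%C); first by apply: eq_Rintegral => t _; exact: F1.
rewrite E; transitivity (\int[tm]_(t in ball) (Re (c * A^-1 ^+ N))).
  by apply: eq_Rintegral => t _; exact: F0.
by rewrite /Rintegral integral_ball_cst.
Qed.

Lemma integrable_ball_mean c :
  tm.-integrable ball (EFin \o (fun t => Re (c * (A - u t)^-1 ^+ N))).
Proof.
apply: (integrable_ball (k := normc c * (normc A - U)^-1 ^+ N)).
  rewrite (_ : (fun t => _) = F c 1); first exact: mF.
  by apply/funext => t; rewrite /F /D mul1r.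
move=> t bt; have := @F_le c 1 t U UA; rewrite /F /D mul1r; apply => //.
by rewrite ComplexField.Normc.normc1 mul1r.
Qed.

End mean_value.

(** * Integrals over the Siegel upper half-space in polar coordinates *)

Section slices.
Context {R : realType}.
Local Notation mu := (@lebesgue_measure R).
Local Notation pos := (`]0, +oo[%classic : set (measurableTypeR R)).

Lemma integral_affine_signed (a b : R) (f : R -> \bar R) : 0 < a ->
  measurable_fun [set: R] f ->
  (\int[mu]_x f x = a%:E * \int[mu]_x f (a * x + b)%R)%E.
Proof.
move=> a0 mf; rewrite integralE [X in (_ * X)%E]integralE.
have mp := measurable_funepos mf; have mn := measurable_funeneg mf.
rewrite (integral_affine b a0 mp); last by move=> t; exact: funepos_ge0.
rewrite (integral_affine b a0 mn); last by move=> t; exact: funeneg_ge0.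
have -> : (\int[mu]_x (fun x => f (a * x + b)%R)^\+ x = \int[mu]_x f^\+ (a * x + b)%R)%E.
  by apply: eq_integral => x _; rewrite !funeposE.
have -> : (\int[mu]_x (fun x => f (a * x + b)%R)^\- x = \int[mu]_x f^\- (a * x + b)%R)%E.
  by apply: eq_integral => x _; rewrite !funenegE.
have X0 : (0 <= \int[mu]_x f^\+ (a * x + b)%R)%E by apply: integral_ge0 => x _; exact: funepos_ge0.
have Y0 : (0 <= \int[mu]_x f^\- (a * x + b)%R)%E by apply: integral_ge0 => x _; exact: funeneg_ge0.
move: (integral _ _ _) (integral _ _ _) X0 Y0 => [x| |] [y| |] //= _ _;
  rewrite ?gt0_muley ?lte_fin// -?EFinM -?EFinN -?EFinD -?EFinM ?mulrBr//.
- by rewrite gt0_muleNy ?lte_fin.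
- by rewrite /= gt0_muleNy ?lte_fin.
Qed.

(** Monotone convergence, in the form of an approximation from below. *)
Lemma exists_integral_ge d (T : measurableType d) (m : {measure set T -> \bar R})
    (D : nat -> set T) (f : T -> R) (l e : R) :
  nondecreasing_seq D -> (forall k, measurable (D k)) -> 0 < e ->
  measurable_fun setT f -> (forall x, 0 <= f x) ->
  (\int[m]_(x in \bigcup_k D k) (f x)%:E = l%:E)%E ->
  exists k, ((l - e)%:E <= \int[m]_(x in D k) (f x)%:E)%E.
Proof.
move=> nD mD e0 mf f0 fl.
have mfk k : measurable_fun (D k) (fun x => (f x)%:E).
  by apply/measurable_EFinP; exact: measurable_funTS.
have f0k k x : D k x -> (0 <= (f x)%:E)%E by rewrite lee_fin.
have h := ge0_nondecreasing_set_cvg_integral (mu := m) nD mD mfk f0k.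
rewrite fl in h.
apply: contrapT => /forallNP H.
have : (l%:E <= (l - e)%:E)%E.
  apply: (cvge_le _ h); near=> k.
  by have /negP := H k; rewrite -ltNge => /ltW.
by rewrite lee_fin leNgt ltrBlDr ltrDl e0.
Unshelve. all: by end_near. 
Qed.

Lemma normc_direction (t : R) : normc (direction t) = 1.
Proof.
apply/eqP; rewrite -(eqrXn2 (_ : 0 < 2)%N) ?normc_ge0//; apply/eqP.
rewrite normcE2 /direction /= exprMn sqr_cosa expr1n.
have t0 : 1 + t ^+ 2 != 0 by rewrite gt_eqF// ltr_pwDl ?sqr_ge0.
by field.
Qed.

Lemma Re_polar (t x : R) : Re (polar (t, x)) = x * (cosa t * t).
Proof. by rewrite /polar ReMr. Qed.

Lemma Im_polar (t x : R) : Im (polar (t, x)) = x * cosa t.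
Proof. by rewrite /polar ImMr. Qed.

Lemma normc_polar (t x : R) : 0 < x -> normc (polar (t, x)) = x.
Proof. by move=> x0; rewrite /polar normcM normc_real normc_direction mulr1 gtr0_norm. Qed.

Variable n : nat.
Local Notation tm := (tuple_measure (@lebesgueC R) n).
Local Notation ball v := [set t : n.-tuple R[i] | sqnorm t < v].

(** The slice of the domain at [w.2] is a ball; the integral over it is taken
  first, and [w.2] is then written in polar coordinates. *)
Lemma integral_siegel_slices (H : @Cn1 R n -> R) (h : R[i] -> R) :
  measurable_fun setT H -> measurable_fun setT h ->
  (forall w, siegel w -> 0 <= H w) ->
  (forall w : R[i], 0 < Im w ->
    (\int[tm]_(t in ball (Im w)) (H (t, w))%:E = (h w)%:E)%E) ->
  (\int[dV n]_(w in @siegel R n) (H w)%:E =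
   \int[mu]_t \int[mu]_x (pos_indic x * (x * cosa t ^+ 2 * h (polar (t, x))))%:E)%E.
Proof.
move=> mH mh H0 Hh.
have mHE : measurable_fun setT ((fun w => (H w)%:E) \_ (@siegel R n)).
  apply/(measurable_restrictT _ (@measurable_siegel R n)); apply: measurable_funTS.
  exact/measurable_EFinP.
have HE0 w : (0 <= ((fun w => (H w)%:E) \_ (@siegel R n)) w)%E.
  by rewrite patchE; case: ifPn => // /set_mem/H0; rewrite lee_fin.
rewrite integral_mkcond (integral_dV mHE HE0).
pose k (w : R[i]) := pos_indic (Im w) * h w.
have h0 w : 0 < Im w -> 0 <= h w.
  move=> w0; rewrite -lee_fin -(Hh w w0); apply: integral_ge0 => t tw.
  by rewrite lee_fin; apply: H0.
have k0 w : (0 <= (k w)%:E)%E.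
  rewrite lee_fin /k; have [w0|w0] := ltP 0 (Im w); first by rewrite mulr_ge0 ?h0.
  by rewrite (_ : pos_indic _ = 0) ?mul0r// /pos_indic ltNge w0.
have mk : measurable_fun [set: R[i]] (fun w => (k w)%:E).
  apply/measurable_EFinP; apply: measurable_funM => //.
  exact: (measurableT_comp measurable_pos_indic measurable_Im).
transitivity (\int[lebesgueC]_(w in [set w : R[i] | (0 < Im w)%R]) (k w)%:E)%E.
  rewrite [RHS]integral_mkcond; apply: eq_integral => w _; rewrite patchE.
  case: ifPn => [/set_mem/= w0|w0].
    rewrite /k /pos_indic w0 mul1r -Hh// [RHS]integral_mkcond.
    apply: eq_integral => t _; rewrite !patchE.
    by congr (if _ then _ else _); apply/idP/idP => /set_mem tS; exact/mem_set.
  apply: integral0_eq => t _; rewrite patchE ifN//; apply/negP => /set_mem tS.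
  move/negP: w0; apply; apply/mem_set => /=.
  by rewrite (le_lt_trans _ tS)// sumr_ge0// => j _; rewrite sqr_ge0.
rewrite (integral_polar mk k0); apply: eq_integral => t _; apply: eq_integral => x _.
rewrite -EFinM; congr EFin; rewrite /jacobian /k Im_polar /=.
have [x0|x0] := ltP 0 x.
  rewrite (_ : pos_indic (x * cosa t) = 1); last by rewrite /pos_indic mulr_gt0 ?cosa_gt0.
  by rewrite (_ : pos_indic x = 1) ?mul1r// /pos_indic x0.
by rewrite (_ : pos_indic x = 0) ?mul0r// /pos_indic ltNge x0.
Qed.

Lemma integral_siegel_radial (psi : R[i] -> R) :
  measurable_fun setT psi -> (forall w, 0 <= psi w) ->
  (\int[dV n]_(w in @siegel R n) (psi w.2)%:E =
   \int[mu]_t \int[mu]_x (pos_indic x * (pi ^+ n / n`!%:R * (x ^+ n.+1 * cosa t ^+ n.+2) *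
     psi (polar (t, x))))%:E)%E.
Proof.
move=> mpsi psi0.
have mP : measurable_fun setT (fun w : @Cn1 R n => psi w.2).
  by apply: (measurableT_comp mpsi); exact: measurable_snd.
have mh : measurable_fun setT (fun w : R[i] => psi w * (pi ^+ n / n`!%:R * Im w ^+ n)).
  apply: measurable_funM => //; apply: measurable_funM => //.
  by apply: measurable_funX; exact: measurable_Im.
rewrite (integral_siegel_slices mP mh); last 2 first.
- by move=> w _; exact: psi0.
- by move=> w w0; exact: (integral_ball_cst n w0 (psi w)).
apply: eq_integral => t _; apply: eq_integral => x _; congr EFin; congr (_ * _).
by rewrite Im_polar exprMn !exprS; ring.
Qed.

Definition itv_indic (s t x : R) : R := ((s <= x) && (x <= t))%R%:R.

Lemma itv_indicE s t : itv_indic s t = \1_(`[s, t]%classic : set R).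
Proof. by apply/funext => x; rewrite indicE mem_setE/= in_itv. Qed.

Lemma itv_indic_le1 s t x : itv_indic s t x <= 1. Proof. by rewrite /itv_indic; case: (_ && _). Qed.

Lemma measurable_itv_indic s t : measurable_fun [set: R] (itv_indic s t).
Proof. by rewrite itv_indicE; apply: measurable_indic; exact: measurable_itv. Qed.

Lemma integral_itv_indic s t (f : R -> R) :
  (\int[mu]_x (itv_indic s t x * f x)%:E = \int[mu]_(x in `[s, t]) (f x)%:E)%E.
Proof.
rewrite [RHS]integral_mkcond; apply: eq_integral => x _.
rewrite patchE mem_setE/= in_itv /itv_indic.
by case: (_ && _); rewrite ?mul1r// mul0r.
Qed.

Lemma integral_itv_inv (s t : R) : 0 < s -> s < t ->
  (\int[mu]_x (itv_indic s t x * x^-1)%:E = (ln t - ln s)%:E)%E.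
Proof.
move=> s0 st; rewrite integral_itv_indic.
have dl (x : R) : 0 < x -> is_derive x 1 (@ln R) x^-1 by exact: is_derive1_ln.
have cl (x : R) : 0 < x -> {for x, continuous (@ln R)}.
  move=> x0; apply: differentiable_continuous; apply/derivable1_diffP.
  by have [] := dl x x0.
rewrite (@continuous_FTC2 R (fun x => x^-1) (@ln R) s t st)//.
- apply: continuous_in_subspaceT => x /set_mem; rewrite /= in_itv/= => /andP[h _].
  by apply: inv_continuous; rewrite gt_eqF// (lt_le_trans s0 h).
- split.
  + move=> x; rewrite in_itv/= => /andP[h _].
    by have [] := dl x (lt_trans s0 h).
  + by apply: cvg_at_right_filter; exact: cl.
  + by apply: cvg_at_left_filter; apply: cl; exact: lt_trans st.
- move=> x; rewrite in_itv/= => /andP[h _].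
  by rewrite derive1E; have [_ ->] := dl x (lt_trans s0 h).
Qed.

End slices.

(** * The lower bound *)

Section lower_bound.
Context {R : realType}.
Local Notation mu := (@lebesgue_measure R).
Local Notation pos := (`]0, +oo[%classic : set (measurableTypeR R)).

Lemma polar_repr (w : R[i]) : 0 < Im w -> w = polar (Re w / Im w, normc w).
Proof.
move=> w0; set t := Re w / Im w.
have e : normc w * cosa t = Im w.
  apply/eqP; rewrite -(eqrXn2 (_ : 0 < 2)%N) ?mulr_ge0 ?normc_ge0 ?(ltW w0) ?(ltW (cosa_gt0 _))//.
  apply/eqP; rewrite exprMn normcE2 sqr_cosa /t.
  have h : Im w ^+ 2 + Re w ^+ 2 != 0 by rewrite gt_eqF// ltr_pwDl ?sqr_ge0// exprn_gt0.
  by field; rewrite h gt_eqF.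
have w1 : Im w != 0 by rewrite gt_eqF.
apply/eqP; rewrite eq_complex Re_polar Im_polar mulrA e /t.
by rewrite mulrC divfK// !eqxx.
Qed.

Lemma normc_sum (I : Type) (s : seq I) (F : I -> R[i]) :
  normc (\sum_(i <- s) F i) <= \sum_(i <- s) normc (F i).
Proof.
elim/big_rec2: _ => [|i x y _ h]; first by rewrite ComplexField.Normc.normc0.
by rewrite (le_trans (le_normcD _ _))// lerD2l.
Qed.

Lemma normc_conj (z : R[i]) : normc z^* = normc z.
Proof. by case: z => a b; rewrite /= sqrrN. Qed.

Lemma itv_indic_inv_ge0 (s S x : R) : 0 < s -> 0 <= itv_indic s S x * x^-1.
Proof.
move=> s0; rewrite /itv_indic; case: (boolP ((s <= x) && (x <= S))) => [/andP[h _]|_].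
  by rewrite mul1r invr_ge0 (le_trans (ltW s0) h).
by rewrite mul0r.
Qed.

Variable n : nat.
Local Notation tm := (tuple_measure (@lebesgueC R) n).
Local Notation ball v := [set t : n.-tuple R[i] | sqnorm t < v].
Implicit Types z : @Cn1 R n.

Lemma normc_hdot_le z (w : @Cn1 R n) : normc (hdot z w) <= (sqnorm z.1 + sqnorm w.1) / 2.
Proof.
rewrite (le_trans (normc_sum _ _))// -big_split mulr_suml; apply: ler_sum => j _.
rewrite normcM normc_conj ler_pdivlMr// -subr_ge0.
by rewrite (_ : _ - _ = (normc (tnth z.1 j) - normc (tnth w.1 j)) ^+ 2) ?sqr_ge0//=; ring.
Qed.

(** The value of [rho z] at the centre of the ball of all [w.1] lying over a given
  [w.2]. *)
Definition kernel_center z (w : R[i]) : R[i] := 'i / 2 * (w^* - z.2).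

Lemma Re_kernel_center z (w : R[i]) : Re (kernel_center z w) = (Im z.2 + Im w) / 2.
Proof. by rewrite /kernel_center half_imag; case: (z.2) w => a b [c e] /=; field. Qed.

(** The mean value property, with a constant [g] added that will make the integrand
  nonnegative on the whole domain. *)
Lemma integral_kernel_slice z (c w : R[i]) (g : R) : siegel z -> 0 < Im w ->
  (\int[tm]_(t in ball (Im w)) (Re (c * (rho z (t, w))^-1 ^+ n.+2) + g)%:E =
   ((Re (c * (kernel_center z w)^-1 ^+ n.+2) + g) * (pi ^+ n / n`!%:R * Im w ^+ n))%:E)%E.
Proof.
move=> /siegelP z0 w0.
pose u t := hdot z (t, 0).
have mu' : measurable_fun setT u.
  apply: measurable_fun_sumC => j; apply: measurable_funMC; first exact: measurable_cst.
  by apply: measurable_fun_conjC; exact: measurable_tnth.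
pose U := (sqnorm z.1 + Im w) / 2.
have U0 : 0 < U by rewrite divr_gt0// ltr_wpDl// sqnorm_ge0.
have UA : U < normc (kernel_center z w).
  rewrite (lt_le_trans _ (normc_ge_Re _))// (lt_le_trans _ (ler_norm _))//.
  by rewrite Re_kernel_center ltr_pM2r// ltrD2r -subr_gt0.
have us s t : u (scale_tuple s t) = s^* * u t.
  rewrite /u /hdot mulr_sumr; apply: eq_bigr => j _ /=.
  by rewrite tnth_map rmorphM mulrCA.
have uU t : ball (Im w) t -> normc (u t) <= U.
  move=> tw; rewrite (le_trans (normc_hdot_le _ _))// ler_pM2r// lerD2l.
  exact: ltW.
have i1 := integrable_ball_mean n.+2 mu' w0 UA uU c.
have mB := @measurable_ball R n (Im w).
have i2 : tm.-integrable (ball (Im w)) (EFin \o cst g).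
  apply: (integrable_ball w0 (k := `|g|)); first exact: measurable_cst.
  by move=> t _.
pose F t := Re (c * (kernel_center z w - u t)^-1 ^+ n.+2).
transitivity (\int[tm]_(t in ball (Im w)) ((EFin \o F) t + (EFin \o cst g) t))%E.
  by apply: eq_integral.
rewrite (integralD mB i1 i2) (integral_ball_cst n w0 g).
rewrite -(fineK (integrable_fin_num mB i1)).
rewrite -[fine _]/(\int[tm]_(t in ball (Im w)) F t).
have hm : \int[tm]_(t in ball (Im w)) F t = _ := integral_ball_mean n.+2 mu' w0 U0 UA us uU c.
by rewrite hm -EFinD mulrDl.
Qed.

(** In polar coordinates, and up to a factor independent of [t] and [x], the kernel
  at the centre is the denominator of [rotated] for the sum of the two angles. *)
Lemma kernel_center_polar (z : @Cn1 R n) (t x t' r : R) : 0 < r -> z.2 = polar (t', r) ->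
  kernel_center z (polar (t, x)) =
  (r / 2)%:C%C * cis (- atan t') * (1 + (x / r)%:C%C * cis (atan t + atan t')).
Proof.
move=> r0 zE; rewrite mulrDr mulr1 mulrACA -(rmorphM (real_complex R)) -cisD.
rewrite [- _ + _]addrC addrK (_ : r / 2 * (x / r) = x / 2); last by field; rewrite gt_eqF.
rewrite /kernel_center half_imag zE /polar /direction /cis cosN sinN.
rewrite !sin_atan -!cosa_cos.
by apply/eqP; rewrite eq_complex /=; apply/andP; split; apply/eqP; field.
Qed.

Variables (p q : R).
Hypotheses (p1 : 1 < p) (qE : q = p / (p - 1)).

Let p0 : 0 < p. Proof. exact: lt_trans p1. Qed.

Let q0 : 0 < q. Proof. by rewrite qE divr_gt0// subr_gt0. Qed.

Let pq : p^-1 + q^-1 = 1.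
Proof. by rewrite qE; field; rewrite !gt_eqF// subr_gt0. Qed.

Let k := n.+2%:R / p.
Let a := n.+2%:R / q.

Let k0 : 0 < k. Proof. by rewrite divr_gt0. Qed.

Let a0 : 0 < a. Proof. by rewrite divr_gt0. Qed.

Let ak : a + k = n.+2%:R. Proof. by rewrite -mulrDr addrC pq mulr1. Qed.

Let aN : a < n.+2%:R. Proof. by rewrite -ak ltrDl. Qed.

Let test_radial (S : R) (w : R[i]) : R := itv_indic 1 S (normc w) * normc w `^ (- k).

(** The phase is the one that the Beta integral acquires along a rotated ray. *)
Let test (S : R) (w : R[i]) : R[i] :=
  (test_radial S w)%:C%C * cis (a * atan (Re w / Im w)).

Let psi (S : R) (w : R[i]) : R := test_radial S w `^ p.

Let mnormc : measurable_fun [set: R[i]] (fun w : R[i] => normc w).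
Proof. exact: (@measurable_normc R _ R[i] id (@measurable_id _ _ _)). Qed.

Let mslope : measurable_fun [set: R[i]] (fun w : R[i] => Re w / Im w).
Proof.
apply: measurable_funM; first exact: measurable_Re.
by apply: measurable_funVr; exact: measurable_Im.
Qed.

Let mradial S : measurable_fun [set: R[i]] (test_radial S).
Proof.
apply: measurable_funM; first exact: (measurableT_comp (measurable_itv_indic 1 S) mnormc).
exact: (measurableT_comp (measurable_powR (- k)) mnormc).
Qed.

Let radial_ge0 S w : 0 <= test_radial S w.
Proof. by rewrite mulr_ge0 ?powR_ge0. Qed.

Let mtest S : measurable_fun [set: R[i]] (test S).
Proof.
apply: measurable_funMC; first exact: measurable_fun_realC.
have ma : measurable_fun [set: R[i]] (fun w : R[i] => a * atan (Re w / Im w)).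
  apply: measurable_funM => //.
  exact: (measurableT_comp (continuous_measurable_fun (@continuous_atan R)) mslope).
apply: measurable_funC.
  exact: (measurableT_comp (continuous_measurable_fun (@continuous_cos R)) ma).
exact: (measurableT_comp (continuous_measurable_fun (@continuous_sin R)) ma).
Qed.

Let normc_test S w : normc (test S w) = test_radial S w.
Proof. by rewrite normcM normc_cis mulr1 normc_real ger0_norm. Qed.

Let mpsi S : measurable_fun [set: R[i]] (psi S).
Proof. exact: (measurableT_comp (measurable_powR p) (mradial S)). Qed.

Let psi_ge0 S w : 0 <= psi S w. Proof. exact: powR_ge0. Qed.

Let slope_polar (t x : R) : 0 < x -> Re (polar (t, x)) / Im (polar (t, x)) = t.
Proof.
move=> x0; rewrite Re_polar Im_polar; field.
by rewrite !gt_eqF// cosa_gt0.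
Qed.

Let test_polar S (t x : R) : 0 < x ->
  test S (polar (t, x)) = (itv_indic 1 S x * x `^ (- k))%:C%C * cis (a * atan t).
Proof. by move=> x0; rewrite /test slope_polar// /test_radial normc_polar. Qed.

Let psi_polar S (t x : R) : 0 < x ->
  psi S (polar (t, x)) = itv_indic 1 S x * x^-1 ^+ n.+2.
Proof.
move=> x0; rewrite /psi /test_radial normc_polar// powRM ?powR_ge0// -powRrM mulNr.
rewrite divfK ?gt_eqF// powRN powR_mulrn ?(ltW x0)// exprVn; congr (_ * _).
by rewrite /itv_indic; case: (_ && _); rewrite ?powR1 ?powR0// gt_eqF.
Qed.

Let b (x : R) : R := x `^ (a - 1) * (1 + x) `^ (- n.+2%:R).

Let B : R := \int[mu]_(x in pos) b x.

Let ib : mu.-integrable pos (EFin \o b).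
Proof. exact: integrable_beta. Qed.

Let BE : B = Gamma a * Gamma k / n.+1`!%:R.
Proof.
have h := GammaM a0 k0 ak.
rewrite (_ : (\int[mu]_(x in pos) _)%E = B%:E) in h.
  have f0 : n.+1`!%:R != 0 :> R by rewrite pnatr_eq0 -lt0n fact_gt0.
  by apply: (mulIf f0); rewrite divfK//; move: h; rewrite -EFinM => -[->]; rewrite [RHS]mulrC.
rewrite /B /Rintegral fineK; last exact: (integrable_fin_num measurable_pos ib).
apply: eq_integral => x /set_mem/posP x0; congr EFin.
by rewrite /b powRN powR_mulrn ?exprVn// addr_ge0// ltW.
Qed.

(** The supremum of the ratio between the rotated and the straight integrands for
  the angles that occur when the slope of [z.2] is at most [T]. *)
Let angle_const (T : R) : R := (Num.sqrt ((1 + cos (pi / 2 + atan T)) / 2))^-1 ^+ n.+2.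

(** The full rotated integral is [B] for every angle; truncating it to a range that
  contains [[1 / M, M]] costs at most [angle_const T] times the tail of the
  straight integral. *)
Let rotated_itv_ge (t t' T s S M : R) : `|t'| <= T -> s <= M^-1 -> M <= S ->
  ((B - angle_const T * (B - \int[mu]_(x in pos) (itv_indic M^-1 M x * b x)))%:E <=
   \int[mu]_(x in pos) (itv_indic s S x * Re (rotated a n.+2 (atan t + atan t') x))%:E)%E.
Proof.
move=> tT sM MS; set th := atan t + atan t'.
pose u : R := pi / 2 + atan T.
have aT : `|atan t'| <= atan T.
  by rewrite ler_norml; move: tT; rewrite ler_norml => /andP[h1 h2]; rewrite -atanN !le_atan// h1.
have upi : u < pi.
  by rewrite /u -ltrBrDl (_ : pi - pi / 2 = pi / 2) ?atan_ltpi2//; field.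
have thu : `|th| < u.
  rewrite (le_lt_trans (ler_normD _ _))// ltr_leD// ltr_norml.
  by rewrite atan_gtNpi2 atan_ltpi2.
have u0 : 0 < u by rewrite (le_lt_trans (normr_ge0 th)).
have nle x : 0 < x -> `|Re (rotated a n.+2 th x)| <= angle_const T * b x.
  by move=> x0; rewrite (le_trans (normc_ge_Re _))//; exact: (normc_rotated_le a n.+2 u0 upi thu x0).
have ir := integrable_rotated a0 aN 1 (lt_trans thu upi).
have ir' : mu.-integrable pos (EFin \o (fun x => Re (rotated a n.+2 th x))).
  by apply: eq_integrable ir => [|x _ /=]; [exact: measurable_pos|rewrite mul1r].
have mre : measurable_fun [set: R] (fun x => Re (rotated a n.+2 th x)).
  by apply: measurable_ReC; exact: measurable_rotated.
have mb : measurable_fun [set: R] b.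
  by apply: measurable_funM; [exact: measurable_powR_in|exact: measurable_powRD_in].
have b0 x : 0 <= b x by rewrite mulr_ge0 ?powR_ge0.
have i1 : mu.-integrable pos (EFin \o (fun x => itv_indic s S x * Re (rotated a n.+2 th x))).
  apply: (integrable_pos_le (g := fun x => angle_const T * b x)).
  - by apply: measurable_funTS; apply: measurable_funM => //; exact: measurable_itv_indic.
  - exact: (integrableZl measurable_pos _ ib).
  - move=> x x0; rewrite normrM ger0_norm// (le_trans _ (nle x x0))//.
    by rewrite ler_piMl// itv_indic_le1.
have i2 : mu.-integrable pos (EFin \o (fun x => itv_indic M^-1 M x * b x)).
  apply: (integrable_pos_le (g := b)) => //.
  - by apply: measurable_funTS; apply: measurable_funM => //; exact: measurable_itv_indic.
  - by move=> x x0; rewrite normrM !ger0_norm// ler_piMl// itv_indic_le1.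
have i3 := integrableB measurable_pos ib i2.
have i4 := integrableZl measurable_pos (angle_const T) i3.
have hB : \int[mu]_(x in pos) Re (rotated a n.+2 th x) = B.
  have := integral_rotated a0 aN 1 (lt_trans thu upi); rewrite mul1r => E.
  apply: etrans (etrans E _).
    by apply: eq_Rintegral => x _; rewrite mul1r.
  apply: eq_Rintegral => x /set_mem/posP x0.
  by rewrite /b powRN powR_mulrn ?exprVn// addr_ge0// ltW.
rewrite -(fineK (integrable_fin_num measurable_pos i1)) lee_fin.
rewrite -[fine _]/(\int[mu]_(x in pos) (itv_indic s S x * Re (rotated a n.+2 th x))).
rewrite lerBlDr -{1}hB -(RintegralB measurable_pos ib i2) -(RintegralZl _ measurable_pos i3).
rewrite -(RintegralD measurable_pos i1 i4).
apply: (le_Rintegral measurable_pos ir' (integrableD measurable_pos i1 i4)) => x /posP x0.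
rewrite /itv_indic; have [hx|hx] := boolP ((s <= x) && (x <= S)).
  rewrite mul1r lerDl mulr_ge0 ?exprn_ge0 ?invr_ge0 ?sqrtr_ge0//.
  by case: (_ && _); rewrite ?mul1r ?mul0r ?subrr ?subr0.
rewrite mul0r add0r (_ : (_ && _) = false); last first.
  apply/negbTE; apply: contra hx => /andP[h1 h2].
  by rewrite (le_trans sM h1) (le_trans h2 MS).
by rewrite mul0r subr0 (le_trans (ler_norm _))// nle.
Qed.

Let m : R := pi ^+ n / n`!%:R.

Let m0 : 0 < m.
Proof. by rewrite divr_gt0 ?exprn_gt0 ?pi_gt0// ltr0n fact_gt0. Qed.

(** In polar coordinates the radial integrand is [1 / x], whence the logarithm. *)
Let integral_psi_itv (s S T : R) : 0 < s -> s < S ->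
  (\int[dV n]_(w in @siegel R n)
     (itv_indic s S (normc w.2) * itv_indic (- T) T (Re w.2 / Im w.2) *
      (normc w.2)^-1 ^+ n.+2)%:E =
   (m * (ln S - ln s))%:E * \int[mu]_(t in `[(- T)%R, T]) (cosa t ^+ n.+2)%:E)%E.
Proof.
move=> s0 sS.
rewrite (integral_siegel_radial n (psi := fun w => itv_indic s S (normc w) *
  itv_indic (- T) T (Re w / Im w) * (normc w)^-1 ^+ n.+2)); last 2 first.
- apply: measurable_funM; last by apply: measurable_funX; exact: measurable_funVr.
  apply: measurable_funM; first exact: (measurableT_comp (measurable_itv_indic s S) mnormc).
  exact: (measurableT_comp (measurable_itv_indic (- T) T) mslope).
- move=> w; apply: mulr_ge0; first exact: mulr_ge0.
  by apply: exprn_ge0; rewrite invr_ge0; exact: normc_ge0.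
rewrite -integral_itv_indic.
have mc : measurable_fun [set: R] (fun t => itv_indic (- T) T t * cosa t ^+ n.+2).
  by apply: measurable_funM; [exact: measurable_itv_indic|apply: measurable_funX; exact: measurable_cosa].
have c0 t : 0 <= itv_indic (- T) T t * cosa t ^+ n.+2.
  by rewrite mulr_ge0// exprn_ge0// ltW// cosa_gt0.
have ls0 : 0 <= m * (ln S - ln s).
  by rewrite mulr_ge0 ?(ltW m0)// subr_ge0 ler_ln ?posrE ?(ltW sS)// (lt_trans s0).
rewrite -(ge0_integral_EFinZl mu ls0 mc c0); apply: eq_integral => t _.
have mi : measurable_fun [set: R] (fun x => itv_indic s S x * x^-1).
  by apply: measurable_funM; [exact: measurable_itv_indic|exact: measurable_funVr].
have i0 x : 0 <= itv_indic s S x * x^-1.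
  exact: itv_indic_inv_ge0.
have c1 : 0 <= m * (itv_indic (- T) T t * cosa t ^+ n.+2) by rewrite mulr_ge0 ?(ltW m0).
rewrite (_ : m * (ln S - ln s) * (itv_indic (- T) T t * cosa t ^+ n.+2) =
   m * (itv_indic (- T) T t * cosa t ^+ n.+2) * (ln S - ln s)); last by ring.
rewrite [RHS]EFinM -(integral_itv_inv s0 sS) -(ge0_integral_EFinZl mu c1 mi i0).
apply: eq_integral => x _; congr EFin; have [x0|x0] := ltP 0 x; last first.
  rewrite (_ : pos_indic x = 0); last by rewrite /pos_indic ltNge x0.
  rewrite (_ : itv_indic s S x = 0) ?mul0r ?mulr0//.
  by rewrite /itv_indic leNgt (le_lt_trans x0 s0).
rewrite (_ : pos_indic x = 1); last by rewrite /pos_indic x0.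
rewrite normc_polar// slope_polar// mul1r /m.
have -> : x^-1 ^+ n.+2 = x^-1 ^+ n.+1 * x^-1 by rewrite exprSr.
have xx : x ^+ n.+1 * x^-1 ^+ n.+1 = 1 by rewrite -exprMn divff ?expr1n// gt_eqF.
rewrite -[RHS]mulr1 -xx; ring.
Qed.

Let integral_psi (S : R) : 1 < S ->
  (\int[dV n]_(w in @siegel R n) (psi S w.2)%:E = (m * ln S * wallis n)%:E)%E.
Proof.
move=> S1; rewrite (integral_siegel_radial n (mpsi S) (psi_ge0 S)).
have mc : measurable_fun [set: R] (fun t : R => cosa t ^+ n.+2).
  by apply: measurable_funX; exact: measurable_cosa.
have c0 t : 0 <= (cosa t : R) ^+ n.+2 by rewrite exprn_ge0// ltW// cosa_gt0.
have ls0 : 0 <= m * ln S by rewrite mulr_ge0 ?(ltW m0)// ln_ge0// ltW.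
rewrite EFinM -integral_cosa -(ge0_integral_EFinZl mu ls0 mc c0); apply: eq_integral => t _.
have mi : measurable_fun [set: R] (fun x => itv_indic 1 S x * x^-1).
  by apply: measurable_funM; [exact: measurable_itv_indic|exact: measurable_funVr].
have i0 x : 0 <= itv_indic 1 S x * x^-1.
  exact: itv_indic_inv_ge0.
have c1 : 0 <= m * cosa t ^+ n.+2 by rewrite mulr_ge0 ?(ltW m0).
rewrite (_ : m * ln S * cosa t ^+ n.+2 = m * cosa t ^+ n.+2 * (ln S - ln 1)); last first.
  by rewrite ln1 subr0; ring.
rewrite [RHS]EFinM -(integral_itv_inv ltr01 S1) -(ge0_integral_EFinZl mu c1 mi i0).
apply: eq_integral => x _; congr EFin; have [x0|x0] := ltP 0 x; last first.
  rewrite (_ : pos_indic x = 0); last by rewrite /pos_indic ltNge x0.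
  rewrite (_ : itv_indic 1 S x = 0) ?mul0r ?mulr0//.
  by rewrite /itv_indic leNgt (le_lt_trans x0 ltr01).
rewrite (_ : pos_indic x = 1); last by rewrite /pos_indic x0.
rewrite psi_polar// mul1r /m.
have -> : x^-1 ^+ n.+2 = x^-1 ^+ n.+1 * x^-1 by rewrite exprSr.
have xx : x ^+ n.+1 * x^-1 ^+ n.+1 = 1 by rewrite -exprMn divff ?expr1n// gt_eqF.
rewrite -[RHS]mulr1 -xx; ring.
Qed.

Let radial_le_psi (S : R) (w : R[i]) : test_radial S w <= S ^+ n.+2 * psi S w.
Proof.
rewrite /psi /test_radial /itv_indic.
case: (boolP (1 <= normc w <= S)) => [/andP[h1 h2]|_]; last first.
  by rewrite !mul0r powR0 ?mulr0// gt_eqF.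
have x0 : 0 < normc w by exact: lt_le_trans h1.
rewrite !mul1r -powRrM mulNr divfK ?gt_eqF// !powRN powR_mulrn ?(ltW x0)//.
rewrite (@le_trans _ _ 1)//.
  rewrite invf_le1 ?powR_gt0// -[leLHS](powRr0 (normc w)).
  by rewrite ler_powR// ltW.
by rewrite ler_pdivlMr ?exprn_gt0// mul1r lerXn2r// ?nnegrE ?(ltW x0)// (le_trans (ltW x0)).
Qed.

Let c0 : R := n.+1`!%:R / (4 * pi ^+ n.+1).

(** For each ray the integral is bounded below by [rotated_itv_ge], uniformly in
  the ray; integrating over the rays gives [wallis n]. *)
Let projection_ge (S M T eta : R) (z : @Cn1 R n) (t' r : R) : siegel z ->
  z.2 = polar (t', r) -> `|t'| <= T -> 0 < M -> M <= r -> r * M <= S -> 1 < S -> 1 <= M ->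
  0 <= eta ->
  eta * B <= B - angle_const T * (B - \int[mu]_(x in pos) (itv_indic M^-1 M x * b x)) ->
  c0 * m * 2 ^+ n.+2 * wallis n * B * eta * r `^ (- k) <=
  normc (bergman_projection (fun w : @Cn1 R n => test S w.2) z).
Proof.
move=> Sz zE tT M0 Mr rS S1 M1 eta0 hB.
have r0 : 0 < r by exact: lt_le_trans Mr.
have hz : 0 < height z by exact/siegelP.
have mS := @measurable_siegel R n.
have mf : measurable_fun setT (fun w : @Cn1 R n => test S w.2).
  by apply: (measurableT_comp (mtest S)); exact: measurable_snd.
pose kerf (w : @Cn1 R n) := rho z w ^- n.+2 * test S w.2.
have mkerf : measurable_fun setT kerf.
  apply: measurable_funMC => //; apply: measurable_funVC; apply: measurable_funXC.
  exact: (measurable_fun_pair2 z (@measurable_rho _ _)).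
(* The main term of the projection is positive after multiplication by [c]. *)
pose c := cis (- (k * atan t')).
pose D := (height z / 2)^-1 ^+ n.+2 * S ^+ n.+2.
have hz2 : 0 < height z / 2 by rewrite divr_gt0.
have S0 : 0 <= S by rewrite ltW// (lt_trans ltr01).
have D0 : 0 <= D by apply: mulr_ge0; apply: exprn_ge0 => //; rewrite invr_ge0 ltW.
have bound (A w : R[i]) : height z / 2 <= Re A -> normc (A^-1 ^+ n.+2 * test S w) <= D * psi S w.
  move=> hA; rewrite normcM normc_test normcX normcV /D -mulrA.
  have A0 : height z / 2 <= normc A by rewrite (le_trans hA)// (le_trans (ler_norm _))// normc_ge_Re.
  apply: ler_pM => //; first by apply: exprn_ge0; rewrite invr_ge0 normc_ge0.
  by rewrite lerXn2r ?nnegrE ?invr_ge0 ?normc_ge0 ?(ltW hz2)// lef_pV2 ?posrE// (lt_le_trans hz2).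
have kerf_le w : siegel w -> normc (kerf w) <= D * psi S w.2.
  move=> /siegelP w0; rewrite /kerf -exprVn; apply: bound.
  by rewrite Re_rho ler_pM2r// -addrA lerDl addr_ge0 ?sqdist_ge0// ltW.
(* Tonelli's theorem is used for nonnegative functions only, so the real part [g]
   is shifted by its majorant [G], whose integral is subtracted at the end. *)
pose G (w : @Cn1 R n) := D * psi S w.2.
have mDpsi : measurable_fun setT (fun w => D * psi S w) by exact: measurable_funM.
have Dpsi0 w : 0 <= D * psi S w by rewrite mulr_ge0.
have mG : measurable_fun setT G.
  by apply: (measurableT_comp mDpsi); exact: measurable_snd.
have GE : (\int[dV n]_(w in @siegel R n) (G w)%:E = (D * (m * ln S * wallis n))%:E)%E.
  under eq_integral do rewrite EFinM.
  rewrite ge0_integralZl//; last 2 first.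
  - by apply/measurable_EFinP; apply: measurable_funTS; apply: (measurableT_comp (mpsi S)); exact: measurable_snd.
  - by move=> w _; rewrite lee_fin.
  by rewrite integral_psi// -EFinM.
have kfin : (\int[dV n]_(w in @siegel R n) (normc (kerf w))%:E < +oo)%E.
  apply: (@le_lt_trans _ _ (D * (m * ln S * wallis n))%:E); last exact: ltry.
  rewrite -GE; apply: le_ge0_integral => w Sw; rewrite lee_fin; first exact: normc_ge0.
  exact: kerf_le.
pose g w := Re (c * kerf w).
have mg : measurable_fun setT g.
  by apply: measurable_ReC; apply: measurable_funMC => //; exact: measurable_cst.
have c1 : normc c = 1 by exact: normc_cis.
have g_le w : siegel w -> `|g w| <= G w.
  by move=> Sw; rewrite (le_trans (normc_ge_Re _))// normcM c1 mul1r kerf_le.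
have iG : (dV n).-integrable (@siegel R n) (EFin \o G).
  apply/integrableP; split; first by apply/measurable_EFinP; exact: measurable_funTS.
  rewrite (_ : (\int[dV n]_(x in _) _)%E = (\int[dV n]_(w in @siegel R n) (G w)%:E)%E).
    by rewrite GE ltry.
  by apply: eq_integral => w _ /=; rewrite ger0_norm// /G.
have ig : (dV n).-integrable (@siegel R n) (EFin \o g).
  apply: (le_integrable mS _ _ iG).
    by apply/measurable_EFinP; exact: measurable_funTS.
  by move=> w Sw; rewrite /= lee_fin (le_trans (g_le w Sw))// ler_norm.
pose h0 (w : R[i]) := Re (c * test S w * (kernel_center z w)^-1 ^+ n.+2).
have mcenter : measurable_fun setT (kernel_center z).
  apply: measurable_funMC; first exact: measurable_cst.
  apply: measurable_funDC; first by apply: measurable_fun_conjC; exact: measurable_id.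
  exact: measurable_cst.
have mh0 : measurable_fun setT h0.
  apply: measurable_ReC; apply: measurable_funMC.
    by apply: measurable_funMC => //; exact: measurable_cst.
  by apply: measurable_funXC; exact: measurable_funVC.
have h0_le w : 0 < Im w -> `|h0 w| <= D * psi S w.
  move=> w0; rewrite (le_trans (normc_ge_Re _))// -mulrA normcM c1 mul1r mulrC.
  apply: bound; rewrite Re_kernel_center ler_pM2r//.
  by rewrite /height lerBlDr -addrA lerDl addr_ge0 ?sqnorm_ge0// ltW.
pose H w := g w + G w.
pose h (w : R[i]) := (h0 w + D * psi S w) * (m * Im w ^+ n).
have mH : measurable_fun setT H by exact: measurable_funD.
have mh : measurable_fun setT h.
  have h1 : measurable_fun setT (fun w => h0 w + D * psi S w) by exact: (measurable_funD mh0 mDpsi).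
  have h2 : measurable_fun setT (fun w : R[i] => m * Im w ^+ n).
    by apply: measurable_funM; [exact: measurable_cst|apply: measurable_funX; exact: measurable_Im].
  exact: (measurable_funM h1 h2).
have H0 w : siegel w -> 0 <= H w.
  by move=> /g_le; rewrite ler_norml => /andP[h1 _]; rewrite -lerBlDr sub0r.
have Hh (w : R[i]) : 0 < Im w -> (\int[tm]_(t in ball (Im w)) (H (t, w))%:E = (h w)%:E)%E.
  move=> w0; rewrite /h -(integral_kernel_slice (c * test S w) (D * psi S w) Sz w0).
  by apply: eq_integral => t _; rewrite /H /g /G /kerf -exprVn [X in c * X]mulrC mulrA.
have E1 := integral_siegel_slices mH mh H0 Hh.
(* In polar coordinates [K1] is the contribution of [g] and [K2] that of [G]. *)
pose K2 t x := pos_indic x * (pi ^+ n / n`!%:R * (x ^+ n.+1 * cosa t ^+ n.+2) * (D * psi S (polar (t, x)))).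
pose K1 t x := pos_indic x * (x * cosa t ^+ 2 * (h0 (polar (t, x)) * (m * Im (polar (t, x)) ^+ n))).
have HK t x : pos_indic x * (x * cosa t ^+ 2 * h (polar (t, x))) = K1 t x + K2 t x.
  by rewrite /K1 /K2 /h -/m Im_polar exprMn !exprS; ring.
have G2 : (\int[mu]_t \int[mu]_x (K2 t x)%:E = \int[dV n]_(w in @siegel R n) (G w)%:E)%E.
  by rewrite -(integral_siegel_radial n mDpsi Dpsi0).
have cosa0 t : 0 < cosa t :> R := cosa_gt0 t.
have K20 t x : 0 <= K2 t x.
  rewrite /K2 -/m; have [x0|x0] := ltP 0 x; last first.
    by rewrite (_ : pos_indic x = 0) ?mul0r// /pos_indic ltNge x0.
  apply: mulr_ge0 => //; apply: mulr_ge0 => //; apply: mulr_ge0; first exact: ltW.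
  by apply: mulr_ge0; apply: exprn_ge0; exact: ltW.
have mpol t : measurable_fun [set: R] (fun x : R => polar (t, x)).
  exact: (measurable_fun_pair2 t (@measurable_polar R)).
have mK1 t : measurable_fun [set: R] (K1 t).
  apply: measurable_funM; first exact: measurable_pos_indic.
  apply: measurable_funM; first exact: measurable_funM.
  apply: measurable_funM; first exact: (measurableT_comp mh0 (mpol t)).
  apply: measurable_funM; first exact: measurable_cst.
  by apply: measurable_funX; exact: (measurableT_comp measurable_Im (mpol t)).
have mK2 : measurable_fun setT (fun x : R * R => K2 x.1 x.2).
  apply: measurable_funM; first exact: (measurableT_comp measurable_pos_indic (@measurable_snd _ _ _ _)).
  apply: measurable_funM.
    apply: measurable_funM => //; apply: measurable_funM.
      by apply: measurable_funX; exact: measurable_snd.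
    by apply: measurable_funX; exact: (measurableT_comp measurable_cosa (@measurable_fst _ _ _ _)).
  have := measurableT_comp mDpsi (@measurable_polar R).
  by rewrite (_ : _ \o _ = fun x : R * R => D * psi S (polar (x.1, x.2)))//; apply/funext => -[].
have K12 t x : `|K1 t x| <= K2 t x.
  have [x0|x0] := ltP 0 x; last first.
    by rewrite /K1 /K2 (_ : pos_indic x = 0) ?mul0r ?normr0// /pos_indic ltNge x0.
  have i0 : 0 < Im (polar (t, x)) by rewrite Im_polar mulr_gt0.
  have c0' : 0 <= pos_indic x * (x * cosa t ^+ 2 * (m * Im (polar (t, x)) ^+ n)).
    apply: mulr_ge0 => //; apply: mulr_ge0; last by rewrite mulr_ge0 ?(ltW m0)// exprn_ge0// ltW.
    by rewrite mulr_ge0 ?(ltW x0)// sqr_ge0.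
  have -> : K1 t x = pos_indic x * (x * cosa t ^+ 2 * (m * Im (polar (t, x)) ^+ n)) * h0 (polar (t, x)).
    by rewrite /K1; ring.
  have -> : K2 t x = pos_indic x * (x * cosa t ^+ 2 * (m * Im (polar (t, x)) ^+ n)) * (D * psi S (polar (t, x))).
    by rewrite /K2 -/m Im_polar exprMn !exprS; ring.
  by rewrite normrM (ger0_norm c0') ler_wpM2l// h0_le.
have iK2 t : mu.-integrable [set: R] (EFin \o K2 t).
  apply/integrableP; split; first by apply/measurable_EFinP; exact: (measurable_fun_pair2 t mK2).
  rewrite (eq_integral_line (g := fun x => (m * cosa t ^+ n.+2 * D * (itv_indic 1 S x * x^-1))%:E)); last first.
    move=> x /=; rewrite ger0_norm//; congr EFin; rewrite /K2 -/m; have [x0|x0] := ltP 0 x; last first.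
      rewrite (_ : pos_indic x = 0); last by rewrite /pos_indic ltNge x0.
      rewrite (_ : itv_indic 1 S x = 0) ?mul0r ?mulr0//.
      by rewrite /itv_indic leNgt (le_lt_trans x0 ltr01).
    rewrite (_ : pos_indic x = 1); last by rewrite /pos_indic x0.
    rewrite psi_polar// mul1r.
    have -> : x^-1 ^+ n.+2 = x^-1 ^+ n.+1 * x^-1 by rewrite exprSr.
    have xx : x ^+ n.+1 * x^-1 ^+ n.+1 = 1 by rewrite -exprMn divff ?expr1n// gt_eqF.
    by rewrite -[RHS]mulr1 -xx; ring.
  have mi : measurable_fun [set: R] (fun x => itv_indic 1 S x * x^-1).
    by apply: measurable_funM; [exact: measurable_itv_indic|exact: measurable_funVr].
  have i0 x : 0 <= itv_indic 1 S x * x^-1.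
    exact: itv_indic_inv_ge0.
  have cc : 0 <= m * cosa t ^+ n.+2 * D.
    apply: mulr_ge0 => //; apply: mulr_ge0; first exact: ltW.
    by apply: exprn_ge0; exact: ltW.
  by rewrite (ge0_integral_EFinZl mu cc mi i0) (integral_itv_inv ltr01 S1) -EFinM ltry.
have iK1 t : mu.-integrable [set: R] (EFin \o K1 t).
  apply: (le_integrable measurableT _ _ (iK2 t)); first by apply/measurable_EFinP; exact: mK1.
  by move=> x _; rewrite /= lee_fin (le_trans (K12 t x))// ler_norm.
pose L := m * 2 ^+ n.+2 * B * eta * r `^ (- k).
have B0 : 0 <= B by apply: Rintegral_ge0 => x _; rewrite mulr_ge0 ?powR_ge0.
have L0 : 0 <= L.
  apply: mulr_ge0; last exact: powR_ge0.
  apply: mulr_ge0 => //; apply: mulr_ge0 => //; apply: mulr_ge0; first exact: ltW.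
  exact: exprn_ge0.
have K1_ge t : ((L * cosa t ^+ n.+2)%:E <= \int[mu]_x (K1 t x)%:E)%E.
  set th := atan t + atan t'.
  pose L1 := m * cosa t ^+ n.+2 * 2 ^+ n.+2 * (r `^ (a - 1) * r^-1 ^+ n.+2).
  have mK1E : measurable_fun [set: R] (fun x => (K1 t x)%:E) by apply/measurable_EFinP; exact: mK1.
  rewrite (integral_affine_signed 0 r0 mK1E).
  pose rot y := itv_indic r^-1 (S / r) y * Re (rotated a n.+2 th y).
  rewrite (eq_integral_line (g := fun y => (pos_indic y * (L1 * rot y))%:E)); last first.
    move=> y; rewrite addr0; congr EFin; rewrite /K1.
    rewrite (_ : pos_indic (r * y) = pos_indic y); last by rewrite /pos_indic pmulr_rgt0.
    have [y0|y0] := ltP 0 y; last by rewrite (_ : pos_indic y = 0) ?mul0r// /pos_indic ltNge y0.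
    congr (_ * _); have x0 : 0 < r * y by rewrite mulr_gt0.
    have hX : c * test S (polar (t, r * y)) * (kernel_center z (polar (t, r * y)))^-1 ^+ n.+2 =
        (itv_indic 1 S (r * y) * (r * y) `^ (- k) * (2 / r) ^+ n.+2 * (y `^ (a - 1))^-1)%:C%C *
        rotated a n.+2 th y.
      rewrite test_polar// (kernel_center_polar t (r * y) r0 zE) (_ : r * y / r = y); last first.
        by rewrite mulrAC divff ?mul1r// gt_eqF.
      rewrite -/th !invfM !exprMn /rotated.
      have cV (x : R) : (cis x)^-1 = cis (- x).
        have nz : cis x != 0 by rewrite -normc_eq0 normc_cis oner_neq0.
        have e : cis x * cis (- x) = 1 by rewrite -cisD subrr cis0.
        by rewrite -[LHS]mulr1 -e mulKf.
      rewrite cV opprK -cis_nat.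
      have h2 : ((r / 2)%:C%C)^-1 ^+ n.+2 = (2 ^+ n.+2 * r^-1 ^+ n.+2)%:C%C.
        by rewrite -(fmorphV (real_complex R)) -(rmorphXn (real_complex R)) invf_div exprMn.
      have hc : c * cis (a * atan t) * cis (n.+2%:R * atan t') = cis (a * th).
        by rewrite /c -!cisD; congr cis; rewrite /th -ak; ring.
      have hy : ((y `^ (a - 1))^-1)%:C%C * (y `^ (a - 1))%:C%C = 1 :> R[i].
        by rewrite -(rmorphM (real_complex R)) mulVf ?(rmorph1 (real_complex R))// gt_eqF// powR_gt0.
      have e2 (x1 x2 : R) : (x1 * x2)%:C%C = x1%:C%C * x2%:C%C by exact: (rmorphM (real_complex R)).
      have e4 (x1 x2 x3 x4 : R) :
          (x1 * x2 * x3 * x4)%:C%C = x1%:C%C * x2%:C%C * x3%:C%C * x4%:C%C by rewrite !e2.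
      have r9 (v1 v2 v3 v4 v5 v6 v7 v8 v9 : R[i]) : v8 * v9 = 1 ->
          v1 * (v2 * v3 * v4) * (v5 * v6 * v7) = v2 * v3 * v5 * v8 * (v1 * v4 * v6 * v9 * v7).
        move=> v89; rewrite -[LHS]mulr1 -v89; ring.
      by rewrite h2 -hc e4 (e2 (itv_indic _ _ _)); exact: r9.
    rewrite /h0 hX ReMr Im_polar /rot.
    have hi : itv_indic 1 S (r * y) = itv_indic r^-1 (S / r) y.
      rewrite /itv_indic (_ : (r * y <= S) = (y <= S / r)); last by rewrite ler_pdivlMr// mulrC.
      by rewrite (_ : (1 <= r * y) = (r^-1 <= y))// -[r^-1]mul1r ler_pdivrMr// mulrC.
    have hp : (r * y) `^ (- k) * (r * y) ^+ n.+1 * (y `^ (a - 1))^-1 = r `^ (a - 1).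
      rewrite -powR_mulrn ?(ltW x0)// -powRD ?(gt_eqF x0) ?implybT//.
      rewrite (_ : - k + n.+1%:R = a - 1) ?powRM ?(ltW r0) ?(ltW y0)//.
        by rewrite mulfK// gt_eqF// powR_gt0.
      by have := ak; rewrite -natr1 => h1; apply: (addrI k); rewrite addNKr addrA [k + a]addrC h1 addrK.
    rewrite hi /L1 -hp; move: (itv_indic _ _ _) (Re _) => I0 V.
    move: (r * y) => x; rewrite !exprMn !exprS; ring.
  have ir : mu.-integrable pos (EFin \o (fun x => Re (rotated a n.+2 th x))).
    have thpi : `|th| < pi.
      have h1 : `|atan t| < pi / 2 by rewrite ltr_norml atan_gtNpi2 atan_ltpi2.
      have h2 : `|atan t'| < pi / 2 by rewrite ltr_norml atan_gtNpi2 atan_ltpi2.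
      by rewrite (le_lt_trans (ler_normD _ _))// [pi]splitr ltrD.
    have := integrable_rotated a0 aN 1 thpi.
    by apply: eq_integrable => [|x _ /=]; [exact: measurable_pos|rewrite mul1r].
  have irot : mu.-integrable pos (EFin \o rot).
    apply: (integrable_pos_le (g := fun x => `|Re (rotated a n.+2 th x)|)).
    - apply: measurable_funTS; apply: measurable_funM; first exact: measurable_itv_indic.
      by apply: measurable_ReC; exact: measurable_rotated.
    - exact: (integrable_abse ir).
    - by move=> x x0; rewrite normrM ger0_norm// ler_piMl// itv_indic_le1.
  rewrite integral_pos_indic; under eq_integral do rewrite EFinM.
  rewrite (integralZl measurable_pos irot L1) muleA -EFinM.
  have rL : L * cosa t ^+ n.+2 = r * L1 * (eta * B).
    have e : r * (r `^ (a - 1) * r^-1 ^+ n.+2) = r `^ (- k).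
      rewrite mulrA -(powR_pred a r0) exprVn -powR_invn ?(ltW r0)//.
      by rewrite -powRD ?(gt_eqF r0) ?implybT// -ak opprD addNKr.
    by rewrite /L -e /L1; ring.
  rewrite rL (EFinM (r * L1)); apply: lee_wpmul2l.
    rewrite lee_fin; apply: mulr_ge0; first exact: ltW.
    apply: mulr_ge0; last by rewrite mulr_ge0 ?powR_ge0// exprn_ge0// invr_ge0 ltW.
    apply: mulr_ge0; last exact: exprn_ge0.
    by apply: mulr_ge0; [exact: ltW|apply: exprn_ge0; exact: ltW].
  rewrite (@le_trans _ _ (B - angle_const T * (B - \int[mu]_(x in pos) (itv_indic M^-1 M x * b x)))%:E)//.
  apply: rotated_itv_ge => //; first by rewrite lef_pV2// posrE.
  by rewrite ler_pdivlMr// mulrC.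
have LB t : ((L * cosa t ^+ n.+2)%:E + \int[mu]_x (K2 t x)%:E <=
    \int[mu]_x (pos_indic x * (x * cosa t ^+ 2 * h (polar (t, x))))%:E)%E.
  rewrite (eq_integral_line (f := fun x => (pos_indic x * (x * cosa t ^+ 2 * h (polar (t, x))))%:E)
    (g := fun x => ((EFin \o K1 t) x + (EFin \o K2 t) x)%E)); last by move=> x; rewrite HK.
  by rewrite (integralD measurableT (iK1 t) (iK2 t)); apply: leeD2r; exact: K1_ge.
have mK2E : measurable_fun setT (fun x : R * R => (K2 x.1 x.2)%:E) by apply/measurable_EFinP.
have K20E t x : (0 <= (K2 t x)%:E)%E by rewrite lee_fin.
have mcosN : measurable_fun [set: R] (fun t : R => cosa t ^+ n.+2).
  by apply: measurable_funX; exact: measurable_cosa.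
have E2 : ((L * wallis n)%:E + \int[dV n]_(w in @siegel R n) (G w)%:E <=
    \int[dV n]_(w in @siegel R n) (H w)%:E)%E.
  rewrite E1 -G2 EFinM -integral_cosa -(ge0_integral_EFinZl mu L0 mcosN); last first.
    by move=> t; apply: exprn_ge0; exact: ltW.
  rewrite -ge0_integralD//; last 4 first.
  - by move=> t _; rewrite lee_fin; apply: mulr_ge0 => //; apply: exprn_ge0; exact: ltW.
  - by apply/measurable_EFinP; exact: measurable_funM.
  - by move=> t _; exact: integral_ge0.
  - exact: (@measurable_ge0_integral _ _ _ _ _ mu (fun t x => (K2 t x)%:E)).
  apply: le_ge0_integral => t _; last exact: LB.
  apply: adde_ge0; last exact: integral_ge0.
  by rewrite lee_fin; apply: mulr_ge0 => //; apply: exprn_ge0; exact: ltW.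
have HE : (\int[dV n]_(w in @siegel R n) (H w)%:E =
    \int[dV n]_(w in @siegel R n) (g w)%:E + \int[dV n]_(w in @siegel R n) (G w)%:E)%E.
  by rewrite -(integralD mS ig iG).
have gL : L * wallis n <= \int[dV n]_(w in @siegel R n) g w.
  move: E2; rewrite HE GE -(fineK (integrable_fin_num mS ig)) -!EFinD lee_fin lerD2r.
  exact.
have c00 : 0 <= c0 by apply: divr_ge0 => //; apply: mulr_ge0 => //; apply: exprn_ge0; exact: pi_ge0.
rewrite /bergman_projection normcM normc_real -/c0 (ger0_norm c00).
rewrite (_ : c0 * m * _ * _ * _ * _ * _ = c0 * (L * wallis n)); last by rewrite /L; ring.
apply: ler_wpM2l => //; apply: (le_trans gL).
rewrite -(Re_cintegralM c mS (measurable_funTS mkerf) kfin).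
by rewrite (le_trans (ler_norm _))// (le_trans (normc_ge_Re _))// normcM c1 mul1r.
Qed.

Let K : R := Gamma k * Gamma a / Gamma (n.+2%:R / 2) ^+ 2.

Let KE : c0 * m * 2 ^+ n.+2 * wallis n * B = K.
Proof.
have W := @wallis_Gamma R n.
have G0 : Gamma (n.+2%:R / 2 : R) ^+ 2 != 0.
  apply/eqP => G0; move: W; rewrite G0 mulr0 => /esym/eqP.
  by rewrite mulf_eq0 gt_eqF ?pi_gt0//= pnatr_eq0 -leqn0 leqNgt fact_gt0.
have f0 : n.+1`!%:R != 0 :> R by rewrite pnatr_eq0 -lt0n fact_gt0.
have n0 : n`!%:R != 0 :> R by rewrite pnatr_eq0 -lt0n fact_gt0.
have pi0 : (pi : R) != 0 by rewrite gt_eqF// pi_gt0.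
have P0 : pi ^+ n != 0 :> R by rewrite expf_neq0.
have {}W := canRL (mulfK G0) W.
rewrite BE /K /c0 /m (exprS 2) (exprS 2) (exprS pi).
have -> : n.+1`!%:R / (4 * (pi * pi ^+ n)) * (pi ^+ n / n`!%:R) * (2 * (2 * 2 ^+ n)) *
    wallis n * (Gamma a * Gamma k / n.+1`!%:R) =
    (wallis n * 2 ^+ n) * (pi ^+ n / (pi * pi ^+ n) / n`!%:R * (Gamma a * Gamma k)) :> R.
  move: (n.+1`!%:R : R) f0 (n`!%:R : R) n0 (pi : R) pi0 (pi ^+ n) P0 => u u0 v v0 x x0 P P0.
  by field; rewrite u0 v0 ?P0 ?x0.
rewrite W; move: (pi : R) pi0 (pi ^+ n) P0 (Gamma _ ^+ 2) G0 => x x0 P P0 g g0.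
move: (n`!%:R : R) n0 => v v0; by field; rewrite ?g0 ?P0 ?x0 ?v0.
Qed.

Let b_ge0 x : 0 <= b x. Proof. by rewrite mulr_ge0 ?powR_ge0. Qed.

Let B_ge0 : 0 <= B. Proof. by apply: Rintegral_ge0 => x _. Qed.

(** The tail of the convergent integral [B] is small for a large cut-off. *)
Let exists_cutoff (T eta : R) : 0 < eta -> eta < 1 -> exists j : nat,
  eta * B <= B - angle_const T *
    (B - \int[mu]_(x in pos) (itv_indic (j.+2%:R)^-1 j.+2%:R x * b x)).
Proof.
move=> eta0 eta1.
have C0 : 0 <= angle_const T by apply: exprn_ge0; rewrite invr_ge0 sqrtr_ge0.
have C1 : 0 < angle_const T + 1 by rewrite ltr_wpDl.
have mb : measurable_fun [set: R] b.
  by apply: measurable_funM; [exact: measurable_powR_in|exact: measurable_powRD_in].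
have ind j : \int[mu]_(x in pos) (itv_indic (j.+2%:R)^-1 j.+2%:R x * b x) =
    fine (\int[mu]_(x in pos_itv j) (b x)%:E)%E.
  rewrite /Rintegral -integral_pos_indic -integral_itv_indic; apply: (congr1 fine).
  apply: eq_integral => x _; congr EFin; have [x0|x0] := ltP 0 x.
    by rewrite (_ : pos_indic x = 1) ?mul1r// /pos_indic x0.
  rewrite (_ : itv_indic _ _ x = 0) ?mul0r ?mulr0//.
  by rewrite /itv_indic leNgt (le_lt_trans x0)// invr_gt0.
have [B0|B0] := eqVneq B 0.
  exists 0%N; rewrite B0 mulr0 !sub0r mulrN opprK mulr_ge0//.
  by apply: Rintegral_ge0 => x _; rewrite mulr_ge0.
have Bp : 0 < B by rewrite lt_neqAle eq_sym B0 B_ge0.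
pose d := (1 - eta) * B / (angle_const T + 1).
have d0 : 0 < d by rewrite divr_gt0// mulr_gt0// subr_gt0.
have bB : (\int[mu]_(x in \bigcup_j pos_itv j) (b x)%:E = B%:E)%E.
  by rewrite bigcup_pos_itv /B /Rintegral fineK//; exact: (integrable_fin_num measurable_pos ib).
have mI j : measurable (pos_itv j : set (measurableTypeR R)) by exact: measurable_itv.
have h := @exists_integral_ge R _ _ mu (@pos_itv R) b B d.
have [j hj] := h (@nondecreasing_pos_itv R) mI d0 mb b_ge0 bB.
exists j; rewrite ind.
have fj : (\int[mu]_(x in pos_itv j) (b x)%:E)%E \is a fin_num.
  apply: integrable_fin_num => //; apply: (integrableS measurable_pos (mI j) _ ib).
  by rewrite -bigcup_pos_itv; exact: bigcup_sup.
move: hj; rewrite -(fineK fj) lee_fin; move: (fine _) => X hX.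
rewrite lerBrDr -lerBrDl -{2}[B]mul1r -mulrBl.
rewrite (@le_trans _ _ (angle_const T * d))//.
  by rewrite ler_wpM2l// lerBlDr addrC -lerBlDr.
rewrite /d mulrA ler_pdivrMr// mulrC ler_wpM2l ?lerDl//.
by rewrite mulr_ge0// subr_ge0 ltW.
Qed.

Let psi_Lp_norm (S : R) : 1 < S ->
  Lp_norm p (fun w : @Cn1 R n => test S w.2) = ((m * ln S * wallis n) `^ p^-1)%:E.
Proof.
move=> S1; rewrite /Lp_norm -poweR_EFin -integral_psi//.
by congr (_ `^ _)%E; apply: eq_integral => w _; rewrite normc_test.
Qed.

(** The three factors [eta] pay for the truncation of the radial integral, of the
  range of slopes and of the range of radii.  The exponent [1 / p] only improves
  the last two. *)
Let Lp_norm_projection_ge (eta : R) : 0 < eta -> eta < 1 -> exists S : R, 1 < S /\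
  ((K * eta ^+ 3 * (m * ln S * wallis n) `^ p^-1)%:E <=
   Lp_norm p (bergman_projection (fun w : @Cn1 R n => test S w.2)))%E.
Proof.
move=> eta0 eta1; have J0 := @wallis_gt0 R n.
have e1 : 0 < 1 - eta by rewrite subr_gt0.
pose D (j : nat) : set (measurableTypeR R) := `[(- j%:R)%R, j%:R]%classic.
have mD j : measurable (D j) by exact: measurable_itv.
have nD : nondecreasing_seq D.
  move=> i j ij; apply/subsetPset => x; rewrite /D /= !in_itv/= => /andP[h1 h2].
  have hij : i%:R <= j%:R :> R by rewrite ler_nat.
  by rewrite (le_trans h2 hij) andbT (le_trans _ h1)// lerN2.
have DT : \bigcup_j D j = setT.
  apply/seteqP; split=> // x _; exists (Num.bound `|x|) => //; rewrite /D /= in_itv/=.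
  by rewrite -ler_norml ltW// archi_boundP.
have mcosN : measurable_fun [set: R] (fun t : R => cosa t ^+ n.+2).
  by apply: measurable_funX; exact: measurable_cosa.
have cos0 (t : R) : 0 <= cosa t ^+ n.+2 by apply: exprn_ge0; exact/ltW/cosa_gt0.
have cosJ : (\int[mu]_(t in \bigcup_j D j) (cosa t ^+ n.+2)%:E = (wallis n)%:E)%E.
  by rewrite DT integral_cosa.
have h := @exists_integral_ge R _ _ mu D (fun t => cosa t ^+ n.+2) (wallis n) ((1 - eta) * wallis n).
have [i hi] := h nD mD (mulr_gt0 e1 J0) mcosN cos0 cosJ.
have {}hi : ((eta * wallis n)%:E <= \int[mu]_(t in D i) (cosa t ^+ n.+2)%:E)%E.
  by rewrite (le_trans _ hi)// lee_fin mulrBl mul1r opprB addrC subrK.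
have [j hj] := exists_cutoff i%:R eta0 eta1.
pose M : R := j.+2%:R; have M0 : 0 < M by [].
have M1 : 1 < M by rewrite ltr1n.
have lM : 0 < ln M by rewrite ln_gt0.
(* With this [N], [ln (S / M) - ln M = (N - 2) * ln M] is at least
   [eta * ln S]. *)
pose N := (Num.bound (2 / (1 - eta))).+3.
have hN : 2 <= N%:R * (1 - eta).
  have d0 : 0 <= 2 / (1 - eta) by rewrite divr_ge0// ltW.
  rewrite -ler_pdivrMr//; apply: (le_trans (ltW (archi_boundP d0))).
  by rewrite ler_nat /N -addn3 leq_addr.
pose S := M ^+ N.
have S1 : 1 < S by rewrite exprn_egt1.
have S0 : 0 < S by rewrite (lt_trans ltr01).
have SM : M < S / M.
  rewrite ltr_pdivlMr// -expr2 /S (_ : N = (N - 2 + 2)%N); last by rewrite subnK.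
  rewrite exprD -[X in X < _]mul1r ltr_pM2r ?exprn_gt0// exprn_egt1//.
have lnS : ln S = N%:R * ln M by rewrite /S lnXn// mulr_natl.
exists S; split => //.
have K0 : 0 <= K.
  rewrite -KE; apply: mulr_ge0 => //; apply: mulr_ge0; last exact: ltW.
  apply: mulr_ge0; last exact: exprn_ge0.
  apply: mulr_ge0; last exact: ltW.
  by apply: divr_ge0 => //; apply: mulr_ge0 => //; apply: exprn_ge0; exact: pi_ge0.
pose X := m * ln S * wallis n.
have X0 : 0 <= X.
  by apply: mulr_ge0; [apply: mulr_ge0; [exact: ltW|rewrite ln_ge0// ltW]|exact: ltW].
pose f := bergman_projection (fun w : @Cn1 R n => test S w.2).
have I1 : (((K * eta) `^ p * (eta ^+ 2 * X))%:E <=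
    \int[dV n]_(w in @siegel R n) (normc (f w) `^ p)%:E)%E.
  have Ke0 : 0 <= K * eta by rewrite mulr_ge0// ltW.
  apply: (@le_trans _ _ (\int[dV n]_(w in @siegel R n) ((K * eta) `^ p *
     (itv_indic M (S / M) (normc w.2) * itv_indic (- i%:R) i%:R (Re w.2 / Im w.2) *
      (normc w.2)^-1 ^+ n.+2))%:E)%E); last first.
    apply: le_ge0_integral => w Sw.
      rewrite lee_fin; apply: mulr_ge0; first exact: powR_ge0.
      apply: mulr_ge0; first exact: mulr_ge0.
      by apply: exprn_ge0; rewrite invr_ge0; exact: normc_ge0.
    rewrite lee_fin; have w0 : 0 < Im w.2 by rewrite (le_lt_trans _ Sw)// sumr_ge0// => l _; exact: sqr_ge0.
    rewrite {1}/itv_indic; case: (boolP (M <= normc w.2 <= S / M)) => [/andP[h1 h2]|_]; last first.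
      by rewrite !mul0r mulr0 powR_ge0.
    rewrite mul1r /itv_indic; case: (boolP (- i%:R <= Re w.2 / Im w.2 <= i%:R)) => [ht|_]; last first.
      by rewrite !mul0r mulr0 powR_ge0.
    rewrite mul1r; have r0 : 0 < normc w.2 by exact: lt_le_trans h1.
    have -> : (normc w.2)^-1 ^+ n.+2 = (normc w.2 `^ (- k)) `^ p.
      by rewrite -powRrM mulNr divfK ?gt_eqF// powRN powR_mulrn ?(ltW r0)// exprVn.
    rewrite -powRM ?powR_ge0// ge0_ler_powR ?nnegrE ?(ltW p0)//; last first.
      have := projection_ge Sw (polar_repr w0) _ M0 h1 _ S1 (ltW M1) (ltW eta0) hj.
      rewrite KE; apply; first by rewrite ler_norml.
      by rewrite -ler_pdivlMr.
    - exact: normc_ge0.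
    - by rewrite mulr_ge0 ?powR_ge0.
  under eq_integral do rewrite EFinM.
  rewrite ge0_integralZl//; last 4 first.
  - exact: measurable_siegel.
  - apply/measurable_EFinP; apply: measurable_funTS.
    have m2 : measurable_fun [set: @Cn1 R n] (fun w : @Cn1 R n => w.2) by exact: measurable_snd.
    have mn := measurableT_comp mnormc m2.
    apply: measurable_funM; last by apply: measurable_funX; exact: measurable_funVr.
    apply: measurable_funM; first exact: (measurableT_comp (measurable_itv_indic _ _) mn).
    exact: (measurableT_comp (measurable_itv_indic _ _) (measurableT_comp mslope m2)).
  - move=> w _; rewrite lee_fin; apply: mulr_ge0; first exact: mulr_ge0.
    by apply: exprn_ge0; rewrite invr_ge0; exact: normc_ge0.
  - by rewrite lee_fin powR_ge0.
  rewrite (EFinM ((K * eta) `^ p)); apply: lee_wpmul2l; first by rewrite lee_fin powR_ge0.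
  rewrite (integral_psi_itv i%:R M0 SM).
  have lnSM : eta * ln S <= ln (S / M) - ln M.
    rewrite ln_div ?posrE// lnS -addrA -opprD -mulr2n -[ln M *+ 2]mulr_natl -mulrBl.
    rewrite mulrA ler_wpM2r ?(ltW lM)// lerBrDr -lerBrDl.
    by rewrite (_ : N%:R - eta * N%:R = N%:R * (1 - eta)) //; ring.
  apply: (@le_trans _ _ ((m * (eta * ln S))%:E * (eta * wallis n)%:E)%E).
    by rewrite -EFinM lee_fin /X le_eqVlt; apply/orP; left; apply/eqP; ring.
  apply: lee_pmul => //.
  - by rewrite lee_fin mulr_ge0 ?(ltW m0)// mulr_ge0 ?(ltW eta0)// ln_ge0// ltW.
  - by rewrite lee_fin mulr_ge0 ?(ltW eta0)// ltW.
  - by rewrite lee_fin ler_wpM2l// ltW.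
have pV0 : 0 < p^-1 by rewrite invr_gt0.
have Ke0 : 0 <= K * eta by rewrite mulr_ge0// ltW.
rewrite /Lp_norm -/f; apply: (@le_trans _ _ (((K * eta) `^ p * (eta ^+ 2 * X))%:E `^ p^-1)%E).
  have hX : 0 <= eta ^+ 2 * X by apply: mulr_ge0 => //; exact: sqr_ge0.
  rewrite poweR_EFin lee_fin -[m * ln S * wallis n]/X.
  rewrite (@powRM R _ _ _ (powR_ge0 _ _) hX) -powRrM divff ?gt_eqF// powRr1//.
  rewrite (@powRM R _ _ _ (sqr_ge0 eta) X0).
  rewrite (_ : K * eta ^+ 3 * _ = K * eta * (eta ^+ 2 * X `^ p^-1)); last by rewrite exprS; ring.
  rewrite ler_wpM2l// ler_wpM2r ?powR_ge0//.
  apply: ger1_powR; last by rewrite invf_le1// ltW.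
  by rewrite exprn_gt0//= exprn_ile1// ltW.
rewrite gt0_ler_poweR ?(ltW pV0)// in_itv; apply/andP; (split; last exact: leey); rewrite lteifT.
  rewrite lee_fin; apply: mulr_ge0; first exact: powR_ge0.
  by apply: mulr_ge0 => //; exact: sqr_ge0.
by apply: integral_ge0 => w _; rewrite lee_fin powR_ge0.
Qed.

(** The ratio of the norms for the test function given by
  [Lp_norm_projection_ge] is at least [eta ^+ 3 * K]. *)
Lemma bergman_opnorm_ge : (K%:E <= bergman_opnorm n p)%E.
Proof.
have J0 := @wallis_gt0 R n.
have K0 : 0 <= K.
  rewrite -KE; apply: mulr_ge0 => //; apply: mulr_ge0; last exact: ltW.
  apply: mulr_ge0; last exact: exprn_ge0.
  apply: mulr_ge0; last exact: ltW.
  by apply: divr_ge0 => //; apply: mulr_ge0 => //; apply: exprn_ge0; exact: pi_ge0.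
apply/lee_mul01Pr; first by rewrite lee_fin.
move=> e /andP[e0 e1]; pose eta := e `^ 3^-1.
have eta0 : 0 < eta by rewrite powR_gt0.
have etaE : eta ^+ 3 = e.
  by rewrite -powR_mulrn ?(ltW eta0)// -powRrM mulVf// powRr1// ltW.
have eta1 : eta < 1.
  by move: e1; rewrite -etaE; apply: contraTT; rewrite -!leNgt; exact: exprn_ege1.
have [S [S1 hS]] := Lp_norm_projection_ge eta0 eta1.
set f := (fun w : @Cn1 R n => test S w.2) in hS.
have X0 : 0 < m * ln S * wallis n by rewrite mulr_gt0// mulr_gt0// ln_gt0.
have Y0 : 0 < (m * ln S * wallis n) `^ p^-1 by rewrite powR_gt0.
have mf : measurable_fun setT f.
  by apply: (measurableT_comp (mtest S)); exact: measurable_snd.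
apply: (@le_trans _ _ (Lp_norm p (bergman_projection f) / Lp_norm p f)%E).
  rewrite (psi_Lp_norm S1) inver gt_eqF// lee_pdivlMr// -!EFinM -etaE.
  by rewrite [eta ^+ 3 * K]mulrC.
apply: ereal_sup_ubound; exists f => //; split.
  by split; [exact: measurable_funTS|rewrite (psi_Lp_norm S1) ltry].
move=> f0; have : (\int[dV n]_(w in @siegel R n) (psi S w.2)%:E = 0)%E.
  rewrite -(integral0 (dV n) (@siegel R n)); apply: ae_eq_integral => //.
  - exact: measurable_siegel.
  - by apply/measurable_EFinP; apply: measurable_funTS; apply: (measurableT_comp (mpsi S)); exact: measurable_snd.
  - apply: filterS f0 => w h Sw; rewrite /psi -normc_test -[test S w.2]/(f w) h//.
    by rewrite ComplexField.Normc.normc0 powR0// gt_eqF.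
by rewrite integral_psi// => /eqP; rewrite eqe gt_eqF.
Qed.

End lower_bound.

Theorem theorem1 (R : realType) (n : nat) (p q : R) (hp : 1 < p)
    (hq : q = p / (p - 1)) :
  ((Gamma (n.+2%:R / p) * Gamma (n.+2%:R / q) / Gamma (n.+2%:R / 2) ^+ 2)%:E
     <= bergman_opnorm n p)%E /\
  (bergman_opnorm n p
     <= (n.+1`!%:R / Gamma (n.+2%:R / 2) ^+ 2 * (pi / sin (pi / p)))%:E)%E.
Proof.
by split; [exact: bergman_opnorm_ge hp hq|exact: bergman_opnorm_le hp hq].
Qed.
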